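(* Let $d\ge 1$ be a fixed constant, and let $P$ and $Q$ be $d$-dimensional polygonal curves with $n$ vertices each. Let $\alpha\in[1,n]$ and $\delta\ge 0$. In $O(n)$ time, one can construct curves $\hat P$ and $\hat Q$ such that, for each of the $d$ coordinate axes, the projections of $\hat P$ and of $\hat Q$ onto that axis each have at most $2n/\alpha$ monotone pieces that are $2\delta$-short. Furthermore, $$d_F(\hat P,\hat Q)\;\le\; d_F(P,Q)\;\le\; d_F(\hat P,\hat Q)+2\alpha\delta .$$
   Context: A $d$-dimensional (polygonal) curve with vertices $p_1,\dots,p_n$ is a piecewise-linear function $P\colon[0,1]\to\mathbb{R}^d$ connecting the points $p_1,\dots,p_n$ in order by line segments. Fr\'echet distance: a reparameterization is a non-decreasing surjection $[0,1]\to[0,1]$. A matching between $P$ and $Q$ is a pair $(f,g)$ of reparameterizations; its cost is $\max_t\lVert P(f(t))-Q(g(t))\rVert_\infty$ (the $L_\infty$ norm is used throughout). $d_F(P,Q)$ is the minimum cost over all matchings. Monotone pieces: a curve is monotone if each of its coordinates is non-increasing or non-decreasing. The monotone pieces of a curve are obtained greedily: the first is the maximal monotone subcurve starting at parameter $0$, and each next one is the maximal monotone subcurve starting at the endpoint of the previous one. The projection of a curve onto a coordinate axis is the one-dimensional curve given by that coordinate. A monotone piece of a one-dimensional curve is $2\delta$-short if its arc-length is at most $2\delta$. Constants hidden in $O(\cdot)$ may depend on $d$. Running time is counted in unit-cost operations on real numbers. *)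

(* Defs.v *)
From HB Require Import structures.
From mathcomp Require Import all_boot all_order all_algebra.
From mathcomp Require Import all_classical all_reals all_analysis.

Set Implicit Arguments.
Unset Strict Implicit.
Unset Printing Implicit Defensive.

Import Order.TTheory GRing.Theory Num.Theory.
Import numFieldNormedType.Exports.

Local Open Scope classical_set_scope.
Local Open Scope ring_scope.

(** * Curves *)

(* A nonempty vertex sequence p_0, ..., p_m is traversed with uniform speed in
   the index: the k-th edge is run through during [k/m, (k+1)/m].  Everything
   below is invariant under reparameterization, so this is only a choice of
   representative.  A single vertex gives the constant curve.  At t = 1 the
   out-of-range vertex p_(m+1) (read as 0) has coefficient 0; values outside
   [0, 1] are never used. *)
Definition curve (R : realType) (d : nat) (p : seq 'rV[R]_d) (t : R) : 'rV[R]_d :=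
  let u := t * (size p).-1%:R in
  let k := Num.truncn u in
  (1 - (u - k%:R)) *: p`_k + (u - k%:R) *: p`_k.+1.

Definition projection (R : realType) (d : nat) (P : R -> 'rV[R]_d) (j : 'I_d) : R -> R :=
  fun t => P t ord0 j.

(** * Fréchet distance *)

Definition reparameterization (R : realType) (f : R -> R) : Prop :=
  {in `[0, 1] &, {homo f : x y / x <= y}} /\ f @` `[0, 1]%classic = `[0, 1]%classic.

(* The norm on row vectors is the library's, i.e. the maximum of the absolute
   values of the entries. *)
Definition matching_cost (R : realType) (d : nat) (P Q : R -> 'rV[R]_d)
    (f g : R -> R) : R :=
  sup [set `|P (f t) - Q (g t)| | t in `[0, 1]%classic].

Definition frechet (R : realType) (d : nat) (P Q : R -> 'rV[R]_d) : R :=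
  inf [set c | exists f g : R -> R,
    [/\ reparameterization f, reparameterization g & c = matching_cost P Q f g]].

(** * Monotone pieces of a one-dimensional curve *)

Definition monotone_on (R : realType) (c : R -> R) (a b : R) : Prop :=
  {in `[a, b] &, {homo c : x y / x <= y}} \/
  {in `[a, b] &, {homo c : x y /~ x <= y}}.

Definition maximal_monotone (R : realType) (c : R -> R) (a b : R) : Prop :=
  [/\ a < b <= 1, monotone_on c a b &
      forall b' : R, b < b' <= 1 -> ~ monotone_on c a b'].

(* s lists the endpoints of the pieces of c, from 0 to 1; it is determined
   by c. *)
Definition monotone_pieces (R : realType) (c : R -> R) (s : seq R) : Prop :=
  [/\ s`_0 = 0, last 0 s = 1 &
      forall i : nat, (i.+1 < size s)%N -> maximal_monotone c s`_i s`_i.+1].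

(* The arc-length of the piece on [a, b] is the total variation of c there. *)
Definition short_piece (R : realType) (c : R -> R) (delta a b : R) : bool :=
  (total_variation a b c <= (2 * delta)%:E)%E.

Definition num_short (R : realType) (c : R -> R) (delta : R) (s : seq R) : nat :=
  count (fun i : nat => short_piece c delta s`_i s`_i.+1) (iota 0 (size s).-1).

(* c has at most x monotone pieces that are 2 delta-short. *)
Definition few_short_pieces (R : realType) (c : R -> R) (delta x : R) : Prop :=
  exists s : seq R, monotone_pieces c s /\ (num_short c delta s)%:R <= x.

(** * Real RAM *)

(* A machine holds natural-number and real variables and arrays.  Variables and
   arrays are named by naturals occurring literally in the program; arrays are
   indexed by computed naturals.  On naturals only addition, truncated
   subtraction and comparison are available; on reals the four field operations
   and comparison (no rounding, no conversion between the two sorts, and only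
   integer literals). *)
Record state (R : Type) := State {
  nvar : nat -> nat;
  rvar : nat -> R;
  narr : nat -> nat -> nat;
  rarr : nat -> nat -> R }.

Inductive nexp : Type :=
  | NLit of nat
  | NVar of nat
  | NGet of nat & nexp
  | NAdd of nexp & nexp
  | NSub of nexp & nexp.

Inductive rexp : Type :=
  | RLit of int
  | RVar of nat
  | RGet of nat & nexp
  | RAdd of rexp & rexp
  | RSub of rexp & rexp
  | RMul of rexp & rexp
  | RDiv of rexp & rexp.

Inductive test : Type :=
  | NLe of nexp & nexp
  | RLe of rexp & rexp.

Inductive cmd : Type :=
  | Skip
  | NSetVar of nat & nexp
  | RSetVar of nat & rexp
  | NSetArr of nat & nexp & nexp
  | RSetArr of nat & nexp & rexp
  | Seq of cmd & cmd
  | If of test & cmd & cmd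
  | While of test & cmd.

Fixpoint neval (R : Type) (s : state R) (e : nexp) : nat :=
  match e with
  | NLit k => k
  | NVar x => nvar s x
  | NGet a i => narr s a (neval s i)
  | NAdd e1 e2 => neval s e1 + neval s e2
  | NSub e1 e2 => neval s e1 - neval s e2
  end%N.

Fixpoint reval (R : realType) (s : state R) (e : rexp) : R :=
  match e with
  | RLit z => z%:~R
  | RVar x => rvar s x
  | RGet a i => rarr s a (neval s i)
  | RAdd e1 e2 => reval s e1 + reval s e2
  | RSub e1 e2 => reval s e1 - reval s e2
  | RMul e1 e2 => reval s e1 * reval s e2
  | RDiv e1 e2 => reval s e1 / reval s e2
  end.

Definition teval (R : realType) (s : state R) (b : test) : bool :=
  match b with
  | NLe e1 e2 => (neval s e1 <= neval s e2)%N
  | RLe e1 e2 => reval s e1 <= reval s e2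
  end.

(* Every node of an expression (literal, memory access, operation, comparison)
   costs one unit. *)
Fixpoint ncost (e : nexp) : nat :=
  match e with
  | NLit _ | NVar _ => 1
  | NGet _ i => (ncost i).+1
  | NAdd e1 e2 | NSub e1 e2 => (ncost e1 + ncost e2).+1
  end%N.

Fixpoint rcost (e : rexp) : nat :=
  match e with
  | RLit _ | RVar _ => 1
  | RGet _ i => (ncost i).+1
  | RAdd e1 e2 | RSub e1 e2 | RMul e1 e2 | RDiv e1 e2 => (rcost e1 + rcost e2).+1
  end%N.

Definition tcost (b : test) : nat :=
  match b with
  | NLe e1 e2 => (ncost e1 + ncost e2).+1
  | RLe e1 e2 => (rcost e1 + rcost e2).+1
  end.

Definition update (T : Type) (f : nat -> T) (k : nat) (v : T) : nat -> T :=
  fun x => if x == k then v else f x.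

Definition set_nvar (R : Type) (s : state R) (x k : nat) : state R :=
  State (update (nvar s) x k) (rvar s) (narr s) (rarr s).

Definition set_rvar (R : Type) (s : state R) (x : nat) (v : R) : state R :=
  State (nvar s) (update (rvar s) x v) (narr s) (rarr s).

Definition set_narr (R : Type) (s : state R) (a i k : nat) : state R :=
  State (nvar s) (rvar s) (update (narr s) a (update (narr s a) i k)) (rarr s).

Definition set_rarr (R : Type) (s : state R) (a i : nat) (v : R) : state R :=
  State (nvar s) (rvar s) (narr s) (update (rarr s) a (update (rarr s a) i v)).

(* exec c s s' t: started in state s, the program c halts in state s' after
   exactly t units of time. *)
Inductive exec (R : realType) : cmd -> state R -> state R -> nat -> Prop :=
  | ExecSkip s : exec Skip s s 1
  | ExecNSetVar s x e :
      exec (NSetVar x e) s (set_nvar s x (neval s e)) (ncost e).+1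
  | ExecRSetVar s x e :
      exec (RSetVar x e) s (set_rvar s x (reval s e)) (rcost e).+1
  | ExecNSetArr s a i e :
      exec (NSetArr a i e) s (set_narr s a (neval s i) (neval s e))
        (ncost i + ncost e).+1
  | ExecRSetArr s a i e :
      exec (RSetArr a i e) s (set_rarr s a (neval s i) (reval s e))
        (ncost i + rcost e).+1
  | ExecSeq c1 c2 s s1 s2 t1 t2 :
      exec c1 s s1 t1 -> exec c2 s1 s2 t2 -> exec (Seq c1 c2) s s2 (t1 + t2)
  | ExecIfTrue b c1 c2 s s' t :
      teval s b -> exec c1 s s' t -> exec (If b c1 c2) s s' (tcost b + t).+1
  | ExecIfFalse b c1 c2 s s' t :
      ~~ teval s b -> exec c2 s s' t -> exec (If b c1 c2) s s' (tcost b + t).+1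
  | ExecWhileTrue b c s s1 s2 t1 t2 :
      teval s b -> exec c s s1 t1 -> exec (While b c) s1 s2 t2 ->
      exec (While b c) s s2 (tcost b + t1 + t2).+1
  | ExecWhileFalse b c s :
      ~~ teval s b -> exec (While b c) s s (tcost b).+1.

(* Coordinate j of vertex i is in cell i of real array base + j. *)
Definition stores_vertices (R : realType) (d : nat) (s : state R) (base : nat)
    (p : seq 'rV[R]_d) : Prop :=
  forall (i : nat) (j : 'I_d), (i < size p)%N -> rarr s (base + j) i = p`_i ord0 j.

(* All memory not mentioned here has arbitrary initial contents. *)
Definition is_input (R : realType) (d : nat) (s : state R)
    (p q : seq 'rV[R]_d) (alpha delta : R) : Prop :=
  [/\ nvar s 0 = size p /\ nvar s 1 = size q,
      rvar s 0 = alpha /\ rvar s 1 = delta,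
      stores_vertices s 0 p & stores_vertices s d q].

Definition is_output (R : realType) (d : nat) (s : state R)
    (p q : seq 'rV[R]_d) : Prop :=
  [/\ nvar s 0 = size p /\ nvar s 1 = size q,
      stores_vertices s 0 p & stores_vertices s d q].

(* Main.v *)
(* Fix a coordinate and put [L = alpha * delta].  The play operator of half-width [eps < L]
   (hysteresis: the output moves only when the input leaves the band of half-width [eps] around
   it) is 1-Lipschitz for the supremum norm and commutes with reparameterizations, so applying it
   to that coordinate of both curves does not increase their distance.  It displaces a curve by at
   most [eps]; lengthening the curve by an initial vertex whose coordinate is [L] lower makes the
   first monotone piece long, and in total the distance drops by at most [2 * L].

   Apart from the first one, the monotone pieces of the output are the excursions of the input of
   amplitude above [2 * eps], shortened by [2 * eps].  A given excursion is therefore short only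
   for [eps] in an interval of length at most [delta], and an amortization over the vertices shows
   that the number of short pieces of both curves, integrated over [0 <= eps < L], is at most
   [2 * n * delta].  Hence some [eps] has at most [2 * n / alpha] of them.

   To find such a level in linear time, a stack of nested excursions emits the intervals of levels
   at which each piece is short, as jumps of the counting function; a level at or below its average
   is then located by prune and search.  The pivots come from sorting groups of constant size,
   keeping every fourth element and repeating with groups twice as large, so that both the work
   and the rank errors form geometric series. *)

Require Import Defs.
From mathcomp Require Import all_boot all_order all_algebra.
From mathcomp Require Import all_classical all_reals all_analysis.
From mathcomp Require Import ring lra zify.
Import Order.TTheory GRing.Theory Num.Theory.
Import numFieldNormedType.Exports.
Local Open Scope ring_scope.
Set Implicit Arguments.
Unset Strict Implicit.
Unset Printing Implicit Defensive.

(** * Piecewise linear sequences and the play operator *)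

Section PiecewiseLinear.
Context {R : realType}.
Implicit Types (x y : nat -> R) (eps u a : R) (k m : nat).

(** The play operator contracts distances only for a common [eps], so both curves share one level
    per coordinate and their counts are added. Every vertex after the first pays [delta], which
    gives [2 * (n - 1) * delta] for the two curves; the piece created by the prepended vertex adds
    [2 * delta] once, since the condition for its shortness is the same for both curves. Dividing by
    [L = alpha * delta] gives [2 * n / alpha].

    The obstacle is that monotone pieces come from a greedy traversal of one concrete curve, whereas
    the search needs the counts at all levels at once. An automaton on vertex sequences with
    threshold [2 * eps] mediates: at level 0 it follows the pieces of a curve, at level [eps] those
    of the play operator, and it ignores retreats of at most [2 * eps], as the removal of nested
    excursions requires. Coordinates are treated one after the other, so subdividing edges for one
    of them must not alter the counts of the others. *)

Definition pl x u : R :=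
  let k := Num.truncn u in
  (1 - (u - k%:R)) * x k + (u - k%:R) * x k.+1.

Lemma pl_edge x k (t : R) : 0 <= t <= 1 ->
  pl x (k%:R + t) = (1 - t) * x k + t * x k.+1.
Proof.
move=> /andP[t0 t1]; rewrite /pl.
have [t1'|] := ltP t 1.
  rewrite (@truncn_def _ _ k); first by rewrite addrAC subrr add0r.
  by rewrite lerDl t0 -natr1 ltrD2l.
move=> t1'; have -> : t = 1 by apply/le_anti; rewrite t1 t1'.
by rewrite natr1 natrK !subrr subr0 !mul0r !mul1r addr0 add0r.
Qed.

Lemma pl_nat x k : pl x k%:R = x k.
Proof.
have := @pl_edge x k 0; rewrite addr0 lexx ler01 => /(_ isT) ->.
by rewrite subr0 mul1r mul0r addr0.
Qed.

Lemma edge_split u : 0 <= u ->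
  exists k (t : R), [/\ u = k%:R + t, 0 <= t <= 1 & (t < 1)].
Proof.
move=> u0; exists (Num.truncn u), (u - (Num.truncn u)%:R).
have /andP[h1 h2] := truncn_itv u0.
split; first by rewrite addrC subrK.
  by rewrite subr_ge0 h1 /= lerBlDl natr1 ltW.
by rewrite ltrBlDl natr1.
Qed.

Lemma edge_split_le u m : 0 <= u <= m.+1%:R ->
  exists k (t : R), [/\ (k <= m)%N, u = k%:R + t & 0 <= t <= 1].
Proof.
move=> /andP[u0 um]; have [ulm|ugm] := ltP u m.+1%:R; last first.
  exists m, 1; split=> //; last by rewrite ler01 lexx.
  by rewrite natr1; apply/le_anti; rewrite um ugm.
have [k [t [uE ht t1]]] := edge_split u0.
exists k, t; split=> //; rewrite -ltnS -(ltr_nat R).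
by apply: le_lt_trans ulm; rewrite uE lerDl; case/andP: ht.
Qed.

Definition clamp eps (y x : R) : R := Num.max (x - eps) (Num.min (x + eps) y).

(** The start at the bottom [x 0 - eps] of the band makes the level-set description [playc_ge] valid
    at time 0 and lets the prepended edge, which comes from [x 0 - L], rise. *)
Fixpoint play eps x k : R :=
  if k is k'.+1 then clamp eps (play eps x k') (x k) else x 0 - eps.

Definition playc eps x u : R := clamp eps (play eps x (Num.truncn u)) (pl x u).

Lemma clamp_ge eps (y x a : R) : 0 <= eps ->
  (a <= clamp eps y x) = (a <= x - eps) || ((a <= y) && (a <= x + eps)).
Proof. by move=> e0; rewrite /clamp le_max le_min [X in _ || X]andbC. Qed.

Lemma clamp_itv eps (y x : R) : 0 <= eps ->
  x - eps <= clamp eps y x <= x + eps.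
Proof.
move=> e0; rewrite /clamp le_max lexx /= ge_max ge_min lexx /= andbT.
lra.
Qed.

Lemma play_itv eps x k : 0 <= eps -> x k - eps <= play eps x k <= x k + eps.
Proof. by move=> e0; case: k => [|k] /=; [lra | exact: clamp_itv]. Qed.

Lemma clampE_cases eps (y x : R) : 0 <= eps ->
  [\/ y < x - eps /\ clamp eps y x = x - eps,
      x + eps < y /\ clamp eps y x = x + eps |
      x - eps <= y <= x + eps /\ clamp eps y x = y].
Proof.
move=> e0; rewrite /clamp.
have [h1|h1] := leP (x + eps) y.
  have [h2|h2] := leP (x - eps) (x + eps); last by lra.
  have [h3|h3] := ltP (x + eps) y; first by constructor 2.
  by constructor 3; lra.
by have [h2|h2] := leP (x - eps) y; [constructor 3; lra | constructor 1].
Qed.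

(** At [t = 1] truncation already selects the next edge; both formulas agree there because clamping
    twice at the same input changes nothing. *)
Lemma playc_edge eps x k (t : R) : 0 <= eps -> 0 <= t <= 1 ->
  playc eps x (k%:R + t) = clamp eps (play eps x k) (pl x (k%:R + t)).
Proof.
move=> e0 /andP[t0 t1]; rewrite /playc.
have [t1'|] := ltP t 1.
  by rewrite (@truncn_def _ _ k) // lerDl t0 -natr1 ltrD2l.
move=> t1'; have -> : t = 1 by lra.
rewrite natr1 natrK pl_nat /=.
set y := play eps x k; set z := x k.+1.
have := clamp_itv y z e0; set w := clamp eps y z => hw.
by have [[h2 ->]|[h2 ->]|[h2 ->]] := clampE_cases w z e0; lra.
Qed.

Lemma playc_nat eps x k : 0 <= eps -> playc eps x k%:R = play eps x k.
Proof.
move=> e0; rewrite -[k%:R]addr0 playc_edge ?lexx ?ler01 // addr0 pl_nat.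
have := play_itv x k e0.
by have [[h1 ->]|[h1 ->]|[h1 ->]] := clampE_cases (play eps x k) (x k) e0; lra.
Qed.

Lemma playc_itv eps x u : 0 <= eps ->
  pl x u - eps <= playc eps x u <= pl x u + eps.
Proof. exact: clamp_itv. Qed.

Definition raised eps x u a := exists s, [/\ 0 <= s <= u, a <= pl x s - eps &
  forall r, s <= r <= u -> a <= pl x r + eps].

(* Upper level sets of the play operator: the threshold [a] is reached iff the
   input was pushed above [a + eps] and has stayed above [a - eps] since. *)
Lemma playc_ge eps x u a : 0 <= eps -> 0 <= u ->
  (a <= playc eps x u) <-> raised eps x u a.
Proof.
move=> e0 u0; have [k [t [-> ht _]]] := edge_split u0 => {u u0}.
(* [H] carries the equivalence from a vertex over the edge that starts there; its instance [t = 1]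
   is the induction step. *)
suff H : forall k (t : R), 0 <= t <= 1 -> (a <= play eps x k <-> raised eps x k%:R a) ->
    (a <= playc eps x (k%:R + t) <-> raised eps x (k%:R + t) a).
  elim: k t ht => [|k IH] t ht; apply: H => //.
    split=> [/= h|[s [/andP[s0 s1] h _]]].
      exists 0; split; rewrite ?lexx ?(pl_nat x 0) // => r /le_anti <-.
      by rewrite (pl_nat x 0); lra.
    have se : s = 0%:R by apply/le_anti; rewrite s0 s1.
    by move: h; rewrite se pl_nat.
  have := IH 1; rewrite natr1 playc_nat //; apply.
  by rewrite ler01 lexx.
move=> {}k {}t {}ht hk.
have hx := play_itv x k e0.
have kR : 0 <= k%:R :> R by [].
have t01 : 0 <= t /\ t <= 1 by case/andP: ht.
case: t01 => t0 t1.
rewrite playc_edge // clamp_ge //; split.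
  move=> /orP[h|/andP[h1 h2]].
    exists (k%:R + t); split=> //; first by rewrite lexx; lra.
    by move=> r /le_anti <-; lra.
  have [s [/andP[hs0 hs1] hs2 hs3]] := hk.1 h1.
  exists s; split=> //; first by lra.
  move=> r /andP[hr1 hr2]; have [hr|hr] := leP r k%:R; first by apply: hs3; rewrite hr1.
  have E : r = k%:R + (r - k%:R) by ring.
  move: hx h1 h2; rewrite E !pl_edge; try lra.
  set q := r - _; have hq : 0 <= q <= t by rewrite /q; lra.
  move=> hx h1 h2; have [h|h] := leP (x k) (x k.+1); nra.
move=> [s [/andP[hs0 hs1] hs2 hs3]].
have [h|h] := leP a (pl x (k%:R + t) - eps) => //=.
have h2 : a <= pl x (k%:R + t) + eps by apply: hs3; rewrite hs1 lexx.
rewrite h2 andbT; apply/hk.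
have [hs|hs] := leP s k%:R.
  by exists s; split=> //; [lra|move=> r hr; apply: hs3; lra].
(* The push happens inside the edge and lies above the value at [k%:R + t], so the edge descends and
   its left vertex was pushed at least as high. *)
have h4 : a <= x k - eps.
  have E : s = k%:R + (s - k%:R) by ring.
  move: hs2 h; rewrite {1}E !pl_edge ?pl_nat; try lra.
  set q := s - _; have hq : 0 <= q <= t by rewrite /q; lra.
  by move=> hs2 h; have [h3|h3] := leP (x k) (x k.+1); nra.
exists k%:R; rewrite pl_nat lexx kR; split=> // r /le_anti <-.
by rewrite pl_nat; lra.
Qed.

End PiecewiseLinear.

(** * Monotonicity and surjectivity of piecewise linear interpolation *)

Section PlOrder.
Context {R : realType}.
Implicit Types (x z : nat -> R) (u v w : R) (k m a b : nat).

Lemma edge_split_ltP a b u : a%:R <= u < b%:R ->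
  exists k (t : R), [/\ (a <= k < b)%N, u = k%:R + t & 0 <= t < 1].
Proof.
move=> /andP[au ub]; have u0 : 0 <= u by apply: le_trans au.
have [k [t [uE /andP[t0 _] t1]]] := edge_split u0.
exists k, t; rewrite t0 t1; split=> //; apply/andP; split.
  by rewrite -ltnS -(ltr_nat R) -natr1; lra.
by rewrite -(ltr_nat R); lra.
Qed.

Lemma edge_split_leP a b u : (a < b)%N -> a%:R <= u <= b%:R ->
  exists k (t : R), [/\ (a <= k < b)%N, u = k%:R + t & 0 <= t <= 1].
Proof.
move=> ab /andP[au]; rewrite le_eqVlt => /orP[/eqP ->|ub].
  exists b.-1, 1; split; [lia|by rewrite natr1 prednK //; lia|by rewrite ler01 lexx].
have /edge_split_ltP[k [t [kab -> /andP[t0 t1]]]] : a%:R <= u < b%:R by rewrite au.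
by exists k, t; split=> //; rewrite t0 ltW.
Qed.

Lemma homo_seq x a b : (forall k, (a <= k < b)%N -> x k <= x k.+1) ->
  forall k l, (a <= k)%N -> (k <= l)%N -> (l <= b)%N -> x k <= x l.
Proof.
move=> h k l ak; elim: l => [|l IH]; first by rewrite leqn0 => /eqP ->.
rewrite leq_eqVlt => /orP[/eqP -> //|kl lb].
by apply: le_trans (IH kl (ltnW lb)) (h _ _); rewrite lb (leq_trans ak kl).
Qed.

Lemma pl_homo x a b : (forall k, (a <= k < b)%N -> x k <= x k.+1) ->
  forall u v, a%:R <= u -> u <= v -> v <= b%:R -> pl x u <= pl x v.
Proof.
move=> h u v au; rewrite le_eqVlt => /orP[/eqP -> //|uv vb].
have /edge_split_ltP[k [s [kab uE /andP[s0 s1]]]] : a%:R <= u < b%:R by lra.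
have ab : (a < b)%N by lia.
have [|l [t [lab vE t01]]] := @edge_split_leP a b v ab; first lra.
rewrite uE vE !pl_edge //; last by lra.
have hk := h k kab; have hl := h l lab.
have : (k <= l)%N by rewrite -ltnS -(ltr_nat R) -natr1; lra.
rewrite leq_eqVlt => /orP[/eqP kl|kl]; first by subst l; nra.
have := @homo_seq x a b h k.+1 l; move=> /(_ _ kl _) h2.
have : x k.+1 <= x l by apply: h2; lia.
by nra.
Qed.

Lemma pl_incr x a b : (forall k, (a <= k < b)%N -> x k < x k.+1) ->
  forall u v, a%:R <= u -> u < v -> v <= b%:R -> pl x u < pl x v.
Proof.
move=> h u v au uv vb.
have h' k : (a <= k < b)%N -> x k <= x k.+1 by move=> /h/ltW.
have /edge_split_ltP[k [s [kab uE /andP[s0 s1]]]] : a%:R <= u < b%:R by lra.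
pose w := Num.min v k.+1%:R.
have wv : w <= v by rewrite /w ge_min lexx.
have uw : u < w by rewrite /w lt_min uv uE -natr1; lra.
have wk : w <= k.+1%:R by rewrite /w ge_min lexx orbT.
apply: (@lt_le_trans _ _ (pl x w)); last by apply: (pl_homo h') => //; lra.
have E : w = k%:R + (w - k%:R) by ring.
rewrite E uE !pl_edge; [|by rewrite -natr1 in wk; lra|lra].
have := h k kab; set q := w - k%:R => hk.
have qs : s < q by rewrite /q; lra.
by nra.
Qed.

Lemma pl_onto x a b w : (a <= b)%N -> x a <= w <= x b ->
  exists v, a%:R <= v <= b%:R /\ pl x v = w.
Proof.
elim: b => [|b IH].
  by rewrite leqn0 => /eqP -> h; exists 0; rewrite lexx (pl_nat x 0); split=> //; apply/le_anti.
rewrite leq_eqVlt => /orP[/eqP -> h|]; first by exists b.+1%:R; rewrite lexx pl_nat; split=> //; apply/le_anti.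
rewrite ltnS => ab /andP[h1 h2].
have [h3|h3] := leP w (x b).
  have [|v [hv <-]] := IH ab; first by rewrite h1.
  by exists v; split=> //; rewrite -natr1; lra.
pose t := (w - x b) / (x b.+1 - x b).
have t1 : 0 <= t <= 1.
  by rewrite /t divr_ge0 ?ler_pdivrMr; try lra.
exists (b%:R + t); rewrite pl_edge //; split.
  have : a%:R <= b%:R :> R by rewrite ler_nat.
  by rewrite -natr1; lra.
have -> : (1 - t) * x b + t * x b.+1 = x b + t * (x b.+1 - x b) by ring.
by rewrite divfK; [ring|lra].
Qed.

End PlOrder.

(** * One stage on the level of vertex sequences *)

Section Stage.
Context {R : realType}.
Implicit Types (x z lam : nat -> R) (eps L u v : R) (k m i : nat).

(* Relative position on edge [k] where the play operator stops resting or stops moving; when it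
   does neither inside the edge, any interior point will do. *)
Definition break eps x k : R :=
  let l := (x k.+1 + (play eps x k - play eps x k.+1) - x k) / (x k.+1 - x k) in
  if l <= 0 then 1 / 2 else if 1 <= l then 1 / 2 else l.

(** Index layout of a stage: [0] is the prepended vertex, [2k+1] the old vertex [k], and [2k+2] the
    subdivision point of edge [k]. In a coordinate that is not smoothed the prepended vertex repeats
    vertex 0. *)
Definition refine lam z i : R :=
  if i == 0%N then z 0%N else if odd i then z i./2
  else let m := i./2.-1 in z m + lam m * (z m.+1 - z m).

Definition smooth eps L x i : R :=
  if i == 0%N then x 0%N - L else if odd i then play eps x i./2
  else let m := i./2.-1 in
       clamp eps (play eps x m) (x m + break eps x m * (x m.+1 - x m)).

Lemma refine_odd lam z k : refine lam z k.*2.+1 = z k.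
Proof. by rewrite /refine /= odd_double /= uphalf_double. Qed.

Lemma refine_even lam z k :
  refine lam z k.*2.+2 = z k + lam k * (z k.+1 - z k).
Proof. by rewrite /refine /= odd_double /= doubleK. Qed.

Lemma smooth_odd eps L x k : smooth eps L x k.*2.+1 = play eps x k.
Proof. by rewrite /smooth /= odd_double /= uphalf_double. Qed.

Lemma smooth_even eps L x k : smooth eps L x k.*2.+2 =
  clamp eps (play eps x k) (x k + break eps x k * (x k.+1 - x k)).
Proof. by rewrite /smooth /= odd_double /= doubleK. Qed.

Lemma break_itv eps x k : 0 < break eps x k < 1.
Proof.
rewrite /break /=; set l := (_ - _) / _; case: ifP => [_|/negbT]; first lra.
by rewrite -ltNge => l0; case: ifP => [_|/negbT]; [lra|rewrite -ltNge; lra].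
Qed.

(* Index time of the original curve at index time [v] of the refined one;
   the prepended edge [0, 1] is collapsed to 0. *)
Definition chi lam v : R := pl (refine lam (fun k => k%:R)) v.

Lemma half_split i : i = 0%N \/ (exists k, i = k.*2.+1) \/ (exists k, i = k.*2.+2).
Proof.
case: i => [|i]; first by left.
by right; rewrite -(odd_double_half i); case: (odd i); [right|left]; exists i./2.
Qed.

(** [chi] has the same breakpoints as the refined sequence, so both sides are affine on each refined
    edge and agree at its ends. *)
Lemma pl_refine lam z v : (forall k, 0 < lam k < 1) -> 0 <= v ->
  pl (refine lam z) v = pl z (chi lam v).
Proof.
move=> hl v0; have [i [t [-> ht _]]] := edge_split v0.
rewrite /chi !pl_edge //.
have t01 : 0 <= t /\ t <= 1 by case/andP: ht.
case: t01 => t0 t1.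
case: (half_split i) => [->|[[k ->]|[k ->]]].
- rewrite /refine /=; have -> : (1 - t) * 0%:R + t * 0%:R = 0%:R :> R by ring.
  by rewrite pl_nat; ring.
- rewrite !refine_odd !refine_even; have := hl k; set l := lam k => hlk.
  have -> : (1 - t) * k%:R + t * (k%:R + l * (k.+1%:R - k%:R)) = k%:R + t * l :> R.
    by rewrite -natr1; ring.
  by rewrite pl_edge; [ring|nra].
have -> : refine lam z k.*2.+3 = z k.+1 by rewrite (refine_odd lam z k.+1).
have -> : refine lam (fun k => k%:R) k.*2.+3 = k.+1%:R :> R by rewrite (refine_odd lam _ k.+1).
rewrite !refine_even; have := hl k; set l := lam k => hlk.
have -> : (1 - t) * (k%:R + l * (k.+1%:R - k%:R)) + t * k.+1%:R = k%:R + (l + t * (1 - l)) :> R.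
  by rewrite -natr1; ring.
by rewrite pl_edge; [ring|nra].
Qed.

(** On an edge the input is affine; the output rests until the boundary of the band is reached and
    then moves in parallel. It has at most one bend, and subdividing there makes both halves affine,
    which is why [smooth] represents the play operator exactly. *)
Lemma break_linear eps x k (t : R) : 0 <= eps -> 0 <= t <= 1 ->
  let l := break eps x k in
  let X s := x k + s * (x k.+1 - x k) in
  let Y s := clamp eps (play eps x k) (X s) in
  Y (t * l) = (1 - t) * play eps x k + t * Y l /\
  Y (l + t * (1 - l)) = (1 - t) * Y l + t * play eps x k.+1.
Proof.
move=> e0 ht /=; rewrite /break /=.
have := play_itv x k e0; set y := play eps x k => hy.
set x0 := x k in hy *; set x1 := x k.+1.
have t01 : 0 <= t /\ t <= 1 by case/andP: ht.
case: t01 => t0 t1.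
have const s : x0 - eps <= y <= x0 + eps -> x1 - eps <= y <= x1 + eps ->
    0 <= s <= 1 -> clamp eps y (x0 + s * (x1 - x0)) = y.
  move=> _ h1 hs; set X := x0 + _.
  have [h|h] := leP x0 x1.
    by have [[h2 ->]|[h2 ->]|[_ ->]] // := clampE_cases y X e0; rewrite /X in h2; nra.
  by have [[h2 ->]|[h2 ->]|[_ ->]] // := clampE_cases y X e0; rewrite /X in h2; nra.
have [[h ->]|[h ->]|[h ->]] := clampE_cases y x1 e0.
- set l := (_ - _) / _.
  have xx : 0 < x1 - x0 by lra.
  (* [l] is the position at which the input reaches [y + eps] and starts to carry the output along.
     Writing it through the final displacement of the output covers both directions by one
     formula. *)
  have lE : l * (x1 - x0) = eps + y - x0 by rewrite /l divfK; [ring|lra].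
  have up s : 0 <= s -> s <= 1 -> clamp eps y (x0 + s * (x1 - x0)) =
     if s <= l then y else x0 + s * (x1 - x0) - eps.
    move=> s0 s1; set X := x0 + _; case: (leP s l) => sl.
      by have [[h2 ->]|[h2 ->]|[_ ->]] // := clampE_cases y X e0; rewrite /X in h2; nra.
    by have [[h2 ->]|[h2 ->]|[h2 ->]] // := clampE_cases y X e0; rewrite /X in h2 *; nra.
  have l0 : 0 <= l by nra.
  have l1 : l < 1 by nra.
  have [h0|h0] := leP l 0.
    have {}l0 : l = 0 by lra.
    rewrite l0 in lE up.
    rewrite !up; try nra.
    have -> : (1 / 2 + t * (1 - 1 / 2) <= 0) = false by apply/negbTE; rewrite -ltNge; nra.
    have -> : (1 / 2 <= 0 :> R) = false by apply/negbTE; rewrite -ltNge; lra.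
    have yE : y = x0 - eps by move: lE; rewrite mul0r; lra.
    rewrite yE; split; last by field.
    case: ifP => ht0; last by field.
    by have -> : t = 0; [lra|ring].
  rewrite leNgt l1 /=; rewrite !up; try nra.
  rewrite lexx ifT; last by nra.
  split; first by ring.
  by case: ifP => ht0; nra.
- set l := (_ - _) / _.
  have xx : x1 - x0 < 0 by lra.
  have lE : l * (x1 - x0) = y - eps - x0 by rewrite /l divfK; [ring|lra].
  have up s : 0 <= s -> s <= 1 -> clamp eps y (x0 + s * (x1 - x0)) =
     if s <= l then y else x0 + s * (x1 - x0) + eps.
    move=> s0 s1; set X := x0 + _; case: (leP s l) => sl.
      by have [[h2 ->]|[h2 ->]|[_ ->]] // := clampE_cases y X e0; rewrite /X in h2; nra.
    by have [[h2 ->]|[h2 ->]|[h2 ->]] // := clampE_cases y X e0; rewrite /X in h2 *; nra.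
  have l0 : 0 <= l by nra.
  have l1 : l < 1 by nra.
  have [h0|h0] := leP l 0.
    have {}l0 : l = 0 by lra.
    rewrite l0 in lE up.
    rewrite !up; try nra.
    have -> : (1 / 2 + t * (1 - 1 / 2) <= 0) = false by apply/negbTE; rewrite -ltNge; nra.
    have -> : (1 / 2 <= 0 :> R) = false by apply/negbTE; rewrite -ltNge; lra.
    have yE : y = x0 + eps by move: lE; rewrite mul0r; lra.
    rewrite yE; split; last by field.
    case: ifP => ht0; last by field.
    by have -> : t = 0; [lra|ring].
  rewrite leNgt l1 /=; rewrite !up; try nra.
  rewrite lexx ifT; last by nra.
  split; first by ring.
  by case: ifP => ht0; nra.
set l := if _ then _ else _.
have hl : 0 < l < 1.
  have := break_itv eps x k; rewrite /break /= -/y -/x0 -/x1.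
  rewrite (_ : clamp eps y x1 = y) //.
  by have [[h2 ->]|[h2 ->]|[_ ->]] // := clampE_cases y x1 e0; lra.
rewrite !const //; [|nra|lra|nra].
by split; ring.
Qed.

Lemma pl_smooth eps L x v : 0 <= eps -> 1 <= v ->
  pl (smooth eps L x) v = playc eps x (chi (break eps x) v).
Proof.
move=> e0 v1; have v0 : 0 <= v by lra.
have [i [t [vE ht t1]]] := edge_split v0.
have t01 : 0 <= t /\ t <= 1 by case/andP: ht.
case: t01 => t0 t1'.
have := break_itv eps x; set lam := break eps x => hlam.
rewrite vE /chi !pl_edge //.
case: (half_split i) => [i0|[[k ->]|[k ->]]].
- by move: vE v1; rewrite i0 => ->; lra.
- rewrite !smooth_odd !smooth_even !refine_odd !refine_even.
  have [<- _] := break_linear x k e0 ht.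
  have hl := hlam k; rewrite -/lam; set l := lam k in hl *.
  have -> : (1 - t) * k%:R + t * (k%:R + l * (k.+1%:R - k%:R)) = k%:R + t * l :> R.
    by rewrite -natr1; ring.
  have htl : 0 <= t * l <= 1 by nra.
  by rewrite playc_edge // pl_edge //; congr (clamp _ _ _); ring.
have -> : smooth eps L x k.*2.+3 = play eps x k.+1 by rewrite (smooth_odd eps L x k.+1).
have -> : refine lam (fun k => k%:R) k.*2.+3 = k.+1%:R :> R by rewrite (refine_odd lam _ k.+1).
rewrite !smooth_even !refine_even.
have [_ <-] := break_linear x k e0 ht.
have hl := hlam k; rewrite -/lam; set l := lam k in hl *.
have -> : (1 - t) * (k%:R + l * (k.+1%:R - k%:R)) + t * k.+1%:R = k%:R + (l + t * (1 - l)) :> R.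
  by rewrite -natr1; ring.
have htl : 0 <= l + t * (1 - l) <= 1 by nra.
by rewrite playc_edge // pl_edge //; congr (clamp _ _ _); ring.
Qed.

End Stage.

(** * Stages and the Fréchet distance *)

Section Matching.
Context {R : realType}.
Implicit Types (x z lam : nat -> R) (eps L u v : R) (k m i : nat) (F G : R -> R).

(** A reparameterization scaled to index time, so that curves with different numbers of vertices are
    compared without rescaling. *)
Definition onto01 F M := [/\ forall s t, 0 <= s -> s <= t -> t <= 1 -> F s <= F t,
  forall t, 0 <= t <= 1 -> 0 <= F t <= M &
  forall v, 0 <= v <= M -> exists t, 0 <= t <= 1 /\ F t = v].

Lemma onto01_0 F M : 0 <= M -> onto01 F M -> F 0 = 0.
Proof.
move=> M0 [h1 h2 h3]; have [|t [/andP[t0 t1] Ft]] := h3 0; first by rewrite lexx.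
have := h1 0 t (lexx _) t0 t1; have := h2 0; rewrite lexx ler01 => /(_ isT).
by rewrite Ft; lra.
Qed.

Section Chi.
Variables (lam : nat -> R).
Hypothesis hlam : forall k, 0 < lam k < 1.

Let K := refine lam (fun k => k%:R).

Lemma chi_knots k : K k <= K k.+1.
Proof.
rewrite /K; case: (half_split k) => [->|[[i ->]|[i ->]]].
- by rewrite /refine /=.
- by rewrite refine_odd refine_even -natr1; have := hlam i; lra.
rewrite (refine_odd lam _ i.+1) refine_even -natr1; have := hlam i; lra.
Qed.

Lemma chi_knots_lt k : (0 < k)%N -> K k < K k.+1.
Proof.
rewrite /K; case: (half_split k) => [->|[[i ->]|[i ->]]] // _.
  by rewrite refine_odd refine_even -natr1; have := hlam i; lra.
rewrite (refine_odd lam _ i.+1) refine_even -natr1; have := hlam i; lra.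
Qed.

Lemma chi_homo u v : 0 <= u -> u <= v -> chi lam u <= chi lam v.
Proof.
move=> u0 uv; have v0 : 0 <= v by lra.
have /andP[_ /ltW hv] := truncn_itv v0.
by apply: (@pl_homo R K 0 (Num.truncn v).+1) => // k _; exact: chi_knots.
Qed.

Lemma chi_lt u v : 1 <= u -> u < v -> chi lam u < chi lam v.
Proof.
move=> u0 uv; have v0 : 0 <= v by lra.
have /andP[_ /ltW hv] := truncn_itv v0.
by apply: (@pl_incr R K 1 (Num.truncn v).+1) => // k /andP[k1 _]; exact: chi_knots_lt.
Qed.

Lemma chi1 : chi lam 1 = 0.
Proof. by rewrite /chi (pl_nat _ 1) (refine_odd lam _ 0). Qed.

Lemma chi_prefix v : 0 <= v <= 1 -> chi lam v = 0.
Proof.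
move=> /andP[v0 v1]; apply/le_anti; rewrite -{1}chi1 chi_homo //=.
have <- : chi lam 0 = 0 by rewrite /chi (pl_nat _ 0) /refine.
exact: chi_homo.
Qed.

Lemma chi_end m : chi lam m.*2.+1%:R = m%:R.
Proof. by rewrite /chi pl_nat refine_odd. Qed.

Lemma chi_ge0 v : 0 <= v -> 0 <= chi lam v.
Proof.
move=> v0; have <- : chi lam 0 = 0 by rewrite /chi (pl_nat _ 0) /refine.
exact: chi_homo.
Qed.

(** The preimage is taken beyond the prepended edge, where [chi] is injective. *)
Lemma chi_onto m u : 0 <= u <= m%:R ->
  exists v, 1 <= v <= m.*2.+1%:R /\ chi lam v = u.
Proof.
move=> hu; apply: (@pl_onto R K 1 m.*2.+1 u) => //.
by rewrite /K refine_odd (refine_odd lam _ 0).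
Qed.

Lemma onto01_chi F m : onto01 F m.*2.+1%:R -> onto01 (chi lam \o F) m%:R.
Proof.
move=> [h1 h2 h3]; split=> /=.
- move=> s t s0 st t1; apply: chi_homo; last exact: h1.
  by have /andP[] := h2 s ltac:(lra).
- move=> t /h2 /andP[a b]; rewrite chi_ge0 // -(chi_end m); exact: chi_homo.
move=> u /chi_onto[v [hv <-]]; have [|t [ht <-]] := h3 v; first lra.
by exists t.
Qed.

(** Half of the time is spent on the prepended edge, at a speed that does not depend on the curve;
    the other half follows [F] through the inverse [psi] of [chi] on the remaining edges. *)
Lemma onto01_lift F m : onto01 F m%:R -> exists F', onto01 F' m.*2.+1%:R /\
  (forall t, 0 <= t -> t < 1 / 2 -> F' t = 2 * t) /\
  (forall t, 1 / 2 <= t -> t <= 1 -> 1 <= F' t /\ chi lam (F' t) = F (2 * t - 1)).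
Proof.
move=> hF; have F0 := onto01_0 (ler0n _ _) hF; have [h1 h2 h3] := hF.
have /choice[psi hpsi] : forall u, exists v, 0 <= u <= m%:R -> 1 <= v <= m.*2.+1%:R /\ chi lam v = u.
  move=> u; have [hu|] := boolP (0 <= u <= m%:R); last by exists 0.
  by have [v hv] := chi_onto hu; exists v.
have m1 : 1 <= m.*2.+1%:R :> R by rewrite ler1n.
have psi_homo u v : 0 <= u -> u <= v -> v <= m%:R -> psi u <= psi v.
  move=> u0 uv vm; have [|h4 h5] := hpsi u; first lra.
  have [|h6 h7] := hpsi v; first lra.
  rewrite leNgt; apply/negP => h8; have := chi_lt _ h8; rewrite h5 h7; lra.
exists (fun t => if t < 1 / 2 then 2 * t else psi (F (2 * t - 1))).
have hF2 t : 1 / 2 <= t <= 1 -> 0 <= F (2 * t - 1) <= m%:R by move=> ht; apply: h2; lra.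
split; last split.
- split=> /=.
  + move=> s t s0 st t1; case: ifP => hs; case: ifP => ht; try lra.
    * have [|/andP[h4 _] _] := hpsi (F (2 * t - 1)); first by apply: hF2; move/negbT: ht; rewrite -leNgt; lra.
      lra.
    * move/negbT: hs; move/negbT: ht; rewrite -!leNgt => ht hs.
      have := hF2 s; have := hF2 t => h4 h5.
      apply: psi_homo; [lra|apply: h1; lra|lra].
  + move=> t ht; case: ifP => h; first lra.
    have [|/andP[h4 h5] _] := hpsi (F (2 * t - 1)); first by apply: hF2; move/negbT: h; rewrite -leNgt; lra.
    lra.
  + move=> v hv; have [v1|v1] := ltP v 1.
      by exists (v / 2); rewrite ifT; [split; lra|lra].
    have hc : 0 <= chi lam v <= m%:R.
      by rewrite chi_ge0 -?(chi_end m) ?chi_homo //; lra.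
    have [t [ht Ft]] := h3 _ hc.
    exists ((t + 1) / 2); split; first lra.
    rewrite ifF; last by apply/negbTE; rewrite -leNgt; lra.
    have -> : 2 * ((t + 1) / 2) - 1 = t by field.
    have [h4 h5] := hpsi _ hc; rewrite Ft.
    apply/le_anti/andP; split; rewrite leNgt; apply/negP => h6.
      by have := chi_lt v1 h6; rewrite h5; lra.
    by have := chi_lt _ h6; rewrite h5; lra.
- by move=> t t0 t1; rewrite t1.
move=> t t0 t1; rewrite ltNge t0 /=.
by have [|h4 h5] := hpsi (F (2 * t - 1)); [apply: hF2; lra|split=> //; lra].
Qed.

End Chi.

(** Compared through upper level sets: the stretch during which [x] keeps a threshold [a] raised is
    transported by the matching to one during which [x'] keeps [a - c] raised. *)
Lemma playc_lip eps (x x' : nat -> R) F F' M M' c : 0 <= eps -> 0 <= M -> 0 <= M' ->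
  onto01 F M -> onto01 F' M' ->
  (forall t, 0 <= t <= 1 -> `|pl x (F t) - pl x' (F' t)| <= c) ->
  forall t, 0 <= t <= 1 -> playc eps x (F t) - c <= playc eps x' (F' t).
Proof.
move=> e0 M0 M0' hF hF' hc t /andP[t0 t1].
have [h1 h2 h3] := hF; have [h1' h2' h3'] := hF'.
have /andP[Ft0 FtM] := h2 t ltac:(lra); have /andP[Ft0' FtM'] := h2' t ltac:(lra).
have [s [/andP[s0 s1] hs1 hs2]] := (playc_ge x (playc eps x (F t)) e0 Ft0).1 (lexx _).
apply/playc_ge => //.
have [|q [/andP[q0 q1] Fq]] := h3 s; first lra.
(* [q] may lie beyond [t] if [F] is constant in between; cut off at [t] it is still mapped to
   [s]. *)
pose r := Num.min q t.
have rt : r <= t by rewrite /r ge_min lexx orbT.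
have r0 : 0 <= r by rewrite /r le_min q0.
have Fr : F r = s.
  rewrite /r; have [qt|tq] := leP q t => //.
  by apply/le_anti; rewrite s1 andbT -Fq h1 // ltW.
exists (F' r); split.
- by have := h2' r ltac:(lra); have := h1' r t r0 rt t1; lra.
- have := hc r ltac:(lra); rewrite Fr ler_norml; lra.
move=> w hw.
have [|p [/andP[p0 p1] Fp]] := h3' w.
  by have := h2' r ltac:(lra); lra.
(* Moving [p] into [[r, t]] keeps its image, because [w] lies between [F' r] and [F' t]. *)
pose p' := Num.max r (Num.min p t).
have hp' : r <= p' <= t by rewrite /p' le_max lexx /= ge_max rt ge_min lexx orbT.
have Fp' : F' p' = w.
  case/andP: hw => hw1 hw2; rewrite /p'; have [pt|tp] := leP p t; last first.
    by rewrite max_r //; have := h1' t p ltac:(lra) (ltW tp) p1; lra.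
  have [rp|pr] := leP r p => //.
  by have := h1' p r p0 (ltW pr) ltac:(lra); lra.
have := hc p' ltac:(lra); rewrite Fp' ler_norml => hcp.
have := hs2 (F p'); rewrite -Fr.
by have := h1 r p'; have := h1 p' t; lra.
Qed.

End Matching.

(** * Matchings by coordinates and the Fréchet distance *)

Section Frechet.
Context {R : realType} {d : nat}.
Implicit Types (p q : seq 'rV[R]_d) (C : 'I_d -> R) (j k : 'I_d) (eps L : R).

Definition vcoord p j (i : nat) : R := p`_i ord0 j.

Lemma curve_coord p j t : curve p t ord0 j = pl (vcoord p j) (t * (size p).-1%:R).
Proof. by rewrite /curve /pl !mxE. Qed.

(* Each edge is subdivided at its break, where the smoothed coordinate has its only bend. *)
Definition stage j eps L p : seq 'rV[R]_d :=
  mkseq (fun i => \row_k if k == j then smooth eps L (vcoord p j) i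
                  else refine (break eps (vcoord p j)) (vcoord p k) i) (size p).*2.

Lemma size_stage j eps L p : size (stage j eps L p) = (size p).*2.
Proof. by rewrite size_mkseq. Qed.

Lemma coord_stage j eps L p k i : (i < (size p).*2)%N ->
  vcoord (stage j eps L p) k i = if k == j then smooth eps L (vcoord p j) i
                  else refine (break eps (vcoord p j)) (vcoord p k) i.
Proof. by move=> hi; rewrite /vcoord nth_mkseq // mxE. Qed.

(** The bound is kept separately for every coordinate: undoing a stage costs [2 * L] in its own
    coordinate only, so in the maximum norm all [d] stages together cost [2 * L] and not [d] times
    as much. *)
Definition matched p q C := exists F G,
  [/\ onto01 F (size p).-1%:R, onto01 G (size q).-1%:R &
  forall t k, 0 <= t <= 1 -> `|pl (vcoord p k) (F t) - pl (vcoord q k) (G t)| <= C k].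

Lemma eq_pl (x y : nat -> R) m u : 0 <= u <= m.+1%:R ->
  (forall i, (i <= m.+1)%N -> x i = y i) -> pl x u = pl y u.
Proof.
move=> /edge_split_le[k [t [km -> ht]]] h.
by rewrite !pl_edge // !h //; lia.
Qed.

Lemma pl_stage j eps L p k v : (0 < size p)%N -> 0 <= v <= (size p).-1.*2.+1%:R ->
  pl (vcoord (stage j eps L p) k) v =
  if k == j then pl (smooth eps L (vcoord p j)) v
  else pl (vcoord p k) (chi (break eps (vcoord p j)) v).
Proof.
move=> p0 hv; rewrite (@eq_pl _ (fun i => if k == j then smooth eps L (vcoord p j) i
   else refine (break eps (vcoord p j)) (vcoord p k) i) _ _ hv); last first.
  by move=> i hi; rewrite coord_stage //; lia.
case: ifP => // _; apply: pl_refine; last by case/andP: hv.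
exact: break_itv.
Qed.

Lemma pred_size_stage j eps L p : (0 < size p)%N ->
  (size (stage j eps L p)).-1 = (size p).-1.*2.+1.
Proof. by rewrite size_stage; lia. Qed.

Lemma pl_smooth_prefix eps L (x : nat -> R) v : 0 <= v <= 1 ->
  pl (smooth eps L x) v = x 0%N - L + v * (L - eps).
Proof.
move=> hv; rewrite -[v in LHS]add0r (@pl_edge _ _ 0) //.
by rewrite (smooth_odd eps L x 0) /= /smooth /=; ring.
Qed.

(** During the first half both curves traverse their prepended edges in step, and their difference
    stays that of the initial vertices; afterwards [playc_lip] applies. *)
Lemma matched_stage j epsP p q C L : 0 <= epsP <= L -> (0 < size p)%N -> (0 < size q)%N ->
  matched p q C -> matched (stage j epsP L p) (stage j epsP L q) C.
Proof.
set eps := epsP => /andP[e0 eL] p0 q0 [F [G [hF hG hC]]].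
have hp := break_itv eps (vcoord p j); have hq := break_itv eps (vcoord q j).
have [F' [hF' [F1 F2]]] := onto01_lift hp hF.
have [G' [hG' [G1 G2]]] := onto01_lift hq hG.
exists F', G'; rewrite !pred_size_stage //; split=> // t k ht.
have [_ hF2 _] := hF'; have [_ hG2 _] := hG'.
rewrite !pl_stage ?hF2 ?hG2 //.
have [t12|t12] := ltP t (1 / 2).
  rewrite F1 ?G1 //; try lra.
  have := hC 0 k; rewrite lexx ler01 => /(_ isT).
  rewrite !(onto01_0 _ hF) ?(onto01_0 _ hG) //.
  rewrite !(pl_nat _ 0) => h; case: ifP => [/eqP kj|_].
    by subst k; rewrite !pl_smooth_prefix; [|lra|lra]; apply: le_trans h; rewrite le_eqVlt; apply/orP; left; apply/eqP; congr `|_|; ring.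
  by rewrite !chi_prefix //; [rewrite !(pl_nat _ 0)|lra|lra].
have [f1 f2] := F2 t t12 ltac:(lra); have [g1 g2] := G2 t t12 ltac:(lra).
case: ifP => [/eqP kj|_]; last by rewrite f2 g2; apply: hC; lra.
subst k; rewrite !pl_smooth // f2 g2.
have hl := @playc_lip R eps (vcoord p j) (vcoord q j) F G _ _ (C j) e0 (ler0n _ _) (ler0n _ _) hF hG
   (fun t => hC t j) (2 * t - 1) ltac:(lra).
have hr := @playc_lip R eps (vcoord q j) (vcoord p j) G F _ _ (C j) e0 (ler0n _ _) (ler0n _ _) hG hF.
have {}hr := hr (fun t ht => ltac:(rewrite distrC; exact: hC t j ht)) (2 * t - 1) ltac:(lra).
by rewrite ler_norml; lra.
Qed.

(** The deviation is asymmetric: the output is at most [L] too low, because of the prepended vertex,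
    but at most [eps] too high. Two curves together are therefore off by at most
    [L + eps <= 2 * L]. *)
Lemma smooth_close eps L (x : nat -> R) v : 0 <= eps <= L -> 0 <= v ->
  - eps <= pl x (chi (break eps x) v) - pl (smooth eps L x) v <= L.
Proof.
move=> /andP[e0 eL] v0; have [v1|v1] := leP v 1.
  rewrite pl_smooth_prefix; last by rewrite v0.
  rewrite chi_prefix ?v0 //; last exact: break_itv.
  by rewrite (pl_nat _ 0); nra.
rewrite pl_smooth //; last by lra.
by have := playc_itv x (chi (break eps x) v) e0; lra.
Qed.

Lemma matched_unstage j eps L p q C : 0 <= eps <= L -> (0 < size p)%N -> (0 < size q)%N ->
  matched (stage j eps L p) (stage j eps L q) C ->
  matched p q (fun k => C k + (if k == j then 2 * L else 0)).
Proof.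
move=> he p0 q0 [F [G []]]; rewrite !pred_size_stage // => hF hG hC.
have hp := break_itv eps (vcoord p j); have hq := break_itv eps (vcoord q j).
exists (chi (break eps (vcoord p j)) \o F), (chi (break eps (vcoord q j)) \o G).
split; [exact: onto01_chi|exact: onto01_chi|move=> t k ht /=].
have [_ hF2 _] := hF; have [_ hG2 _] := hG.
have := hC t k ht; rewrite !pl_stage ?hF2 ?hG2 //.
case: ifP => [/eqP kj|_]; last by rewrite addr0.
subst k => h.
have := @smooth_close eps L (vcoord p j) (F t) he; have := @smooth_close eps L (vcoord q j) (G t) he.
move: h; have /andP[-> _] := hF2 t ht; have /andP[-> _] := hG2 t ht.
by rewrite !ler_norml => h /(_ isT) h1 /(_ isT) h2; lra.
Qed.

Lemma norm_rV_le (v : 'rV[R]_d) c : 0 <= c ->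
  (`|v| <= c) <-> (forall k, `|v ord0 k| <= c).
Proof.
move=> c0; rewrite [`|v|]/Num.Def.normr /= mx_normrE; split.
  move=> h k; apply: le_trans h.
  exact: (@le_bigmax _ _ _ 0 (fun ij => `|v ij.1 ij.2|) (ord0, k)).
by move=> h; apply: bigmax_le => // -[i k] _ /=; rewrite (ord1 i).
Qed.

Lemma coord_bounded (x : nat -> R) m : exists B, 0 <= B /\
  forall u, 0 <= u <= m%:R -> `|pl x u| <= B.
Proof.
exists (\sum_(0 <= i < m.+2) `|x i|); split; first exact: sumr_ge0.
have hle i : (i < m.+2)%N -> `|x i| <= \sum_(0 <= i < m.+2) `|x i|.
  move=> hi; rewrite big_mkord (bigD1 (Ordinal hi)) //= lerDl; exact: sumr_ge0.
move=> u hu; have [|k [t [km -> ht]]] := @edge_split_le _ u m; first by rewrite -natr1; lra.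
rewrite pl_edge //; have := hle k ltac:(lia); have := hle k.+1 ltac:(lia).
set B := \sum_(_ <= _ < _) _ => h1 h2.
apply: le_trans (ler_normD _ _) _; rewrite !normrM.
have -> : `|1 - t| = 1 - t by rewrite ger0_norm; lra.
have -> : `|t| = t by rewrite ger0_norm; lra.
by nra.
Qed.

Lemma curve_bounded p : exists B, forall t, 0 <= t <= 1 -> `|curve p t| <= B.
Proof.
have /choice[B hB] : forall k, exists B, 0 <= B /\
    forall u, 0 <= u <= (size p).-1%:R -> `|pl (vcoord p k) u| <= B.
  by move=> k; exact: coord_bounded.
have hle k : B k <= \sum_k B k.
  by rewrite (bigD1 k) //= lerDl; apply: sumr_ge0 => i _; case: (hB i).
exists (\sum_k B k) => t ht; apply/norm_rV_le.
  by apply: sumr_ge0 => i _; case: (hB i).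
move=> k; apply: le_trans (hle k); have [_] := hB k; rewrite curve_coord; apply.
have : 0 <= (size p).-1%:R :> R by [].
by nra.
Qed.

Lemma onto01_reparam (f : R -> R) : reparameterization f -> onto01 f 1.
Proof.
move=> [h1 h2].
have hin t : 0 <= t <= 1 -> t \in `[0 : R, 1] by rewrite in_itv.
split.
- by move=> s t s0 st t1; apply: h1 => //; apply: hin; lra.
- move=> t ht; have : (f @` `[0, 1])%classic (f t) by exists t => //=; rewrite in_itv.
  by rewrite h2 /= in_itv.
move=> v hv; have : (`[0, 1]%classic : set R) v by rewrite /= in_itv.
by rewrite -h2 => -[t /=]; rewrite in_itv /= => ht <-; exists t.
Qed.

Lemma reparam_onto01 (f : R -> R) : onto01 f 1 -> reparameterization f.
Proof.
move=> [h1 h2 h3]; split.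
  move=> s t; rewrite !in_itv /= => /andP[s0 s1] /andP[t0 t1] st; exact: h1.
apply/seteqP; split=> [v [t /=]|v /=]; rewrite !in_itv /=; first by move=> /h2 ? <-.
by move=> /h3[t [ht <-]]; exists t => //=; rewrite in_itv.
Qed.

Lemma frechet_le p q c : matched p q (fun=> c) -> 0 <= c ->
  frechet (curve p) (curve q) <= c.
Proof.
move=> [F [G [hF hG hC]]] c0.
have scale (r : seq ('rV[R]_d)) (H : R -> R) : onto01 H (size r).-1%:R ->
    exists h : R -> R, reparameterization h /\ forall t : R, 0 <= t <= 1 -> h t * (size r).-1%:R = H t.
  set M : R := (size r).-1%:R => -[h1 h2 h3].
  (* A curve with one vertex has index range [[0, 0]], which cannot be rescaled; the identity
     serves. *)
  have [m0|m0] := eqVneq M 0.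
    exists id; split=> [|t /h2]; last by rewrite m0 mulr0; lra.
    by apply: reparam_onto01; split=> // v hv; exists v.
  have mp : 0 < M by rewrite lt_def m0 ler0n.
  exists (fun t => H t / M); split; last by move=> t _; rewrite divfK.
  apply: reparam_onto01; split.
  - by move=> s t s0 st t1; rewrite ler_pM2r ?invr_gt0 // h1.
  - by move=> t /h2 h; rewrite divr_ge0 ?ler_pdivrMr ?mul1r; lra.
  - move=> v hv; have [|t [ht E]] := h3 (v * M); first by nra.
    by exists t; split=> //; rewrite E mulfK.
have [f [hf fF]] := scale p F hF; have [g [hg gG]] := scale q G hG.
apply: (@le_trans _ _ (matching_cost (curve p) (curve q) f g)).
  apply: ge_inf; last by exists f, g.
  exists 0 => _ [f' [g' [_ _ ->]]]; rewrite /matching_cost.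
  (* A set without supremum has [sup] equal to 0 by convention, so costs are non-negative in every
     case. *)
  set S := (X in sup X); have [hS|/sup_out ->] := pselect (has_sup S) => //.
  by have [[x Sx] hub] := hS; apply: le_trans (ub_le_sup hub Sx); case: Sx => t _ <-.
apply: ge_sup; first by exists `|curve p (f 0) - curve q (g 0)|; exists 0 => //=; rewrite in_itv /= lexx ler01.
move=> y [t ht <-] /=; have {}ht : 0 <= t <= 1 by move: ht; rewrite /= in_itv.
apply/norm_rV_le => // k.
by rewrite mxE [X in _ + X]mxE !curve_coord fF // gG //; exact: hC.
Qed.

(** Asking for a cost strictly above the infimum avoids the question of attainment. Boundedness of
    the curves enters because the [sup] of an unbounded set is 0 and would bound nothing. *)
Lemma frechet_lt p q c : frechet (curve p) (curve q) < c -> matched p q (fun=> c).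
Proof.
move=> h; have [|_ [f [g [hf hg ->]]] hlt] := inf_lt _ h.
  exists (matching_cost (curve p) (curve q) id id), id, id.
  by split=> //; apply: reparam_onto01; split=> // v hv; exists v.
have [Bp hBp] := curve_bounded p; have [Bq hBq] := curve_bounded q.
have [f1 f2 f3] := onto01_reparam hf; have [g1 g2 g3] := onto01_reparam hg.
have hcost t : 0 <= t <= 1 -> `|curve p (f t) - curve q (g t)| <= c.
  move=> ht; apply: le_trans (ltW hlt).
  apply: ub_le_sup; last by exists t => //=; rewrite in_itv.
  exists (Bp + Bq) => y [s hs <-] /=; have {}hs : 0 <= s <= 1 by move: hs; rewrite /= in_itv.
  apply: le_trans (ler_normB _ _) _; apply: lerD; [apply: hBp; exact: f2|apply: hBq; exact: g2].
have c0 : 0 <= c by apply: le_trans (hcost 0 _); rewrite ?lexx ?ler01.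
have scale (r : seq ('rV[R]_d)) (h0 : R -> R) : onto01 h0 1 ->
    onto01 (fun t => h0 t * (size r).-1%:R) (size r).-1%:R.
  set M : R := (size r).-1%:R => -[h1 h2 h3]; have m0 : 0 <= M by rewrite ler0n.
  split.
  - by move=> s t s0 st t1; apply: ler_wpM2r => //; exact: h1.
  - by move=> t /h2 ht; nra.
  - move=> v hv; have [m0'|mn0] := eqVneq M 0.
      by exists 0; split; [lra|rewrite m0' mulr0; lra].
    have mp : 0 < M by rewrite lt_def mn0.
    have [|t [ht E]] := h3 (v / M); first by rewrite divr_ge0 ?ler_pdivrMr ?mul1r; lra.
    by exists t; split=> //; rewrite E divfK.
exists (fun t => f t * (size p).-1%:R), (fun t => g t * (size q).-1%:R); split.
- by apply: scale; split.
- by apply: scale; split.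
move=> t k ht; have := (norm_rV_le _ c0).1 (hcost t ht) k.
by rewrite mxE [X in _ + X]mxE !curve_coord.
Qed.

Lemma frechet_ge0 p q : 0 <= frechet (curve p) (curve q).
Proof.
apply: lb_le_inf.
  exists (matching_cost (curve p) (curve q) id id), id, id.
  by split=> //; apply: reparam_onto01; split=> // v hv; exists v.
move=> _ [f' [g' [_ _ ->]]]; rewrite /matching_cost.
set S := (X in sup X); have [hS|/sup_out ->] := pselect (has_sup S) => //.
by have [[x Sx] hub] := hS; apply: le_trans (ub_le_sup hub Sx); case: Sx => t _ <-.
Qed.

End Frechet.

(** * Counting monotone pieces with hysteresis *)

Section Automaton.
Context {R : realType}.
Implicit Types (eps delta s e be b x v : R) (up g : bool) (l : seq (R * R)).

Definition beyond up e x := if up then e <= x else x <= e.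

(** The play operator shortens a piece by [2 * eps], so this is shortness of the smoothed piece, in
    terms of the input. *)
Definition short eps delta s e := `|e - s| <= 2 * eps + 2 * delta.

(* The current piece runs in direction [up] from [s] to its extreme [e] so far and ends once the
   input has retreated by more than [2 * eps]; [g] tells whether it is to be counted when short.
   Each value carries the level [b] from which the piece starting there is counted. *)
Fixpoint short_pieces eps delta up s g e be l : nat :=
  if l is (x, b) :: l' then
    if beyond up e x then short_pieces eps delta up s g x b l'
    else if 2 * eps < `|x - e| then
      ((g && short eps delta s e) + short_pieces eps delta (~~ up) e (be <= eps)%R x b l')%N
    else short_pieces eps delta up s g e be l'
  else g && short eps delta s e.

(** The possible positions of the last input [v] relative to the running extreme [e]: it has not
    retreated far enough to end the piece. *)
Definition trails eps up e v := if up then e - 2 * eps <= v <= e else e <= v <= e + 2 * eps.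

Ltac unf := rewrite /trails /beyond /= -?ltNge.

Lemma distE_lt x y : (x < y) -> `|x - y| = y - x :> R.
Proof. by move=> h; rewrite ltr0_norm; lra. Qed.

Lemma distE_gt x y : (y < x) -> `|x - y| = x - y :> R.
Proof. by move=> h; rewrite gtr0_norm; lra. Qed.

Variables (eps delta : R).
Hypothesis e0 : 0 <= eps.
Ltac xlra := move: (e0); intros; lazymatch goal with |- @eq nat _ _ => exfalso; lra | |- _ => lra end.
Local Notation cnt := (short_pieces eps delta).
Local Notation near := (trails eps).

Variant step_spec up s g e be x b l : nat -> Prop :=
| StepExtend of beyond up e x : step_spec up s g e be x b l (cnt up s g x b l)
| StepTurn of (if up then 2 * eps < e - x else 2 * eps < x - e) :
   step_spec up s g e be x b l
    ((g && short eps delta s e) + cnt (~~ up) e (be <= eps)%R x b l)%N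
| StepStay of near up e x & ~~ beyond up e x :
   step_spec up s g e be x b l (cnt up s g e be l).

Lemma stepP up s g e be x b l :
  step_spec up s g e be x b l (cnt up s g e be ((x, b) :: l)).
Proof.
rewrite /=; case: ifPn => [h|h]; first exact: StepExtend.
case: ifPn => h2; [apply: StepTurn|apply: StepStay => //];
  by case: up h => /=; unf => h;
    move: h2; rewrite -?leNgt ?(distE_lt h) ?(distE_gt h); xlra.
Qed.

Lemma cntE_extend up s g e be x b l : beyond up e x ->
  cnt up s g e be ((x, b) :: l) = cnt up s g x b l.
Proof. by move=> /= ->. Qed.

Lemma cntE_turn up s g e be x b l : (if up then 2 * eps < e - x else 2 * eps < x - e) ->
  cnt up s g e be ((x, b) :: l) =
  ((g && short eps delta s e) + cnt (~~ up) e (be <= eps)%R x b l)%N.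
Proof.
move=> h; case: stepP => //; case: up h => /=; unf; xlra.
Qed.

Lemma cntE_stay up s g e be x b l : near up e x -> ~~ beyond up e x ->
  cnt up s g e be ((x, b) :: l) = cnt up s g e be l.
Proof.
move=> h h'; case: stepP => //; [by rewrite (negbTE h')|move: h; case: up h' => /=; unf; xlra].
Qed.

Lemma cnt_births up s g e be l l' : unzip1 l = unzip1 l' ->
  [seq p.2 <= eps | p <- l] = [seq p.2 <= eps | p <- l'] ->
  forall be', (be <= eps) = (be' <= eps) -> cnt up s g e be l = cnt up s g e be' l'.
Proof.
elim: l l' up s g e be => [|[x b] l IH] [|[x' b'] l'] up s g e be //= [<- h1] [h2 h3] be' h4.
by case: ifP => _; [exact: IH|case: ifP => _; [rewrite h4; congr (_ + _)%N|]; exact: IH].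
Qed.

Lemma cnt_nil up s g e be : cnt up s g e be [::] = g && short eps delta s e :> nat.
Proof. by []. Qed.

Arguments short_pieces : simpl never.

(** Whatever [m] does, [b] does as well and further: an extension is extended, a turn is prolonged,
    and a stay leaves no trace. The birth of [m] is lost in each case. *)
Lemma cnt_insert up s g e be a m b l bm bx : near up e a ->
  (a < m <= b \/ b <= m < a) ->
  cnt up s g e be ((m, bm) :: (b, bx) :: l) = cnt up s g e be ((b, bx) :: l).
Proof.
move=> ha hm; case: (stepP up s g e be m bm) => h.
- by rewrite !cntE_extend //; case: up ha h; unf; xlra.
- rewrite cntE_extend; last by case: up ha h => /=; unf => ha h; xlra.
  by rewrite cntE_turn //; case: up ha h => /=; unf => ha h; xlra.
by [].
Qed.

(* A short retreat [v1 -> v2] between two longer moves is invisible. *)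
Lemma cnt_skip up s g e be v0 v1 v2 v3 b1 b2 b3 l : near up e v0 ->
  `|v2 - v1| <= 2 * eps ->
  (v0 < v2 /\ v2 < v1 /\ v1 <= v3) \/ (v2 < v0 /\ v1 < v2 /\ v3 <= v1) ->
  cnt up s g e be ((v1, b1) :: (v2, b2) :: (v3, b3) :: l) = cnt up s g e be ((v3, b3) :: l).
Proof.
move=> ha hd hm.
have hd' : - (2 * eps) <= v2 - v1 <= 2 * eps by rewrite -ler_norml.
case: (stepP up s g e be v1 b1) => h1.
- case: up ha h1 => /=; unf => ha h1.
    by rewrite cntE_stay; [rewrite !cntE_extend //; unf; xlra|unf; xlra|unf; xlra].
  by rewrite cntE_stay; [rewrite !cntE_extend //; unf; xlra|unf; xlra|unf; xlra].
- case: up ha h1 => /=; unf => ha h1.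
    rewrite cntE_stay; [|unf; xlra|unf; xlra].
    rewrite cntE_extend; last by unf; xlra.
    by rewrite (@cntE_turn true) //; xlra.
  rewrite cntE_stay; [|unf; xlra|unf; xlra].
  rewrite cntE_extend; last by unf; xlra.
  by rewrite (@cntE_turn false) //; xlra.
move=> h2; rewrite cntE_stay //; case: up ha h1 h2 => /=; unf; xlra.
Qed.

(* The same when the first move is itself a turn, in which case it need not be longer. *)
Lemma cnt_skip_turn up s g v0 be v1 v2 v3 b1 b2 b3 l :
  2 * eps < `|v1 - v0| -> `|v2 - v1| <= 2 * eps ->
  (if up then v1 < v0 /\ v1 < v2 /\ v3 <= v1 else v0 < v1 /\ v2 < v1 /\ v1 <= v3) ->
  cnt up s g v0 be ((v1, b1) :: (v2, b2) :: (v3, b3) :: l) = cnt up s g v0 be ((v3, b3) :: l).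
Proof.
rewrite ler_norml => ha hd hm.
have ht : if up then 2 * eps < v0 - v1 else 2 * eps < v1 - v0.
  by case: up hm => -[h1 h2]; move: ha; rewrite ?(distE_lt h1) ?(distE_gt h1).
rewrite cntE_turn //.
rewrite cntE_stay; [|by case: up hm {ht}; unf; xlra|by case: up hm {ht}; unf; xlra].
rewrite cntE_extend; last by case: up hm {ht}; unf; xlra.
by rewrite (@cntE_turn up) //; case: up hm ht; xlra.
Qed.

Lemma cnt_skip_last up s g e be v0 v1 v2 b1 b2 b1' : near up e v0 ->
  `|v2 - v1| <= 2 * eps ->
  (v0 < v2 /\ v2 < v1) \/ (v2 < v0 /\ v1 < v2) ->
  cnt up s g e be [:: (v1, b1); (v2, b2)] = cnt up s g e be [:: (v1, b1')].
Proof.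
rewrite ler_norml => ha hd hm.
case: (stepP up s g e be v1 b1) => h1.
- rewrite (@cntE_extend _ _ _ _ _ v1) // cntE_stay //; case: up ha h1; unf => *; xlra.
- rewrite (@cntE_turn _ _ _ _ _ v1) // cntE_stay //; case: up ha h1; unf => *; xlra.
move=> h2; rewrite (@cntE_stay _ _ _ _ _ v1) // cntE_stay //; case: up ha h1 h2; unf => *; xlra.
Qed.

Lemma cnt_skip_turn_last up s g v0 be v1 v2 b1 b2 b1' :
  2 * eps < `|v1 - v0| -> `|v2 - v1| <= 2 * eps ->
  (if up then v1 < v0 /\ v1 < v2 else v0 < v1 /\ v2 < v1) ->
  cnt up s g v0 be [:: (v1, b1); (v2, b2)] = cnt up s g v0 be [:: (v1, b1')].
Proof.
rewrite ler_norml => ha hd hm.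
have ht : if up then 2 * eps < v0 - v1 else 2 * eps < v1 - v0.
  by case: up hm => -[h1 h2]; move: ha; rewrite ?(distE_lt h1) ?(distE_gt h1).
rewrite !(@cntE_turn _ _ _ _ _ v1) // cntE_stay //; case: up hm {ht}; unf => *; xlra.
Qed.

(** A prefix contributes a fixed number of finished pieces and leaves a state near its last value,
    from which different continuations can be compared. *)
Lemma cnt_context (pre : seq (R * R)) v b up s g e be :
  exists K up' s' g' e' be', near up' e' v /\
  (forall l, cnt up s g e be (pre ++ (v, b) :: l) = (K + cnt up' s' g' e' be' l)%N).
Proof.
elim: pre up s g e be => [|[x bx] pre IH] up s g e be.
  case: (stepP up s g e be v b [::]) => h.
  - exists 0%N, up, s, g, v, b; split=> [|l]; first by case: up {h}; unf; xlra.
    by rewrite cntE_extend.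
  - exists (g && short eps delta s e), (~~ up), e, (be <= eps), v, b; split=> [|l].
      by case: up {h}; unf; xlra.
    by rewrite cntE_turn.
  - by move=> h'; exists 0%N, up, s, g, e, be; split=> // l; rewrite cntE_stay.
case: (stepP up s g e be x bx [::]) => h.
- have [K [up' [s' [g' [e' [be' [h1 h2]]]]]]] := IH up s g x bx.
  by exists K, up', s', g', e', be'; split=> // l; rewrite cntE_extend.
- have [K [up' [s' [g' [e' [be' [h1 h2]]]]]]] := IH (~~ up) e (be <= eps)%R x bx.
  exists ((g && short eps delta s e) + K)%N, up', s', g', e', be'; split=> // l.
  by rewrite cntE_turn // h2 addnA.
move=> h'; have [K [up' [s' [g' [e' [be' [h1 h2]]]]]]] := IH up s g e be.
by exists K, up', s', g', e', be'; split=> // l; rewrite cntE_stay.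
Qed.

Lemma cnt_dup up s g e be a b l : near up e a -> b <= eps -> be <= eps ->
  cnt up s g e be ((a, b) :: l) = cnt up s g e be l.
Proof.
move=> ha hb hbe; case: stepP => // h.
  have -> : a = e by case: up ha h; unf; xlra.
  by apply: cnt_births; rewrite ?hb ?hbe.
by case: up ha h; unf; xlra.
Qed.

(** Only the current piece depends on its start; after the next turn the two runs coincide. Since
    extending lengthens a piece, one that is short when it ends is short already with the present
    extreme [e]. *)
Lemma cnt_mono up s1 s2 g1 e be l : (if up then s1 <= e else e <= s1) ->
  (cnt up s1 g1 e be l <= cnt up s2 false e be l + (g1 && short eps delta s1 e))%N.
Proof.
elim: l e be => [|[x b] l IH] e be h; first by rewrite !cnt_nil add0n.
case: (stepP up s1 g1 e be x b) => hx.
- rewrite cntE_extend //; apply: leq_trans (IH _ _ _) _.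
    by case: up h hx {IH} => /=; xlra.
  rewrite leq_add2l; case: g1 {IH} => //=; rewrite /short.
  case: up h hx => /= h hx.
    by rewrite !ger0_norm; [|xlra|xlra]; case: leP => //= h1; case: leP => //=; xlra.
  by rewrite !ler0_norm; [|xlra|xlra]; case: leP => //= h1; case: leP => //=; xlra.
- by rewrite cntE_turn //= add0n addnC.
by move=> h2; rewrite cntE_stay //; exact: IH.
Qed.

End Automaton.

(** * Subdivision *)

Ltac unf := rewrite /trails /beyond /= -?ltNge.

Arguments short_pieces : simpl never.

Section Subdivision.
Context {R : realType}.
Implicit Types (eps delta s e be a b x v y : R) (up g : bool) (l xs : seq R).

Definition timed l : seq (R * R) := [seq (x, 0) | x <- l].

(** The first argument is the vertex read last. [SubDup] admits repetitions, which arise at the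
    prepended vertex and on horizontal edges. *)
Inductive subdivides : R -> seq R -> seq R -> Prop :=
| SubNil a : subdivides a [::] [::]
| SubStep a b l l' : subdivides b l l' -> subdivides a (b :: l) (b :: l')
| SubDup a l l' : subdivides a l l' -> subdivides a l (a :: l')
| SubIns a m b l l' : a < m <= b \/ b <= m < a ->
    subdivides m (b :: l) l' -> subdivides a (b :: l) (m :: l').

Lemma cnt_subdivides eps delta a l l' up s g e : 0 <= eps ->
  subdivides a l l' -> trails eps up e a ->
  short_pieces eps delta up s g e 0 (timed l') = short_pieces eps delta up s g e 0 (timed l).
Proof.
move=> e0 h; elim: h up s g e => {a l l'}.
- by [].
- move=> a b l l' _ IH up s g e ha /=.
  case: (stepP delta e0 up s g e 0 b 0 (timed l)) => h.
  + by rewrite cntE_extend // IH //; case: up {ha} h; unf; lra.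
  + by rewrite cntE_turn // e0 IH //; case: up {ha} h; unf; lra.
  + by move=> h'; rewrite cntE_stay // IH.
- by move=> a l l' _ IH up s g e ha /=; rewrite cnt_dup //; exact: IH.
move=> a m b l l' hm _ IH up s g e ha /=.
rewrite -(cnt_insert delta e0 s g 0 (timed l) 0 0 ha hm).
case: (stepP delta e0 up s g e 0 m 0 ((b, 0) :: timed l)) => h.
- by rewrite cntE_extend // -IH //; case: up {ha} h; unf; lra.
- by rewrite cntE_turn // e0 -IH //; case: up {ha} h; unf; lra.
by move=> h'; rewrite cntE_stay // -IH.
Qed.

Lemma between_ins a b (lam : R) : 0 < lam < 1 ->
  let m := a + lam * (b - a) in m = a \/ (a < m <= b \/ b <= m < a).
Proof.
move=> h m; have [ab|ba|ab] := ltgtP a b.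
- by right; left; rewrite /m; nra.
- by right; right; rewrite /m; nra.
- by left; rewrite /m ab; ring.
Qed.

Lemma subdivides_refine (lam z : nat -> R) k m : (forall i, 0 < lam i < 1) ->
  subdivides (z k) [seq z i | i <- iota k.+1 m]
    [seq refine lam z i | i <- iota k.*2.+2 m.*2].
Proof.
move=> hl; elim: m k => [|m IH] k; first exact: SubNil.
rewrite doubleS /= refine_even (refine_odd lam z k.+1).
have IH' := IH k.+1; rewrite doubleS in IH'.
have [->|h] := between_ins (z k) (z k.+1) (hl k).
  by apply: SubDup; apply: SubStep.
by apply: SubIns => //; apply: SubStep.
Qed.

Lemma subdivides_refine0 (lam z : nat -> R) m : (forall i, 0 < lam i < 1) ->
  subdivides (z 0%N) [seq z i | i <- iota 1 m]
    [seq refine lam z i | i <- iota 1 m.*2.+1].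
Proof.
move=> hl /=; rewrite (refine_odd lam z 0); apply: SubDup.
exact: (subdivides_refine z 0 m hl).
Qed.

Fixpoint playseq eps y xs : seq R :=
  if xs is x :: xs' then clamp eps y x :: playseq eps (clamp eps y x) xs' else [::].

(** The automaton with threshold [2 * eps] on the input and the one with threshold 0 on the output
    run in lockstep: the extreme of the output is that of the input moved inwards by [eps], and the
    output rests while the input retreats by at most [2 * eps]. The hypotheses under [g] say that a
    counted piece began at a genuine turn, so that its amplitude shrinks by exactly [2 * eps]. *)
Lemma cnt_playseq eps delta up s g e s' xs : 0 <= eps ->
  (g -> if up then s < e - 2 * eps else e + 2 * eps < s) ->
  (g -> s' = if up then s + eps else s - eps) ->
  let e' := if up then e - eps else e + eps in
  short_pieces 0 delta up s' g e' 0 (timed (playseq eps e' xs)) =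
  short_pieces eps delta up s g e 0 (timed xs).
Proof.
move=> e0; elim: xs up s g e s' => [|x xs IH] up s g e s' hg hs' /=.
  rewrite !cnt_nil; case: g hg hs' => //= /(_ isT) hg /(_ isT) ->.
  rewrite /short; congr nat_of_bool; case: up hg => hg.
    by rewrite !gtr0_norm; [|lra|lra]; apply/idP/idP; lra.
  by rewrite !ltr0_norm; [|lra|lra]; apply/idP/idP; lra.
case: (stepP delta e0 up s g e 0 x 0 (timed xs)) => h.
- have E : clamp eps (if up then e - eps else e + eps) x = if up then x - eps else x + eps.
    have [[h2 ->]|[h2 ->]|[h2 ->]] := clampE_cases (if up then e - eps else e + eps) x e0;
      by case: up h h2 {hg hs'}; unf; lra.
  rewrite E cntE_extend; last by case: up h {hg hs' E}; unf; lra.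
  apply: IH => // g1; have := hg g1; case: up h {hg hs' E}; unf; lra.
- have E : clamp eps (if up then e - eps else e + eps) x = if up then x + eps else x - eps.
    have [[h2 ->]|[h2 ->]|[h2 ->]] := clampE_cases (if up then e - eps else e + eps) x e0;
      by case: up h h2 {hg hs'}; lra.
  rewrite E (@cntE_turn _ 0 delta (lexx 0)); last by case: up h {hg hs' E} => h; lra.
  rewrite lexx e0; congr (_ + _)%N.
    case: g hg hs' => //= /(_ isT) hg /(_ isT) ->.
    rewrite /short; congr nat_of_bool; case: up hg {h E} => hg.
      by rewrite !gtr0_norm; [|lra|lra]; apply/idP/idP; lra.
    by rewrite !ltr0_norm; [|lra|lra]; apply/idP/idP; lra.
  have := IH (~~ up) e true x (if up then e - eps else e + eps).
  case: up h {hg hs' E IH} => /= h IH; apply: IH => // _; lra.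
move=> h'.
have E : clamp eps (if up then e - eps else e + eps) x = if up then e - eps else e + eps.
  have [[h2 ->]|[h2 ->]|[h2 ->]] := clampE_cases (if up then e - eps else e + eps) x e0;
    by case: up h h' h2 {hg hs'}; unf; lra.
rewrite E cntE_extend; last by case: up {h h' hg hs' E}; unf; lra.
exact: IH.
Qed.

(** Rate independence: on a monotone stretch from [a] through [m] to [b] the intermediate input has
    no effect on the result. *)
Lemma clamp_clamp eps y a m b : 0 <= eps -> a - eps <= y <= a + eps ->
  a <= m <= b \/ b <= m <= a -> clamp eps (clamp eps y m) b = clamp eps y b.
Proof.
move=> e0 ha hm; have := clamp_itv y m e0.
have [[h1 ->]|[h1 ->]|[h1 ->]] := clampE_cases y m e0 => h0 //.
  have [[h2 ->]|[h2 ->]|[h2 ->]] := clampE_cases y b e0;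
  by have [[h3 ->]|[h3 ->]|[h3 ->]] := clampE_cases (m - eps) b e0; lra.
have [[h2 ->]|[h2 ->]|[h2 ->]] := clampE_cases y b e0;
by have [[h3 ->]|[h3 ->]|[h3 ->]] := clampE_cases (m + eps) b e0; lra.
Qed.

Lemma playseq_smooth eps L (x : nat -> R) k m : 0 <= eps ->
  [seq smooth eps L x i | i <- iota k.*2.+2 m.*2] =
  playseq eps (play eps x k) [seq refine (break eps x) x i | i <- iota k.*2.+2 m.*2].
Proof.
move=> e0; elim: m k => [//|m IH] k.
rewrite doubleS /= smooth_even (smooth_odd eps L x k.+1) refine_even (refine_odd _ x k.+1).
set m1 := x k + _; rewrite (_ : clamp eps (clamp eps _ m1) (x k.+1) = play eps x k.+1).
  by have := IH k.+1; rewrite doubleS => ->.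
apply: (@clamp_clamp _ _ (x k)) => //; first exact: play_itv.
by have := break_itv eps x k; rewrite /m1; have [] := leP (x k) (x k.+1); nra.
Qed.

End Subdivision.

(** * From the automaton to the monotone pieces of a curve *)

Section Pieces.
Context {R : realType}.
Implicit Types (delta t : R) (z : nat -> R) (c : R -> R) (up g : bool) (ts : seq R).

Fixpoint pieces c t ts : Prop :=
  if ts is t' :: ts' then maximal_monotone c t t' /\ pieces c t' ts' else t = 1.

Fixpoint shorts c delta t ts : nat :=
  if ts is t' :: ts' then (short_piece c delta t t' + shorts c delta t' ts')%N else 0%N.

Lemma pieces_monotone c ts : pieces c 0 ts -> monotone_pieces c (0 :: ts).
Proof.
move=> h; split=> //.
  have H u : pieces c u ts -> last u ts = 1.
    by elim: ts u {h} => [|t' ts IH] u //= -[_ /IH].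
  exact: H.
have H u : pieces c u ts -> forall i, (i.+1 < size (u :: ts))%N ->
    maximal_monotone c (u :: ts)`_i (u :: ts)`_i.+1.
  elim: ts u {h} => [|t' ts IH] u //= [h1 h2] [|i] //= hi.
  exact: (IH t' h2 i hi).
exact: H.
Qed.

Lemma num_shortE c delta ts : num_short c delta (0 :: ts) = shorts c delta 0 ts.
Proof.
have H u : count (fun i => short_piece c delta (u :: ts)`_i (u :: ts)`_i.+1)
    (iota 0 (size ts)) = shorts c delta u ts.
  elim: ts u => [|t' ts IH] u //.
  rewrite [size _]/= [iota _ _]/= [count _ _]/= [shorts _ _ _ _]/= -IH; congr (_ + _)%N.
  by rewrite -[1%N]addn0 iotaDl count_map; apply: eq_count => i /=.
exact: H.
Qed.

(** Arc-length is at least displacement, so counting by displacement can only overestimate the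
    number of short pieces. *)
Lemma short_piece_diff c delta a b : a <= b -> short_piece c delta a b ->
  `|c b - c a| <= 2 * delta.
Proof.
move=> ab h; rewrite -lee_fin; apply: le_trans h; exact: total_variation_ge.
Qed.

Section Walk.
Variables (z : nat -> R) (m : nat) (delta : R).
Hypothesis m0 : (0 < m)%N.
Let c t := pl z (t * m%:R).
Let T (i : nat) : R := i%:R / m%:R.

Let mR : 0 < m%:R :> R. Proof. by rewrite ltr0n. Qed.

Let cT i : c (T i) = z i.
Proof. by rewrite /c /T divfK ?pl_nat //; exact: lt0r_neq0. Qed.

Let TK i : T i * m%:R = i%:R.
Proof. by rewrite /T divfK //; exact: lt0r_neq0. Qed.

Let T_le i j : (i <= j)%N -> T i <= T j.
Proof. by move=> ij; rewrite /T ler_pM2r ?invr_gt0 // ler_nat. Qed.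

Let T_lt i j : (i < j)%N -> T i < T j.
Proof. by move=> ij; rewrite /T ltr_pM2r ?invr_gt0 // ltr_nat. Qed.

Let T_m : T m = 1.
Proof. by rewrite /T divff //; exact: lt0r_neq0. Qed.

Definition mono_on up a i := forall k, (a <= k < i)%N ->
  if up then z k <= z k.+1 else z k.+1 <= z k.

Lemma mono_on_between up a i k l : mono_on up a i -> (a <= k)%N -> (k <= l)%N -> (l <= i)%N ->
  if up then z k <= z l else z l <= z k.
Proof.
case: up => h ak kl li; first exact: (homo_seq h).
have := @homo_seq _ (fun n => - z n) a i _ k l ak kl li.
by rewrite lerN2; apply => n hn; rewrite lerN2; exact: h.
Qed.

Lemma plN (x : nat -> R) u : pl (fun k => - x k) u = - pl x u.
Proof. by rewrite /pl; ring. Qed.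

Lemma mono_on_curve up a i : mono_on up a i -> monotone_on c (T a) (T i).
Proof.
have tr u v : u \in `[T a, T i] -> v \in `[T a, T i] -> u <= v ->
    [/\ a%:R <= u * m%:R, u * m%:R <= v * m%:R & v * m%:R <= i%:R].
  rewrite !in_itv /= => /andP[u1 u2] /andP[v1 v2] uv; split.
  - by rewrite -(TK a) ler_pM2r.
  - by rewrite ler_pM2r.
  - by rewrite -(TK i) ler_pM2r.
case: up => h; [left|right].
  by move=> u v hu hv uv; have [h1 h2 h3] := tr u v hu hv uv; exact: (pl_homo h).
move=> u v hu hv uv; have [h1 h2 h3] := tr v u hv hu uv.
rewrite /c -lerN2 -!plN; apply: (@pl_homo _ _ a i) => // k hk.
by rewrite lerN2; exact: h.
Qed.

(** A longer piece contains a point of the next edge, where the curve strictly moves back, as well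
    as a strict move in direction [up] from [T a] to [T i]; it is monotone in neither direction. *)
Lemma maximal_piece up a i : (a < i)%N -> (i < m)%N -> mono_on up a i ->
  (if up then z a < z i /\ z i.+1 < z i else z i < z a /\ z i < z i.+1) ->
  maximal_monotone c (T a) (T i).
Proof.
move=> ai im h ht; split.
- by rewrite T_lt // -T_m T_le // ltnW.
- exact: mono_on_curve h.
move=> b' /andP[hb1 hb2] hmono.
(* The witness is kept on the next edge, where the curve is affine. *)
pose t := Num.min b' (T i.+1).
have tb : t <= b' by rewrite /t ge_min lexx.
have it : T i < t by rewrite /t lt_min hb1 T_lt.
have ti : t <= T i.+1 by rewrite /t ge_min lexx orbT.
have ain : T a \in `[T a, b'] by rewrite in_itv /= lexx (le_trans (T_le (ltnW ai)) (ltW hb1)).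
have iin : T i \in `[T a, b'] by rewrite in_itv /= T_le ?(ltnW ai) // ltW.
have tin : t \in `[T a, b'] by rewrite in_itv /= tb andbT (le_trans (T_le (ltnW ai)) (ltW it)).
have aiT := T_le (ltnW ai).
have h1 : i%:R < t * m%:R by rewrite -(TK i) ltr_pM2r.
have h2 : t * m%:R <= i.+1%:R by rewrite -(TK i.+1) ler_pM2r.
have E : t * m%:R = i%:R + (t * m%:R - i%:R) by ring.
have ct : c t = z i + (t * m%:R - i%:R) * (z i.+1 - z i).
  by rewrite /c {1}E pl_edge; [ring|rewrite -natr1 in h2; lra].
have q0 : 0 < t * m%:R - i%:R by lra.
case: hmono => hm.
  have := hm _ _ ain iin aiT; have := hm _ _ iin tin (ltW it); rewrite !cT ct.
  by case: up ht {h} => ht; nra.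
have := hm _ _ iin ain aiT; have := hm _ _ tin iin (ltW it); rewrite !cT ct.
by case: up ht {h} => ht; nra.
Qed.

(** At level 0 the automaton retraces the greedy decomposition. The hypothesis on the count with
    [delta = 0] says that no piece has amplitude 0; in particular [up] is the true direction of the
    first piece. *)
Lemma walk i up a g : (a <= i <= m)%N -> mono_on up a i ->
  short_pieces 0 0 up (z a) true (z i) 0 (timed [seq z k | k <- iota i.+1 (m - i)]) = 0%N ->
  exists ts, pieces c (T a) ts /\
   (shorts c delta (T a) ts <=
    short_pieces 0 delta up (z a) true (z i) 0 (timed [seq z k | k <- iota i.+1 (m - i)]))%N.
Proof.
move E : (m - i)%N => n; elim: n i up a E => [|n IH] i up a E /andP[ai im] hmono.
  have {}E : i = m by lia.
  rewrite [timed _]/= !cnt_nil E /=; case hz: (short 0 0 (z a) (z m)) => // _.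
  move: hz; rewrite /short !mulr0 addr0 => hz; exists [:: 1]; split=> /=.
    split=> //; split.
    + have am : (a < m)%N.
        rewrite ltn_neqAle -{2}E ai andbT.
        by apply/eqP => am; move: hz; rewrite am subrr normr0 lexx.
      by rewrite -{1}T_m T_lt // lexx.
    + by rewrite -[in X in monotone_on _ _ X]T_m -{1}E; exact: mono_on_curve hmono.
    + by move=> b' /andP[h1 h2]; have := lt_le_trans h1 h2; rewrite ltxx.
  rewrite addn0; case: (boolP (short_piece _ _ _ _)) => // hs.
  have h1 : T a <= 1 by rewrite -T_m; apply: T_le; rewrite -E.
  have := short_piece_diff h1 hs; rewrite -{1}T_m !cT => h2.
  by rewrite add0r h2.
have e0 := lexx (0 : R).
rewrite /= -/(timed _) => h.
have hin : (i < m)%N by lia.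
have En : (m - i.+1)%N = n by lia.
have hcase : beyond up (z i) (z i.+1) \/ (if up then z i.+1 < z i else z i < z i.+1).
  by case: (up); rewrite /beyond; have [] := leP (z i) (z i.+1); have [] := leP (z i.+1) (z i); auto.
case: hcase => hx.
  rewrite cntE_extend // in h; rewrite cntE_extend //.
  apply: IH => //; first by lia.
  move=> k hk; have [ki|ki] := eqVneq k i; first by subst k; case: up hx {h hmono}.
  by apply: hmono; lia.
have hturn : (if up then 2 * 0 < z i - z i.+1 else 2 * 0 < z i.+1 - z i) by clear En E; case: up hx {h hmono IH} => hx; lra.
rewrite (@cntE_turn _ 0 _ e0) // in h; rewrite (@cntE_turn _ 0 delta e0) //.
move/eqP: h; rewrite addn_eq0 /= lexx => /andP[h1 /eqP h2].
have [||ts [hts1 hts2]] := IH i.+1 (~~ up) i En _ _ h2; first by lia.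
  by move=> k hk; have -> : k = i by [lia|]; case: up hx {h1 h2 hturn hmono} => /= /ltW.
have aiz : (a < i)%N.
  rewrite ltn_neqAle ai andbT; apply/eqP => ai'; move: h1.
  by rewrite ai' /short subrr normr0 !mulr0 addr0 lexx.
have hz : if up then z a < z i else z i < z a.
  have := mono_on_between hmono (leqnn _) ai (leqnn _); move: h1; rewrite /short !mulr0 addr0.
  case: up {hmono hx hturn h2 hts2} => h3 h4; rewrite lt_neqAle h4 andbT; apply/eqP => h5;
  by move: h3; rewrite h5 subrr normr0 lexx.
exists (T i :: ts); split=> /=.
  split=> //; apply: (maximal_piece aiz hin hmono).
  by case: up hx hz {h2 hts2 hturn hmono}.
apply: leq_add => //; case: (boolP (short_piece _ _ _ _)) => // hs.
have := short_piece_diff (T_le ai) hs; rewrite !cT /short mulr0 add0r => ->.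
by [].
Qed.

Lemma few_short_walk up : 
  short_pieces 0 0 up (z 0%N) true (z 0%N) 0 (timed [seq z k | k <- iota 1 m]) = 0%N ->
  exists s, monotone_pieces c s /\ (num_short c delta s <=
    short_pieces 0 delta up (z 0%N) true (z 0%N) 0 (timed [seq z k | k <- iota 1 m]))%N.
Proof.
move=> h; have := @walk 0%N up 0%N true; rewrite subn0 => /(_ _ _ h).
case=> [//|k|ts [h1 h2]]; first by rewrite ltn0 andbF.
have T0 : T 0 = 0 by rewrite /T mul0r.
rewrite T0 in h1 h2; exists (0 :: ts); rewrite num_shortE; split=> //.
exact: pieces_monotone.
Qed.

End Walk.
End Pieces.

(** * Effect of one stage on the counts *)

Section StageCount.
Context {R : realType} {d : nat}.
Implicit Types (p q : seq 'rV[R]_d) (j k : 'I_d) (eps L delta : R) (up g : bool).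

Definition vals p j := [seq vcoord p j i | i <- iota 1 (size p).-1].

Definition pieces_count eps delta p j up g :=
  short_pieces eps delta up (vcoord p j 0) g (vcoord p j 0) 0 (timed (vals p j)).

Lemma vals_stage j eps L p k : (0 < size p)%N ->
  vals (stage j eps L p) k =
  [seq if k == j then smooth eps L (vcoord p j) i
       else refine (break eps (vcoord p j)) (vcoord p k) i | i <- iota 1 (size p).-1.*2.+1].
Proof.
move=> p0; rewrite /vals pred_size_stage //; apply/eq_in_map => i.
by rewrite mem_iota => hi; rewrite coord_stage //; lia.
Qed.

Lemma coord0_stage j eps L p k : (0 < size p)%N ->
  vcoord (stage j eps L p) k 0 = if k == j then vcoord p j 0 - L else vcoord p k 0.
Proof. by move=> p0; rewrite coord_stage // double_gt0. Qed.

Lemma pieces_count_other e delta j eps L p k up g : (0 < size p)%N -> k != j -> 0 <= e ->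
  pieces_count e delta (stage j eps L p) k up g = pieces_count e delta p k up g.
Proof.
move=> p0 kj e0; rewrite /pieces_count vals_stage // coord0_stage // (negbTE kj).
apply: cnt_subdivides => //.
  exact: (subdivides_refine0 (vcoord p k) _ (break_itv eps (vcoord p j))).
by case: up; unf; lra.
Qed.

(** The prepended edge rises by [L - eps] into the first piece, which can thus be short only if
    [L - eps <= 2 * delta]. All other pieces are those of the input at level [eps], whose own first
    piece is left uncounted. *)
Lemma pieces_count_self delta j eps L p g : (0 < size p)%N -> 0 <= eps <= L ->
  (pieces_count 0 delta (stage j eps L p) j true g <=
   pieces_count eps delta p j true false + (g && (L - eps <= 2 * delta)%R))%N.
Proof.
move=> p0 /andP[e0 eL]; rewrite /pieces_count vals_stage // coord0_stage // eqxx.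
rewrite [iota _ _]/= [map _ _]/= [timed _]/= (smooth_odd eps L _ 0) [play _ _ 0]/=.
rewrite -/(timed _) cntE_extend; last by unf; lra.
apply: leq_trans (@cnt_mono R 0 delta (lexx 0) true _ 0 g _ 0 _ _) _; first by rewrite /=; lra.
apply: leq_add; last first.
  rewrite /short mulr0 add0r (_ : vcoord p j 0 - eps - (vcoord p j 0 - L) = L - eps); last by ring.
  by rewrite ger0_norm //; lra.
rewrite (@playseq_smooth R eps L (vcoord p j) 0 (size p).-1 e0).
have := @cnt_playseq R eps delta true (vcoord p j 0) false (vcoord p j 0) 0
   [seq refine (break eps (vcoord p j)) (vcoord p j) i | i <- iota 2 (size p).-1.*2] e0.
move=> /(_ ltac:(done) ltac:(done)) /= ->.
rewrite (cnt_subdivides delta _ _ e0 (subdivides_refine (vcoord p j) 0 (size p).-1 (break_itv eps (vcoord p j)))) //.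
by unf; lra.
Qed.

(** A piece born at a turn exceeds amplitude [2 * eps] from its first vertex on, so it is never
    short for [delta = 0]. *)
Lemma cnt_positive eps up s g e be l : 0 <= eps ->
  (g -> if up then 2 * eps < e - s else 2 * eps < s - e) ->
  short_pieces eps 0 up s g e be l = 0%N.
Proof.
move=> e0; elim: l up s g e be => [|[x b] l IH] up s g e be hg.
  rewrite cnt_nil; case: g hg => //= /(_ isT) h; rewrite /short mulr0 addr0; apply/eqP.
  by rewrite eqb0 -ltNge; case: up h => h; [rewrite gtr0_norm|rewrite ltr0_norm]; lra.
case: (stepP 0 e0 up s g e be x b l) => h.
- by apply: IH => /hg; case: up h {hg}; unf; lra.
- rewrite IH; last by case: up h {hg} => /=; lra.
  rewrite addn0; case: g hg => //= /(_ isT) hg; rewrite /short mulr0 addr0; apply/eqP.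
  by rewrite eqb0 -ltNge; case: up hg {h} => h; [rewrite gtr0_norm|rewrite ltr0_norm]; lra.
by move=> _; exact: IH.
Qed.

Lemma projectionE p j : projection (curve p) j = fun t => pl (vcoord p j) (t * (size p).-1%:R).
Proof. by apply/funext => t; rewrite /projection curve_coord. Qed.

Lemma few_short_positive delta p j : (1 < size p)%N -> 
  forall up, pieces_count 0 0 p j up true = 0%N ->
  exists s, monotone_pieces (projection (curve p) j) s /\
   (num_short (projection (curve p) j) delta s <= pieces_count 0 delta p j up true)%N.
Proof.
move=> p1 up h; rewrite projectionE.
by apply: (@few_short_walk R (vcoord p j) (size p).-1 delta); first lia.
Qed.

(** [up] is the direction of the first strict move; without such a move the sequence is constant. *)
Lemma first_move (a : R) (l : seq R) : (forall x, x \in l -> x = a) \/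
  exists up, short_pieces 0 0 up a true a 0 (timed l) = 0%N.
Proof.
have e0 := lexx (0 : R).
elim: l => [|x l [IH|[up IH]]]; first by left.
- have [xa|ax|xa] := ltgtP x a.
  + right; exists false => /=; rewrite cntE_extend; last by unf; lra.
    by apply: cnt_positive => // _; lra.
  + right; exists true => /=; rewrite cntE_extend; last by unf; lra.
    by apply: cnt_positive => // _; lra.
  + by left => y; rewrite inE => /orP[/eqP ->|/IH]; rewrite ?xa.
have [xa|ax|->] := ltgtP x a.
+ right; exists false => /=; rewrite cntE_extend; last by unf; lra.
  by apply: cnt_positive => // _; lra.
+ right; exists true => /=; rewrite cntE_extend; last by unf; lra.
  by apply: cnt_positive => // _; lra.
right; exists up => /=; rewrite cntE_extend //; last by case: (up); unf; lra.
Qed.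

(** This settles [delta = 0], where short means of length 0: a constant coordinate is one single
    piece, and any other has no piece of length 0. *)
Lemma few_short_zero p j : (0 < size p)%N ->
  few_short_pieces (projection (curve p) j) 0 1.
Proof.
move=> p0; have [h|[up h]] := first_move (vcoord p j 0) (vals p j); last first.
  have [p1|p1] := ltnP 1 (size p); last first.
    have E : size p = 1%N by lia.
    by move: h; rewrite /vals E /= cnt_nil /short subrr normr0 !mulr0 addr0 lexx.
  have [s [hs hn]] := few_short_positive 0 p1 h.
  exists s; split=> //; move: hn; rewrite /pieces_count h leqn0 => /eqP ->.
  exact: ler01.
have hc t : 0 <= t <= 1 -> projection (curve p) j t = vcoord p j 0.
  move=> ht; rewrite projectionE.
  have [E|m0] := eqVneq (size p).-1 0%N; first by rewrite E mulr0 (pl_nat _ 0).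
  have hz i : (i <= (size p).-1)%N -> vcoord p j i = vcoord p j 0.
    case: i => // i hi; apply: h; apply/mapP; exists i.+1 => //.
    by rewrite mem_iota; lia.
  have [|k [t' [km -> ht']]] := @edge_split_le _ (t * (size p).-1%:R) (size p).-2.
    rewrite prednK; last by rewrite lt0n.
    have : 0 <= (size p).-1%:R :> R by [].
    by nra.
  by rewrite pl_edge // !hz; [ring|lia|lia].
exists [:: 0; 1]; split.
  split=> // -[|i] //= _; split; rewrite ?ltr01 ?lexx //.
    left=> x y; rewrite !in_itv /= => hx hy _; rewrite !hc //.
  by move=> b' /andP[h1 h2]; have := lt_le_trans h1 h2; rewrite ltxx.
by rewrite -[leRHS]/(1%:R) ler_nat /num_short /=; case: (short_piece _ _ _ _).
Qed.

End StageCount.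

(** * Stages for all coordinates *)

Section Stages.
Context {R : realType} {d : nat}.
Implicit Types (p q : seq 'rV[R]_d) (j k : 'I_d) (js : seq 'I_d) (eps : 'I_d -> R) (L delta : R).

Definition stages eps L js p := foldl (fun p j => stage j (eps j) L p) p js.

Lemma size_stages eps L js p : size (stages eps L js p) = (size p * 2 ^ size js)%N.
Proof.
rewrite /stages; elim: js p => [|j js IH] p /=; first by rewrite muln1.
by rewrite IH size_stage expnS -muln2 mulnA.
Qed.

Lemma size_stages_gt0 eps L js p : (0 < size p)%N -> (0 < size (stages eps L js p))%N.
Proof. by move=> h; rewrite size_stages muln_gt0 h expn_gt0. Qed.

Lemma matched_stages eps L js p q C : (forall j, 0 <= eps j <= L) ->
  (0 < size p)%N -> (0 < size q)%N ->
  matched p q C -> matched (stages eps L js p) (stages eps L js q) C.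
Proof.
move=> he; rewrite /stages; elim: js p q => [|j js IH] p q p0 q0 //= h.
by apply: IH; rewrite ?size_stage ?double_gt0 //; exact: matched_stage.
Qed.

(** As [js] has no repetitions, each coordinate is charged [2 * L] at most once. *)
Lemma matched_unstages eps L js p q C : (forall j, 0 <= eps j <= L) -> uniq js ->
  (0 < size p)%N -> (0 < size q)%N ->
  matched (stages eps L js p) (stages eps L js q) C ->
  matched p q (fun k => C k + (if k \in js then 2 * L else 0)).
Proof.
move=> he; rewrite /stages; elim: js p q => [|j js IH] p q /=.
  move=> _ p0 q0 [F [G [h1 h2 h3]]]; exists F, G; split=> // t k ht.
  by rewrite addr0; exact: h3.
move=> /andP[jjs ujs] p0 q0 h.
have /IH := h; rewrite !size_stage !double_gt0 => /(_ ujs p0 q0) h'.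
have [F [G [h1 h2 h3]]] := matched_unstage (he j) p0 q0 h'.
exists F, G; split=> // t k ht; apply: le_trans (h3 t k ht) _.
rewrite inE; have [->|kj] := eqVneq k j; first by rewrite (negbTE jjs) /= addr0.
by rewrite addr0.
Qed.

Lemma stages_count_other e delta eps L js p k up g : 0 <= e -> (0 < size p)%N -> k \notin js ->
  pieces_count e delta (stages eps L js p) k up g = pieces_count e delta p k up g.
Proof.
move=> e0; rewrite /stages; elim: js p => [|j js IH] p p0 //=.
rewrite inE negb_or => /andP[kj kjs]; rewrite IH ?size_stage ?double_gt0 //.
exact: pieces_count_other.
Qed.

(** The stages of other coordinates only subdivide coordinate [j]. Those before its own stage
    preserve the count at level [eps j], those after it the count at level 0. *)
Lemma stages_count_self delta eps L js p j g : (forall j, 0 <= eps j <= L) ->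
  (0 < size p)%N -> uniq js -> j \in js ->
  (pieces_count 0 delta (stages eps L js p) j true g <=
   pieces_count (eps j) delta p j true false + (g && (L - eps j <= 2 * delta)%R))%N.
Proof.
move=> he; rewrite /stages; elim: js p => [|i js IH] p p0 //= /andP[ijs ujs].
rewrite inE; have [<- _|ji /= jjs] := eqVneq i j.
  rewrite stages_count_other ?size_stage ?double_gt0 //.
  exact: pieces_count_self.
apply: leq_trans (IH _ _ ujs jjs) _; first by rewrite size_stage double_gt0.
rewrite pieces_count_other 1?eq_sym //; by case/andP: (he j).
Qed.

Lemma few_short_stages (delta L : R) eps p j (x : R) : 0 < delta ->
  (forall j, 0 <= eps j < L) -> (0 < size p)%N ->
  (pieces_count (eps j) delta p j true false + (L - eps j <= 2 * delta)%R)%N%:R <= x ->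
  few_short_pieces (projection (curve (stages eps L (enum 'I_d) p)) j) delta x.
Proof.
move=> d0 he p0 hx; set p' := stages _ _ _ _.
have he' k : 0 <= eps k <= L by have := he k; lra.
have p1 : (1 < size p')%N.
  have d_gt0 : (0 < d)%N := leq_ltn_trans (leq0n j) (ltn_ord j).
  have : (2 ^ 1 <= 2 ^ d)%N by rewrite leq_exp2l.
  by rewrite size_stages size_enum_ord; nia.
have hj : j \in enum 'I_d by rewrite mem_enum.
(* With [eps j < L] the prepended edge has positive length, so no piece of the result is degenerate
   and [few_short_positive] applies. *)
have h0 : pieces_count 0 0 p' j true true = 0%N.
  apply/eqP; rewrite -leqn0; apply: leq_trans (stages_count_self 0 true he' p0 (enum_uniq _) hj) _.
  rewrite /pieces_count cnt_positive //; last by have := he j; lra.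
  by rewrite mulr0 add0n leqn0 eqb0 -ltNge; have := he j; lra.
have [s [hs hn]] := few_short_positive delta p1 h0.
exists s; split=> //; apply: le_trans hx; rewrite ler_nat; apply: leq_trans hn _.
exact: (stages_count_self delta true he' p0 (enum_uniq _) hj).
Qed.

Lemma frechet_stages eps L p q : (forall j, 0 <= eps j <= L) -> 
  (0 < size p)%N -> (0 < size q)%N -> (0 < d)%N ->
  let p' := stages eps L (enum 'I_d) p in let q' := stages eps L (enum 'I_d) q in
  frechet (curve p') (curve q') <= frechet (curve p) (curve q) /\
  frechet (curve p) (curve q) <= frechet (curve p') (curve q') + 2 * L.
Proof.
move=> he p0 q0 d0 p' q'.
have L0 : 0 <= L by have := he (Ordinal d0); lra.
have F1 := frechet_ge0 p q; have F2 := frechet_ge0 p' q'.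
split; apply/ler_addgt0Pr => e e0.
  apply: frechet_le; last exact: addr_ge0 F1 (ltW e0).
  by apply: matched_stages => //; apply: frechet_lt; rewrite ltrDl.
apply: frechet_le; last first.
  by apply: addr_ge0 (ltW e0); apply: addr_ge0 F2 _; rewrite mulr_ge0.
have h : matched p' q' (fun=> frechet (curve p') (curve q') + e).
  by apply: frechet_lt; rewrite ltrDl.
have [F [G [h1 h2 h3]]] := matched_unstages he (enum_uniq _) p0 q0 h.
exists F, G; split=> // t k ht; apply: le_trans (h3 t k ht) _.
by rewrite mem_enum /= addrAC.
Qed.

End Stages.

(** * The stack of nested pieces *)

Ltac nlia := repeat match goal with H : ?T |- _ => lazymatch T with
  | is_true (leq _ _) => fail
  | is_true (andb (leq _ _) _) => fail
  | is_true (negb _) => fail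
  | @eq nat _ _ => fail
  | nat => fail
  | _ \/ _ => fail
  | _ => clear H end end; lia.

(** * Counting functions given by their jumps *)

Section Events.
Context {R : realType}.
Implicit Types (ev : seq (R * R)) (x L delta b dth rl : R).

Definition cov ev x : R := \sum_(e <- ev | e.1 <= x) e.2.
(** The integral of [cov ev] over [[0, L]] for events in that range: a jump by [w] at [t]
    contributes [w * (L - t)]. *)
Definition area L ev : R := \sum_(e <- ev) e.2 * (L - e.1).

Lemma cov_cat ev ev' x : cov (ev ++ ev') x = cov ev x + cov ev' x.
Proof. by rewrite /cov big_cat. Qed.

Lemma area_cat L ev ev' : area L (ev ++ ev') = area L ev + area L ev'.
Proof. by rewrite /area big_cat. Qed.

(* The jumps of the indicator function of those levels in [[b, dth[] (cut off at [L]) at which a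
   piece of amplitude [rl] is short. *)
Definition emitted L delta rl b dth : seq (R * R) :=
  let lo := if rl / 2 - delta <= b then b else rl / 2 - delta in
  if dth <= lo then [::] else if L <= lo then [::]
  else (lo, 1) :: (if L <= dth then [::] else [:: (dth, -1)]).

Lemma cov_emitted L delta rl b dth x : x < L ->
  cov (emitted L delta rl b dth) x = [&& b <= x, rl <= 2 * x + 2 * delta & x < dth]%:R.
Proof.
move=> xL; rewrite /emitted /cov; set lo := (if _ then b else _).
have -> : [&& b <= x, rl <= 2 * x + 2 * delta & x < dth] = (lo <= x < dth).
  rewrite andbA; congr andb; rewrite /lo; case: ifP => h; apply/idP/idP; lra.
case: (leP dth lo) => h1.
  by rewrite big_nil; case: (leP lo x) => //= h2; case: ltP => // h3; exfalso; lra.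
case: (leP L lo) => h2.
  by rewrite big_nil; case: (leP lo x) => //= h3; exfalso; lra.
case: (leP L dth) => h3; rewrite !big_cons big_nil /=.
  case: (leP lo x) => //= h4; rewrite ?addr0.
  by have -> : x < dth by lra.
case: (leP lo x) => h4 /=.
  by rewrite ltNge; case: (leP dth x) => h5 /=; rewrite ?addr0 // subrr.
by case: (leP dth x) => h5 /=; rewrite ?addr0 //; exfalso; lra.
Qed.

(* A bound for the measure of the levels above [b] at which a piece of amplitude [rl] still exists
   and is short. *)
Definition credit delta rl b : R := Num.min (rl - 2 * b) (2 * delta) / 2.

Lemma credit_ge0 delta rl b : 2 * b <= rl -> 0 <= delta -> 0 <= credit delta rl b.
Proof. by move=> h1 h2; rewrite /credit divr_ge0 // le_min; lra. Qed.

Lemma credit_le1 delta rl b : credit delta rl b <= (rl - 2 * b) / 2.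
Proof. by rewrite /credit ler_pM2r ?invr_gt0 // ge_min lexx. Qed.

Lemma credit_le2 delta rl b : credit delta rl b <= delta.
Proof. by rewrite /credit ler_pdivrMr // ge_min [delta * _]mulrC lexx orbT. Qed.

Lemma credit_cases delta rl b : credit delta rl b = (rl - 2 * b) / 2 \/ 
  credit delta rl b = delta.
Proof.
rewrite /credit; case: (leP (rl - 2 * b) (2 * delta)) => _; [by left|right].
by rewrite mulrC mulKf.
Qed.

(** As a function of [b] the credit is constant while the piece is too long to be short and falls at
    unit rate afterwards. Its drop from [b] to [dth] is thus the length of the interval of levels at
    which the piece is short. *)
Lemma area_emitted L delta rl b dth : b <= dth ->
  area L (emitted L delta rl b dth) <= credit delta rl b - credit delta rl dth.
Proof.
move=> hb; rewrite /emitted; set lo := (if _ then b else _).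
have hlo : 0 <= credit delta rl b - credit delta rl dth /\
    dth - lo <= credit delta rl b - credit delta rl dth.
  have := credit_le1 delta rl dth; have := credit_le2 delta rl dth.
  move=> h1 h2; rewrite /lo; move: h1 h2; set c2 := credit _ _ dth => h1 h2; rewrite /credit; case: ifP => h.
    have -> : Num.min (rl - 2 * b) (2 * delta) = rl - 2 * b by apply/min_idPl; lra.
    lra.
  have -> : Num.min (rl - 2 * b) (2 * delta) = 2 * delta.
    by apply/min_idPr; move/negbT: h; rewrite -ltNge; lra.
  lra.
case: hlo; set c := _ - _ => h1 h2.
case: (leP dth lo) => h3; first by rewrite /area big_nil.
case: (leP L lo) => h4; first by rewrite /area big_nil.
by case: (leP L dth) => h5; rewrite /area !big_cons big_nil /=; lra.
Qed.

Lemma emitted_nil L delta rl b dth : dth <= b -> emitted L delta rl b dth = [::].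
Proof.
by move=> h; rewrite /emitted; case: (leP (rl / 2 - delta) b) => h1; rewrite ifT //; lra.
Qed.

Lemma emitted_in L delta rl b dth e : 0 <= b -> e \in emitted L delta rl b dth ->
  0 <= e.1 < L.
Proof.
move=> b0; rewrite /emitted; set lo := (if _ then b else _).
have hlo : 0 <= lo by rewrite /lo; case: (leP (rl / 2 - delta) b) => h; lra.
case: (leP dth lo) => h1 //; case: (leP L lo) => h2 //; rewrite inE; case: (leP L dth) => h3.
  by rewrite orbF => /eqP -> /=; lra.
by rewrite inE => /orP[] /eqP -> /=; lra.
Qed.

Lemma emitted_late L delta rl b dth : L <= b -> emitted L delta rl b dth = [::].
Proof.
move=> h; rewrite /emitted; set lo := (if _ then b else _).
have hlo : L <= lo by rewrite /lo; case: (leP (rl / 2 - delta) b) => h1; lra.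
by case: (leP dth lo) => // _; rewrite hlo.
Qed.

(** The uncapped credits add up, [(a - b + c) / 2 - be = (a / 2 - be) + (c - b) / 2], and capping
    non-negative terms at [delta] is subadditive. *)
Lemma credit_merge delta a b c be : 0 <= delta -> 2 * be <= a -> b <= c ->
  credit delta (a - b + c) be <= credit delta a be + credit delta c (b / 2).
Proof.
move=> d0 h1 h2.
have := credit_le1 delta (a - b + c) be; have := credit_le2 delta (a - b + c) be.
have h3 : 2 * (b / 2) = b by field.
have := @credit_ge0 delta a be h1 d0; have := @credit_ge0 delta c (b / 2).
rewrite h3 => /(_ h2 d0).
have [->|->] := credit_cases delta a be; have [->|->] := credit_cases delta c (b / 2); lra.
Qed.

Lemma credit_half delta a : 0 <= delta -> credit delta a (a / 2) = 0.
Proof.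
move=> d0; rewrite /credit (_ : a - 2 * (a / 2) = 0); last by field.
by rewrite min_l ?mul0r //; lra.
Qed.

Lemma size_emitted L delta rl b dth : (size (emitted L delta rl b dth) <= 2)%N.
Proof. by rewrite /emitted; do ![case: ifP => //] => *. Qed.

End Events.

(** * Reading a vertex onto the stack *)

Section Stack.
Context {R : realType}.
Implicit Types (V B : nat -> R) (r k : nat) (x L delta eps : R) (rest : seq R).

Definition gap V k : R := `|V k.+1 - V k|.

(* [V k] are alternating local extrema, and the piece from [V k] to [V k.+1] is counted from level
   [B k] on.  The piece starting at [V 0] is a sentinel: too tall to be popped, and born too late
   to be counted. *)
Record stack_inv L V B r : Prop := StackInv {
  stack_r : (0 < r)%N;
  stack_B0 : L <= B 0%N;
  stack_Br : B r = 0;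
  stack_V0 : 2 * L < V 1%N - V 0%N;
  stack_alt : forall k, (k < r)%N -> if odd k then V k.+1 < V k else V k < V k.+1;
  stack_birth0 : forall k, (1 <= k < r)%N -> 0 <= B k;
  stack_birth1 : forall k, (1 <= k < r)%N -> 2 * B k <= gap V k;
  stack_birth2 : forall k, (2 <= k < r)%N -> 2 * B k <= gap V k.-1 }.

(** Nested excursions have amplitudes shrinking towards the top; the sentinel is exempt. After a
    vertex has been read the property holds up to [r.-1], and pops restore it for the top piece. *)
Definition decreasing V r := forall k, (2 <= k < r)%N -> gap V k < gap V k.-1.

Lemma decreasing_lt V r i j : decreasing V r -> (0 < i < j)%N -> (j < r)%N ->
  gap V j < gap V i.
Proof.
move=> hd; elim: j => [|j IH]; first by rewrite ltn0 andbF.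
move=> /andP[i0]; rewrite ltnS leq_eqVlt => /orP[/eqP <-|ij] jr.
  by apply: (hd i.+1); rewrite jr andbT ltnS.
apply: lt_trans (IH _ _); last by apply: ltnW.
  by apply: (hd j.+1); rewrite jr andbT ltnS (leq_trans _ ij).
by rewrite i0.
Qed.

Definition entries V B a n : seq (R * R) := [seq (V k, B k) | k <- iota a n].

(** The automaton reads the stack in place of the consumed input. It starts downwards at [V 0], so
    that [V 1] is a turn and the sentinel gets the flag [B 0 <= eps], false for [eps < L]. *)
Definition stack_count eps delta V B r rest :=
  short_pieces eps delta false (V 0%N) false (V 0%N) 0 (entries V B 0 r.+1 ++ timed rest).

Definition stack_credit delta V B r := \sum_(1 <= k < r) credit delta (gap V k) (B k).

Lemma eq_entries V B V' B' n : (forall k, (k < n)%N -> V k = V' k /\ B k = B' k) ->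
  entries V B 0 n = entries V' B' 0 n.
Proof.
by move=> h; apply/eq_in_map => k; rewrite mem_iota => /= hk; have [-> ->] := h k hk.
Qed.

Lemma entriesS V B n : entries V B 0 n.+1 = rcons (entries V B 0 n) (V n, B n).
Proof. by rewrite /entries -addn1 iotaD map_cat cats1 add0n. Qed.

(** When all gaps exceed [2 * eps], no entry is hidden by the hysteresis: every one is a turn and
    the state after reading them is known. *)
Lemma cnt_tall eps delta V B k : 0 <= eps ->
  (forall i, (i < k)%N -> if odd i then V i.+1 < V i else V i < V i.+1) ->
  (forall i, (i < k)%N -> 2 * eps < gap V i) ->
  exists K s' g', forall b' l,
    short_pieces eps delta false (V 0%N) false (V 0%N) 0 (entries V B 0 k ++ (V k, b') :: l) =
    (K + short_pieces eps delta (odd k) s' g' (V k) b' l)%N.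
Proof.
move=> e0; elim: k => [|k IH] halt hgap.
  by exists 0%N, (V 0%N), false => b' l; rewrite add0n /= cntE_extend //; unf; lra.
have [||K [s' [g' h]]] := IH; [by move=> i ik; apply: halt; nlia|by move=> i ik; apply: hgap; nlia|].
exists (K + (g' && short eps delta s' (V k)))%N, (V k), (B k <= eps) => b' l.
rewrite entriesS cat_rcons h cntE_turn //; first by rewrite addnA.
have := halt k (leqnn _); have := hgap k (leqnn _); rewrite /gap.
by case: (odd k) => h1 h2; move: h1; rewrite ?(distE_lt h2) ?(distE_gt h2).
Qed.

Lemma stack_credit1 delta V B : stack_credit delta V B 1 = 0.
Proof. by rewrite /stack_credit big_geq. Qed.

Lemma stack_creditS delta V B r : (0 < r)%N ->
  stack_credit delta V B r.+1 = stack_credit delta V B r + credit delta (gap V r) (B r).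
Proof. by move=> r0; rewrite /stack_credit big_nat_recr. Qed.

Lemma eq_stack_credit delta V B V' B' r :
  (forall k, (k <= r)%N -> V k = V' k) -> (forall k, (0 < k < r)%N -> B k = B' k) ->
  stack_credit delta V B r = stack_credit delta V' B' r.
Proof.
move=> hV hB; apply: eq_big_nat => k hk; rewrite /gap !hV ?hB //; nlia.
Qed.

Lemma update_same (T : Type) (f : nat -> T) k v : update f k v k = v.
Proof. by rewrite /update eqxx. Qed.

Lemma update_other (T : Type) (f : nat -> T) k v i : i != k -> update f k v i = f i.
Proof. by move=> h; rewrite /update (negbTE h). Qed.

Lemma stack_step_count eps delta V B r x rest : 0 <= eps -> (0 < r)%N ->
  (V r.-1 < V r <= x \/ x <= V r < V r.-1) ->
  stack_count eps delta V B r (x :: rest) =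
  short_pieces eps delta false (V 0%N) false (V 0%N) 0 (entries V B 0 r ++ (x, 0) :: timed rest).
Proof.
move=> e0; case: r => // r _; rewrite [r.+1.-1]/= => hx.
rewrite /stack_count 2!entriesS !cat_rcons.
have [K [up' [s' [g' [e' [be' [h1 h2]]]]]]] := cnt_context delta e0 (entries V B 0 r) (V r) (B r) false (V 0%N) false (V 0%N) 0.
rewrite [timed _]/= !h2; congr (_ + _)%N.
exact: (cnt_insert delta e0 s' g' be' _ _ _ h1 hx).
Qed.

(** The old end of the top piece is passed over by the new vertex and may be overwritten. Only the
    top piece changes its credit, and no credit exceeds [delta]; this is what one vertex pays. *)
Lemma stack_continue L V B r x : stack_inv L V B r -> 0 <= (x - V r) * (V r - V r.-1) ->
  let V' := update V r x in
  [/\ stack_inv L V' B r, decreasing V r -> decreasing V' r.-1,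
      forall eps delta rest, 0 <= eps ->
        stack_count eps delta V B r (x :: rest) = stack_count eps delta V' B r rest &
      forall delta, 0 <= delta ->
        stack_credit delta V' B r <= stack_credit delta V B r + delta].
Proof.
move=> [r0 hB0 hBr hV0 halt hb0 hb1 hb2] hx.
case: r r0 hBr halt hb0 hb1 hb2 hx => // r _ hBr halt hb0 hb1 hb2 hx V'.
rewrite [r.+1.-1]/= in hx *.
have hr := halt r (leqnn _).
have hmono : V r < V r.+1 <= x \/ x <= V r.+1 < V r.
  by case: (odd r) hr => hr; [right|left]; rewrite hr ?andbT /=; nra.
have Vs : V' r.+1 = x by rewrite /V' update_same.
have Vo k : k != r.+1 -> V' k = V k by move=> hk; rewrite /V' update_other.
clearbody V'.
have hgap k : (k < r)%N -> gap V' k = gap V k by move=> kr; rewrite /gap !Vo //; nlia.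
have hgapr : gap V r <= gap V' r.
  rewrite /gap Vs Vo; last nlia.
   case: hmono => h.
    by rewrite !ger0_norm; lra.
  by rewrite !ler0_norm; lra.
have gap_le k : (k <= r)%N -> gap V k <= gap V' k.
  by rewrite leq_eqVlt => /orP[/eqP -> //|/hgap ->].
split.
- split=> //.
  + case: r {hBr halt hb0 hb1 hb2 hx hgap hgapr gap_le} hmono hr Vs Vo => [|r] h hr Vs Vo.
      by rewrite /= in hr; rewrite Vs Vo //; lra.
    by rewrite !Vo.
  + move=> k; rewrite ltnS leq_eqVlt => /orP[/eqP ->|kr].
      by rewrite Vs Vo; [|nlia]; case: (odd r) hr => hr; lra.
    by rewrite !Vo; [apply: halt; nlia|nlia|nlia].
  + by move=> k hk; apply: le_trans (hb1 k hk) _; apply: gap_le; nlia.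
  + by move=> k hk; apply: le_trans (hb2 k hk) _; apply: gap_le; nlia.
- by move=> hd k hk /=; rewrite !hgap; [apply: hd; nlia|nlia|nlia].
- move=> eps delta rest e0; rewrite stack_step_count //.
  rewrite /stack_count [in RHS]entriesS cat_rcons Vs hBr (Vo 0%N) //.
  by rewrite (@eq_entries V B V' B) // => k hk; rewrite Vo //; nlia.
- move=> delta d0; case: r {hr hmono hgap hgapr gap_le hx Vs hb0 hb2 halt hBr} hb1 Vo => [|r] hb1 Vo.
    by rewrite !stack_credit1 add0r.
  rewrite (stack_creditS _ V' B) // (stack_creditS _ V B) // (@eq_stack_credit delta V' B V B r.+1) //; last first.
    by move=> k hk; rewrite Vo //; nlia.
  have := credit_le2 delta (gap V' r.+1) (B r.+1).
  have := @credit_ge0 _ delta (gap V r.+1) (B r.+1) (hb1 r.+1 _) d0; rewrite ltnS leqnn => /(_ isT).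
  by lra.
Qed.

(** The old top becomes the start of a piece born at level 0, whose credit, again at most [delta],
    is the payment of the new vertex. *)
Lemma stack_push L V B r x : stack_inv L V B r -> (x - V r) * (V r - V r.-1) < 0 ->
  let V' := update V r.+1 x in let B' := update B r.+1 0 in
  [/\ stack_inv L V' B' r.+1, decreasing V r -> decreasing V' r,
      forall eps delta rest, 0 <= eps ->
        stack_count eps delta V B r (x :: rest) = stack_count eps delta V' B' r.+1 rest &
      forall delta, 0 <= delta ->
        stack_credit delta V' B' r.+1 <= stack_credit delta V B r + delta].
Proof.
move=> [r0 hB0 hBr hV0 halt hb0 hb1 hb2] hx V' B'.
have hB k : (k <= r)%N -> B' k = B k by move=> kr; rewrite /B' update_other //; nlia.
have hV k : (k <= r)%N -> V' k = V k by move=> kr; rewrite /V' update_other //; nlia.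
have Vs : V' r.+1 = x by rewrite /V' update_same.
have Bs : B' r.+1 = 0 by rewrite /B' update_same.
clearbody V' B'.
have hgap k : (k < r)%N -> gap V' k = gap V k by move=> kr; rewrite /gap !hV //; nlia.
have hx2 : if odd r then x < V r else V r < x.
  have h1 : (r.-1 < r)%N by nlia.
  have := halt _ h1; rewrite prednK //.
  have -> : odd r.-1 = ~~ odd r by case: (r) r0 => //= n _; rewrite negbK.
  by case: (odd r) => /= h; nra.
split.
- split=> //.
  + by rewrite hB.
  + by rewrite !hV.
  + move=> k; rewrite ltnS leq_eqVlt => /orP[/eqP ->|kr].
      by rewrite Vs hV.
    by rewrite !hV //; [exact: halt|nlia].
  + move=> k /andP[k0]; rewrite ltnS leq_eqVlt => /orP[/eqP ->|kr]; first by rewrite hB // hBr.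
    by rewrite hB; [apply: hb0; rewrite k0|nlia].
  + move=> k /andP[k0]; rewrite ltnS leq_eqVlt => /orP[/eqP ->|kr].
      by rewrite hB // hBr mulr0 normr_ge0.
    by rewrite hB ?hgap; [apply: hb1; rewrite k0| |nlia].
  + move=> k /andP[k0]; rewrite ltnS leq_eqVlt => /orP[/eqP ->|kr].
      by rewrite hB // hBr mulr0 normr_ge0.
    by rewrite hB ?hgap; [apply: hb2; rewrite k0|nlia|nlia].
- by move=> hd k hk /=; rewrite !hgap; [exact: hd|nlia|nlia].
- move=> eps delta rest e0.
  rewrite /stack_count [in RHS]entriesS cat_rcons Vs Bs (hV 0%N) //.
  by rewrite (@eq_entries V' B' V B) // => k hk; rewrite hV ?hB.
- move=> delta d0; rewrite stack_creditS // (@eq_stack_credit delta V' B' V B) //; last first.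
    by move=> k hk; rewrite hB //; nlia.
  by rewrite lerD2l credit_le2.
Qed.

End Stack.

(** * Removing pieces from the stack *)

Section StackPop.
Context {R : realType}.
Implicit Types (V B : nat -> R) (r k : nat) (x L delta eps : R) (rest : seq R).

(* From level [dth] on, the middle one of three consecutive pieces is gone and the outer two have
   merged with it. *)
Lemma stack_pop L V B k : stack_inv L V B k.+3 -> decreasing V k.+2 ->
  gap V k.+1 <= gap V k.+2 ->
  let dth := gap V k.+1 / 2 in
  let V' := update V k.+1 (V k.+3) in
  let B' := update (update B k (Num.max (B k) dth)) k.+1 0 in
  let ev delta := emitted L delta (gap V k) (B k) dth ++
    emitted L delta (gap V k.+1) (B k.+1) dth ++ emitted L delta (gap V k.+2) (B k.+2) dth in
  [/\ stack_inv L V' B' k.+1, decreasing V' k,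
      forall eps delta rest, 0 <= eps < L ->
        (stack_count eps delta V B k.+3 rest)%:R <=
        (stack_count eps delta V' B' k.+1 rest)%:R + cov (ev delta) eps,
      forall delta, 0 <= delta ->
        area L (ev delta) + stack_credit delta V' B' k.+1 <= stack_credit delta V B k.+3 &
      forall delta e, e \in ev delta -> 0 <= e.1 < L].
Proof.
move=> [r0 hB0 hBr hV0 halt hb0 hb1 hb2] hdec hbc dth V' B' ev.
have hV i : (i <= k)%N -> V' i = V i by move=> kr; rewrite /V' update_other //; nlia.
have hB i : (i < k)%N -> B' i = B i by move=> kr; rewrite /B' !update_other //; nlia.
have hBk : B' k = Num.max (B k) dth by rewrite /B' update_other ?update_same //; nlia.
have hB1 : B' k.+1 = 0 by rewrite /B' update_same.
have hV1 : V' k.+1 = V k.+3 by rewrite /V' update_same.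
clearbody V' B'.
have hgap i : (i < k)%N -> gap V' i = gap V i by move=> kr; rewrite /gap !hV //; nlia.
have halt0 := halt k ltac:(nlia); have halt1 := halt k.+1 ltac:(nlia).
have halt2 := halt k.+2 ltac:(nlia).
rewrite /= in halt1; rewrite /= negbK in halt2.
have hb1b : B k.+1 <= dth by rewrite /dth; have := hb1 k.+1 ltac:(nlia); lra.
have hb2b : B k.+2 <= dth by rewrite /dth; have := hb2 k.+2 ltac:(nlia); rewrite /=; lra.
have hdec1 : (0 < k)%N -> gap V k.+1 < gap V k by move=> k0; apply: hdec; nlia.
have dthE : 2 * dth = gap V k.+1 by rewrite /dth; field.
have order : if odd k then V k.+1 < V k /\ V k.+1 < V k.+2 /\ V k.+3 <= V k.+1
             else V k < V k.+1 /\ V k.+2 < V k.+1 /\ V k.+1 <= V k.+3.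
  move: hbc halt0 halt1 halt2; rewrite /gap; case: (odd k) => /= h h0 h1 h2.
    by move: h; rewrite (distE_gt h1) (distE_lt h2); lra.
  by move: h; rewrite (distE_lt h1) (distE_gt h2); lra.
have gapk : gap V' k = gap V k - gap V k.+1 + gap V k.+2.
  rewrite /gap hV1 hV //; case: (odd k) order halt1 halt2 => [] [q1 [q2 q3]] /= h1 h2.
    rewrite (distE_lt q1) (distE_gt q2) (distE_lt h2) ler0_norm; lra.
  by rewrite (distE_gt q1) (distE_lt q2) (distE_gt h2) ger0_norm; lra.
have g0 i : 0 <= gap V i by rewrite /gap.
have ha : gap V 0 = V 1%N - V 0%N by have := halt 0%N ltac:(nlia); rewrite /gap => h; rewrite distE_gt.
split.
- split=> //.
  + case: (posnP k) => [k0|k0]; last by rewrite hB.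
    by rewrite -[X in B' X]k0 hBk le_max [X in B X]k0 hB0.
  + case: (posnP k) => [k0|k0]; last by rewrite !hV.
    rewrite -[X in V' X.+1]k0 hV1 hV //; move: order; rewrite k0 /=; lra.
  + move=> i; rewrite ltnS leq_eqVlt => /orP[/eqP ->|ik].
      by rewrite hV1 hV //; case: (odd k) order; lra.
    by rewrite !hV //; [apply: halt; nlia|nlia].
  + move=> i /andP[i0]; rewrite ltnS leq_eqVlt => /orP[/eqP ->|ik].
      by rewrite hBk le_max; apply/orP; right; rewrite /dth divr_ge0.
    by rewrite hB //; apply: hb0; nlia.
  + move=> i /andP[i0]; rewrite ltnS leq_eqVlt => /orP[/eqP E|ik].
      subst i; rewrite hBk gapk; have := hb1 k ltac:(nlia); have := hdec1 i0.
      by case: (leP (B k) dth) => h; lra.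
    by rewrite hB // hgap //; apply: hb1; nlia.
  + move=> i /andP[i0]; rewrite ltnS leq_eqVlt => /orP[/eqP E|ik].
      subst i; rewrite hBk hgap; last nlia.
      have := hb2 k ltac:(nlia); have := hdec1 ltac:(nlia); have := hdec k ltac:(nlia).
      by case: (leP (B k) dth) => h; lra.
    by rewrite hB // hgap; [apply: hb2|]; nlia.
- by move=> i hi; rewrite !hgap; [apply: hdec|nlia|]; nlia.
- move=> eps delta rest /andP[e0 eL]; rewrite /ev !cov_cat !cov_emitted //.
  rewrite /stack_count [in X in X%:R <= _]entriesS 3!entriesS [in X in _ <= X + _]entriesS.
  rewrite [entries V' B' 0 k.+1]entriesS !cat_rcons hV1 (hV k) // (hV 0%N) // hBr hB1 hBk.
  rewrite (@eq_entries R V' B' V B k); last by move=> i ik; rewrite hV ?hB //; nlia.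
  (* From [dth] on the middle piece is hidden and both counts agree. Below [dth] the merged piece is
     born too late to be counted, and the three old ones are accounted for by the events. *)
  have [hd|hd] := leP dth eps.
    have -> : short_pieces eps delta false (V 0%N) false (V 0%N) 0
       (entries V B 0 k ++ [:: (V k, Num.max (B k) dth), (V k.+3, 0) & timed rest]) =
       short_pieces eps delta false (V 0%N) false (V 0%N) 0
       (entries V B 0 k ++ [:: (V k, B k), (V k.+3, 0) & timed rest]).
      apply: cnt_births => //; first by rewrite /unzip1 !map_cat.
      by rewrite !map_cat /= ge_max hd andbT.
    have hle : `|V k.+2 - V k.+1| <= 2 * eps by rewrite -/(gap V k.+1) -dthE; lra.
    suff -> : short_pieces eps delta false (V 0%N) false (V 0%N) 0
       (entries V B 0 k ++ [:: (V k, B k), (V k.+1, B k.+1), (V k.+2, B k.+2), (V k.+3, 0) & timed rest]) =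
       short_pieces eps delta false (V 0%N) false (V 0%N) 0
       (entries V B 0 k ++ [:: (V k, B k), (V k.+3, 0) & timed rest]).
      by rewrite lerDl !addr_ge0.
    (* For [k = 0] the lowest of the three pieces is the sentinel, about which [decreasing] says
       nothing; it is a turn, which calls for the variant [cnt_skip_turn]. *)
    case: (posnP k) => [k0|k0].
      subst k; rewrite /= in halt0 order hle *.
      have hx : beyond false (V 0%N) (V 0%N) by rewrite /beyond.
      rewrite !(@cntE_extend _ _ _ _ _ _ _ _ (V 0%N) (B 0%N) _ hx).
      apply: cnt_skip_turn => //; rewrite -/(gap V 0) ha; lra.
    have [K [up' [s' [g' [e' [be' [h1 h2]]]]]]] :=
      cnt_context delta e0 (entries V B 0 k) (V k) (B k) false (V 0%N) false (V 0%N) 0.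
    rewrite !h2; congr (_ + _)%N; apply: (cnt_skip delta e0 _ _ _ _ _ _ _ h1 hle).
    have := hdec1 k0; rewrite /gap; case: (odd k) order => -[q1 [q2 q3]].
      by rewrite (distE_lt q1) (distE_gt q2); lra.
    by rewrite (distE_gt q1) (distE_lt q2); lra.
  (* The amplitudes above the sentinel decrease down to [gap V k.+1 = 2 * dth], the top one is no
     smaller by hypothesis, and the sentinel exceeds [2 * L]. *)
  have tall i : (i < k.+3)%N -> 2 * eps < gap V i.
    case: i => [|i] hi; first by rewrite ha; lra.
    have [ik|ik] := leqP i.+1 k; last first.
      have : i = k \/ i = k.+1 by nlia.
      by case=> ->; lra.
    by have := @decreasing_lt R V k.+2 i.+1 k.+1 hdec ltac:(nlia) (leqnn _); lra.
  have [||K [s' [g' h]]] := @cnt_tall R eps delta V B k e0; [by move=> i ik; apply: halt; nlia|by move=> i ik; apply: tall; nlia|].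
  rewrite !h {h}.
  have t0 := tall k ltac:(nlia); have t1 := tall k.+1 ltac:(nlia).
  have t2 := tall k.+2 ltac:(nlia); rewrite /gap in t0 t1 t2.
  rewrite !(@cntE_turn _ eps delta e0 _ _ _ _ _ (V k.+1)); last first.
    by case: (odd k) order t0 => -[q1 [q2 q3]]; rewrite ?(distE_lt q1) ?(distE_gt q1).
  rewrite (@cntE_turn _ eps delta e0 _ _ _ _ _ (V k.+2)); last first.
    by case: (odd k) order t1 => /= -[q1 [q2 q3]]; rewrite ?(distE_lt q2) ?(distE_gt q2).
  rewrite (@cntE_turn _ eps delta e0 _ _ _ (V k.+2)); last first.
    by rewrite negbK; case: (odd k) halt2 t2 => q; rewrite ?(distE_lt q) ?(distE_gt q).
  rewrite (@cntE_turn _ eps delta e0 _ _ _ (V k)); last first.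
    by case: (odd k) order t0 => -[q1 [q2 q3]]; rewrite ?(distE_lt q1) ?(distE_gt q1); lra.
  have -> : (Num.max (B k) dth <= eps) = false by rewrite ge_max; case: (B k <= eps) => //=; rewrite leNgt hd.
  rewrite !andbT -!natrD ler_nat negbK.
  have hdir : if ~~ odd k then V k.+2 <= V k.+3 else V k.+3 <= V k.+2.
    by case: (odd k) halt2 => /= /ltW.
  (* The piece still growing starts at [V k.+2] in the old stack and, uncounted, at [V k] in the new
     one; it is charged with its present amplitude. *)
  move: (@cnt_mono R eps delta e0 (~~ odd k) (V k.+2) (V k) (B k.+2 <= eps) (V k.+3) 0 (timed rest) hdir).
  rewrite /short -!/(gap V _).
  set n1 := short_pieces _ _ _ (V k.+2) _ _ _ _; set n2 := short_pieces _ _ _ (V k) _ _ _ _.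
  set n3 := nat_of_bool ((B k.+2 <= eps) && _); set n4 := nat_of_bool ((B k.+1 <= eps) && _).
  set n5 := nat_of_bool ((B k <= eps) && _); set n6 := nat_of_bool (g' && _).
  by move: n1 n2 n3 n4 n5 n6 => n1 n2 n3 n4 n5 n6; nlia.
- move=> delta d0; rewrite /ev !area_cat.
  have hB0' := area_emitted L delta (gap V k.+1) hb1b.
  have hC0' := area_emitted L delta (gap V k.+2) hb2b.
  have hcd := @credit_ge0 _ delta (gap V k.+2) dth ltac:(rewrite dthE; exact: hbc) d0.
  rewrite {2}/dth credit_half // subr0 in hB0'.
  rewrite (@stack_creditS R _ V B k.+2) // (@stack_creditS R _ V B k.+1) //.
  (* The sentinel is born at [B 0 >= L], so nothing is emitted for it. *)
  have [k0|k0] := posnP k.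
    subst k; rewrite (emitted_late _ _ _ hB0) !stack_credit1 /area big_nil; rewrite /area in hB0' hC0'; lra.
  rewrite (@stack_creditS R _ V B k) // (@stack_creditS R _ V' B' k) //.
  rewrite (@eq_stack_credit R delta V' B' V B k); [|by []|by move=> i hi; apply: hB; nlia].
  rewrite hBk gapk.
  have h1 := hb1 k ltac:(nlia); have h2 := hdec1 k0.
  (* If the lower piece is born after [dth] it emits nothing, and the merge is charged at [B k]
     instead of [dth]. *)
  have [hle|hlt] := leP (B k) dth.
    have := area_emitted L delta (gap V k) hle.
    have := @credit_merge _ delta (gap V k) (gap V k.+1) (gap V k.+2) dth d0 ltac:(rewrite dthE; lra) hbc.
    rewrite -/dth; lra.
  rewrite (emitted_nil _ _ _ (ltW hlt)) {1}/area big_nil.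
  have := @credit_merge _ delta (gap V k) (gap V k.+1) (gap V k.+2) (B k) d0 h1 hbc.
  rewrite -/dth; lra.
move=> delta e; rewrite /ev !mem_cat => /orP[|/orP[]].
- have [k0|k0] := posnP k; first by subst k; rewrite emitted_late.
  by apply: emitted_in; apply: hb0; nlia.
- by apply: emitted_in; apply: hb0; nlia.
- by apply: emitted_in; apply: hb0; nlia.
Qed.

(** At the end of the input the stack is dismantled from the top: the last piece exists up to half
    of its amplitude and is hidden by the hysteresis from then on. *)
Lemma stack_finish L V B r k : stack_inv L V B r -> decreasing V r -> (k.+2 <= r)%N ->
  let ev delta := emitted L delta (gap V k.+1) (B k.+1) (gap V k.+1 / 2) in
  [/\ forall eps delta, 0 <= eps < L ->
        (stack_count eps delta V B k.+2 [::])%:R <=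
        (stack_count eps delta V B k.+1 [::])%:R + cov (ev delta) eps,
      forall delta, 0 <= delta ->
        area L (ev delta) + stack_credit delta V B k.+1 <= stack_credit delta V B k.+2 &
      forall delta e, e \in ev delta -> 0 <= e.1 < L].
Proof.
move=> [r0 hB0 hBr hV0 halt hb0 hb1 hb2] hdec kr ev.
have dthE : 2 * (gap V k.+1 / 2) = gap V k.+1 by field.
have halt0 := halt k ltac:(nlia); have halt1 := halt k.+1 ltac:(nlia).
rewrite /= in halt1.
have ha : gap V 0 = V 1%N - V 0%N by have := halt 0%N ltac:(nlia); rewrite /gap => h; rewrite distE_gt.
have hb1k := hb1 k.+1 ltac:(nlia).
split.
- move=> eps delta /andP[e0 eL]; rewrite /ev cov_emitted //.
  rewrite /stack_count [in X in X%:R <= _]entriesS 2!entriesS.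
  rewrite [timed [::]]/= !cat_rcons.
  have [hd|hd] := leP (gap V k.+1 / 2) eps.
    rewrite !andbF addr0 ler_nat.
    have hle : `|V k.+2 - V k.+1| <= 2 * eps by rewrite -/(gap V k.+1); lra.
    suff -> : short_pieces eps delta false (V 0%N) false (V 0%N) 0
       (entries V B 0 k ++ [:: (V k, B k); (V k.+1, B k.+1); (V k.+2, B k.+2)]) =
       short_pieces eps delta false (V 0%N) false (V 0%N) 0
       (entries V B 0 k ++ [:: (V k, B k); (V k.+1, B k.+1)]) by [].
    have [k0|k0] := posnP k.
      subst k; rewrite /= in halt0 halt1 hle *.
      have hx : beyond false (V 0%N) (V 0%N) by rewrite /beyond.
      rewrite !(@cntE_extend _ _ _ _ _ _ _ _ (V 0%N) (B 0%N) _ hx).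
      apply: cnt_skip_turn_last => //; rewrite -/(gap V 0) ha; lra.
    have [K [up' [s' [g' [e' [be' [h1 h2]]]]]]] :=
      cnt_context delta e0 (entries V B 0 k) (V k) (B k) false (V 0%N) false (V 0%N) 0.
    rewrite !h2; congr (_ + _)%N; apply: (cnt_skip_last delta e0 _ _ _ _ _ _ h1 hle).
    have := hdec k.+1 ltac:(nlia); rewrite /gap /=; case: (odd k) halt0 halt1 => /= q1 q2.
      by rewrite (distE_lt q1) (distE_gt q2); lra.
    by rewrite (distE_gt q1) (distE_lt q2); lra.
  have tall i : (i < k.+2)%N -> 2 * eps < gap V i.
    case: i => [|i] hi; first by rewrite ha; lra.
    have [ik|ik] := leqP i.+1 k; last first.
      have -> : i = k by nlia.
      by lra.
    by have := @decreasing_lt R V r i.+1 k.+1 hdec ltac:(nlia) ltac:(nlia); lra.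
  have [||K [s' [g' h]]] := @cnt_tall R eps delta V B k.+1 e0; [by move=> i ik; apply: halt; nlia|by move=> i ik; apply: tall; nlia|].
  have h' b' l : short_pieces eps delta false (V 0%N) false (V 0%N) 0
      (entries V B 0 k ++ [:: (V k, B k), (V k.+1, b') & l]) =
      (K + short_pieces eps delta (odd k.+1) s' g' (V k.+1) b' l)%N.
    by rewrite -h entriesS cat_rcons.
  rewrite !h'.
  have t1 := tall k.+1 ltac:(nlia); rewrite /gap in t1.
  rewrite (@cntE_turn _ eps delta e0); last first.
    by move: halt1; rewrite /=; case: (odd k) t1 => /= t1 q; move: t1; rewrite ?(distE_lt q) ?(distE_gt q).
  by rewrite andbT -natrD ler_nat !cnt_nil addnA.
- move=> delta d0; rewrite /ev (stack_creditS delta V B (ltn0Sn k)).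
  have := @area_emitted _ L delta (gap V k.+1) (B k.+1) (gap V k.+1 / 2) ltac:(lra).
  by rewrite credit_half //; lra.
by move=> delta e; apply: emitted_in; apply: hb0; nlia.
Qed.

End StackPop.

(** * Running programs *)

Section Programs.
Context {R : realType}.
Implicit Types (c : cmd) (b : test) (s : state R) (Q : state R -> nat -> Prop).

Definition runs c s Q := exists s' t, exec c s s' t /\ Q s' t.

Lemma runs_mono c s Q Q' : runs c s Q -> (forall s' t, Q s' t -> Q' s' t) -> runs c s Q'.
Proof. by move=> [s' [t [h1 h2]]] h; exists s', t; split=> //; exact: h. Qed.

Lemma runs_seq c1 c2 s Q :
  runs c1 s (fun s1 t1 => runs c2 s1 (fun s2 t2 => Q s2 (t1 + t2)%N)) -> runs (Seq c1 c2) s Q.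
Proof.
move=> [s1 [t1 [h1 [s2 [t2 [h2 h3]]]]]].
by exists s2, (t1 + t2)%N; split=> //; exact: ExecSeq h1 h2.
Qed.

(** [pot] bounds the time still to be spent in the loop. As every iteration takes time, it also
    proves termination. *)
Lemma runs_while b c s (I : state R -> Prop) (pot : state R -> nat) Q :
  I s ->
  (forall s, I s -> teval s b ->
     runs c s (fun s' t => I s' /\ (t + (tcost b).+1 + pot s' <= pot s)%N)) ->
  (forall s' t, I s' -> ~~ teval s' b -> (t + pot s' <= pot s + (tcost b).+1)%N -> Q s' t) ->
  runs (While b c) s Q.
Proof.
move=> Is hbody hQ.
suff [s' [t [h1 h2 h3 h4]]] : exists s' t, [/\ exec (While b c) s s' t, I s', ~~ teval s' b &
    (t + pot s' <= pot s + (tcost b).+1)%N] by exists s', t; split=> //; exact: hQ.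
have [n hn] : exists n, (pot s <= n)%N by exists (pot s).
elim: n s Is hn {hQ} => [|n IH] s Is hn.
  have [hb|hb] := boolP (teval s b); last first.
    by exists s, (tcost b).+1; split=> //; [exact: ExecWhileFalse|rewrite addnC].
  have [s' [t [_ [_ h]]]] := hbody s Is hb; exfalso.
  by have := leq_trans h hn; rewrite addnS addSn ltn0.
have [hb|hb] := boolP (teval s b); last first.
  by exists s, (tcost b).+1; split=> //; [exact: ExecWhileFalse|rewrite addnC].
have [s1 [t1 [h1 [h2 h3]]]] := hbody s Is hb.
have [|s' [t [h4 h5 h6 h7]]] := IH s1 h2; first by move: h3 hn; clear; move: (pot s1) (pot s) (tcost b) => *; lia.
exists s', (tcost b + t1 + t).+1; split=> //; last by move: h3 h7; clear; move: (pot s') (pot s1) (pot s) (tcost b) => *; lia.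
exact: ExecWhileTrue h1 h4.
Qed.

Fixpoint straight c : bool :=
  match c with
  | Seq c1 c2 | If _ c1 c2 => straight c1 && straight c2
  | While _ _ => false
  | _ => true
  end.

Fixpoint outcome c s : state R :=
  match c with
  | NSetVar x e => set_nvar s x (neval s e)
  | RSetVar x e => set_rvar s x (reval s e)
  | NSetArr a i e => set_narr s a (neval s i) (neval s e)
  | RSetArr a i e => set_rarr s a (neval s i) (reval s e)
  | Seq c1 c2 => outcome c2 (outcome c1 s)
  | If b c1 c2 => if teval s b then outcome c1 s else outcome c2 s
  | _ => s
  end.

Fixpoint cost c : nat :=
  match c with
  | NSetVar _ e => (ncost e).+1
  | RSetVar _ e => (rcost e).+1
  | NSetArr _ i e => (ncost i + ncost e).+1
  | RSetArr _ i e => (ncost i + rcost e).+1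
  | Seq c1 c2 => (cost c1 + cost c2)%N
  | If b c1 c2 => (tcost b + (cost c1 + cost c2)).+1
  | _ => 1%N
  end.

Lemma outcome_seq c1 c2 s : outcome (Seq c1 c2) s = outcome c2 (outcome c1 s).
Proof. by []. Qed.

Lemma exec_straight c s : straight c -> exists t, exec c s (outcome c s) t /\ (t <= cost c)%N.
Proof.
elim: c s => [|x e|x e|a i e|a i e|c1 IH1 c2 IH2|b c1 IH1 c2 IH2|b c IH] s //=.
- by exists 1%N; split=> //; exact: ExecSkip.
- by eexists; split; [exact: ExecNSetVar|].
- by eexists; split; [exact: ExecRSetVar|].
- by eexists; split; [exact: ExecNSetArr|].
- by eexists; split; [exact: ExecRSetArr|].
- move=> /andP[/IH1 h1 /IH2 h2]; have [t1 [h3 h4]] := h1 s; have [t2 [h5 h6]] := h2 (outcome c1 s).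
  by exists (t1 + t2)%N; split; [exact: ExecSeq h3 h5|lia].
move=> /andP[/IH1 h1 /IH2 h2]; have [hb|hb] := boolP (teval s b).
  have [t [h3 h4]] := h1 s; exists (tcost b + t).+1; split; last by lia.
  exact: ExecIfTrue.
have [t [h3 h4]] := h2 s; exists (tcost b + t).+1; split; last by lia.
exact: ExecIfFalse.
Qed.

Lemma runs_straight c s Q : straight c ->
  (forall t, (t <= cost c)%N -> Q (outcome c s) t) -> runs c s Q.
Proof.
move=> hc hQ; have [t [h1 h2]] := exec_straight s hc.
by exists (outcome c s), t; split=> //; exact: hQ.
Qed.

Fixpoint mod_nvar c : seq nat :=
  match c with
  | NSetVar x _ => [:: x]
  | Seq c1 c2 | If _ c1 c2 => mod_nvar c1 ++ mod_nvar c2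
  | While _ c => mod_nvar c
  | _ => [::]
  end.

Fixpoint mod_rvar c : seq nat :=
  match c with
  | RSetVar x _ => [:: x]
  | Seq c1 c2 | If _ c1 c2 => mod_rvar c1 ++ mod_rvar c2
  | While _ c => mod_rvar c
  | _ => [::]
  end.

Fixpoint mod_rarr c : seq nat :=
  match c with
  | RSetArr a _ _ => [:: a]
  | Seq c1 c2 | If _ c1 c2 => mod_rarr c1 ++ mod_rarr c2
  | While _ c => mod_rarr c
  | _ => [::]
  end.

(** A syntactic frame property, which lets specifications mention only what changes. *)
Definition agree c s s' :=
  [/\ forall x, x \notin mod_nvar c -> nvar s' x = nvar s x,
      forall x, x \notin mod_rvar c -> rvar s' x = rvar s x &
      forall a, a \notin mod_rarr c -> rarr s' a = rarr s a].

Lemma exec_agree c s s' t : exec c s s' t -> agree c s s'.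
Proof.
elim=> {c s s' t} /=; rewrite /agree /=.
- by [].
- by move=> s x e; split=> // y; rewrite inE => /negbTE h /=; rewrite /update h.
- by move=> s x e; split=> // y; rewrite inE => /negbTE h /=; rewrite /update h.
- by [].
- by move=> s a i e; split=> // y; rewrite inE => /negbTE h /=; rewrite /update h.
- move=> c1 c2 s s1 s2 t1 t2 _ [h1 h2 h3] _ [h4 h5 h6].
  by split=> x; rewrite mem_cat negb_or => /andP[hx hy];
    [rewrite h4 ?h1|rewrite h5 ?h2|rewrite h6 ?h3].
- move=> b c1 c2 s s' t _ _ [h1 h2 h3].
  by split=> x; rewrite mem_cat negb_or => /andP[hx hy]; [rewrite h1|rewrite h2|rewrite h3].
- move=> b c1 c2 s s' t _ _ [h1 h2 h3].
  by split=> x; rewrite mem_cat negb_or => /andP[hx hy]; [rewrite h1|rewrite h2|rewrite h3].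
- move=> b c s s1 s2 t1 t2 _ _ [h1 h2 h3] _ [h4 h5 h6].
  by split=> x hx; [rewrite h4 ?h1|rewrite h5 ?h2|rewrite h6 ?h3].
- by [].
Qed.

Lemma runs_agree c s Q : runs c s Q -> runs c s (fun s' t => agree c s s' /\ Q s' t).
Proof. by move=> [s' [t [h1 h2]]]; exists s', t; split=> //; split=> //; exact: exec_agree h1. Qed.

Lemma outcome_agree c s : straight c -> agree c s (outcome c s).
Proof. by move=> /(exec_straight s)[t [h _]]; exact: exec_agree h. Qed.

Lemma agreeN c s s' x : agree c s s' -> x \notin mod_nvar c -> nvar s' x = nvar s x.
Proof. by case=> h _ _; exact: h. Qed.

Lemma agreeR c s s' x : agree c s s' -> x \notin mod_rvar c -> rvar s' x = rvar s x.
Proof. by case=> _ h _; exact: h. Qed.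

Lemma agreeA c s s' a : agree c s s' -> a \notin mod_rarr c -> rarr s' a = rarr s a.
Proof. by case=> _ _ h; exact: h. Qed.

Lemma state_eq s s' : nvar s = nvar s' -> rvar s = rvar s' -> narr s = narr s' ->
  rarr s = rarr s' -> s = s'.
Proof. by case: s s' => [? ? ? ?] [? ? ? ?] /= -> -> -> ->. Qed.

End Programs.

Notation "c1 ;; c2" := (Seq c1 c2) (at level 90, right associativity).

(** * The program for the stack *)

Section Pass.
Context {R : realType}.
Variable D : nat.
Implicit Types (s : state R).

(* Real arrays from [D] on: times and weights of the events, the pivot's workspace, values and
   births of the stack, the chosen levels, and breaks, play values and buffer of a stage.
   Variables: [nvar 2] is the top of the stack, [nvar 3] the number of events, [rvar 1] is delta,
   [rvar 2] is [L], and [rvar 3] accumulates the number of vertices as a real. *)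
Definition evs s : seq (R * R) :=
  [seq (rarr s D i, rarr s D.+1 i) | i <- iota 0 (nvar s 3)].

Definition c_push (w : rexp) (x : rexp) : cmd :=
  RSetArr D (NVar 3) x ;; RSetArr D.+1 (NVar 3) w ;; NSetVar 3 (NAdd (NVar 3) (NLit 1)).

Lemma evs_push s x w : 
  evs (outcome (c_push (RLit w) (RVar x)) s) = rcons (evs s) (rvar s x, w%:~R).
Proof.
rewrite /evs.
have -> : nvar (outcome (c_push (RLit w) (RVar x)) s) 3 = (nvar s 3 + 1)%N by [].
rewrite iotaD map_cat cats1 /= add0n /update eqxx.
have -> : (D == D.+1) = false by lia.
have -> : (D.+1 == D) = false by lia.
rewrite /= !eqxx; congr rcons.
apply/eq_in_map => i; rewrite mem_iota => hi; have -> : (i == nvar s 3) = false by lia.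
by [].
Qed.

Definition c_emit : cmd :=
  RSetVar 23 (RSub (RDiv (RVar 20) (RLit 2)) (RVar 1)) ;;
  If (RLe (RVar 23) (RVar 21)) (RSetVar 23 (RVar 21)) Skip ;;
  If (RLe (RVar 22) (RVar 23)) Skip
    (If (RLe (RVar 2) (RVar 23)) Skip
       (c_push (RLit 1) (RVar 23) ;;
        If (RLe (RVar 2) (RVar 22)) Skip (c_push (RLit (-1)) (RVar 22)))).

Lemma update_update (T : Type) (f : nat -> T) k u v : update (update f k u) k v = update f k v.
Proof. by apply/funext => i; rewrite /update; case: (i == k). Qed.

Lemma evs_emit s :
  evs (outcome c_emit s) = evs s ++ emitted (rvar s 2) (rvar s 1) (rvar s 20) (rvar s 21) (rvar s 22).
Proof.
rewrite /emitted /c_emit; cbv zeta.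
set lo : R := if _ <= rvar s 21 then _ else _.
have h : outcome (RSetVar 23 (RSub (RDiv (RVar 20) (RLit 2)) (RVar 1)) ;;
    If (RLe (RVar 23) (RVar 21)) (RSetVar 23 (RVar 21)) Skip) s = set_rvar s 23 lo.
  rewrite /= [X in X <= _]/update [X in _ <= X]/update /= /lo; case: ifP => // _.
  by rewrite /set_rvar /= update_update.
set c := If (RLe (RVar 22) _) _ _.
change (outcome (?c1 ;; ?c2 ;; c) s) with (outcome c (outcome (c1 ;; c2) s)).
rewrite h /c {h c}.
have -> : evs s = evs (set_rvar s 23 lo) by [].
set s1 := set_rvar s 23 lo.
have -> : lo = rvar s1 23 by [].
have -> : rvar s 22 = rvar s1 22 by [].
have -> : rvar s 2 = rvar s1 2 by [].
clearbody s1; clear lo.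
change (outcome (If ?b ?c ?c') s1) with (if teval s1 b then outcome c s1 else outcome c' s1).
rewrite [teval _ _]/=; case: ifP => // _; first by rewrite cats0.
change (outcome (If ?b ?c ?c') s1) with (if teval s1 b then outcome c s1 else outcome c' s1).
rewrite [teval _ _]/=; case: ifP => // _; first by rewrite cats0.
set s2 := outcome (c_push (RLit 1) (RVar 23)) s1.
have h2 : evs s2 = rcons (evs s1) (rvar s1 23, 1) by exact: evs_push.
change (outcome (?c1 ;; If ?b ?c ?c') s1) with (if teval s2 b then outcome c s2 else outcome c' s2).
rewrite [teval _ _]/= /update; case: ifP => _.
  by rewrite h2 cats1.
have -> : evs (outcome (c_push (RLit (-1)) (RVar 22)) s2) = rcons (evs s2) (rvar s2 22, -1) by exact: evs_push.
by rewrite h2 -cats1 -cats1 -catA.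
Qed.

Definition c_gap (x : nat) (k : nexp) : cmd :=
  RSetVar x (RSub (RGet (D + 3) (NAdd k (NLit 1))) (RGet (D + 3) k)) ;;
  If (RLe (RLit 0) (RVar x)) Skip (RSetVar x (RSub (RLit 0) (RVar x))).

Lemma outcome_gap s x k :
  outcome (c_gap x k) s = set_rvar s x (gap (rarr s (D + 3)) (neval s k)).
Proof.
rewrite /c_gap /= /update eqxx /gap addn1; set v := _ - _; case: ifP => h.
  by rewrite ger0_norm.
rewrite /set_rvar /= update_update sub0r ler0_norm //.
by move: h => /negbT; rewrite -ltNge => /ltW.
Qed.

Definition c_pop_gaps : cmd :=
  c_gap 6 (NSub (NVar 2) (NLit 3)) ;; c_gap 7 (NSub (NVar 2) (NLit 2)) ;;
  c_gap 8 (NSub (NVar 2) (NLit 1)) ;; RSetVar 22 (RDiv (RVar 7) (RLit 2)).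

Definition c_emit_piece (x k : nat) : cmd :=
  (RSetVar 20 (RVar x) ;; RSetVar 21 (RGet (D + 4) (NSub (NVar 2) (NLit k)))) ;; c_emit.

Definition c_merge : cmd :=
  (RSetVar 21 (RGet (D + 4) (NSub (NVar 2) (NLit 3))) ;;
   If (RLe (RVar 22) (RVar 21)) Skip (RSetVar 21 (RVar 22))) ;;
  RSetArr (D + 4) (NSub (NVar 2) (NLit 3)) (RVar 21) ;;
  RSetArr (D + 3) (NSub (NVar 2) (NLit 2)) (RGet (D + 3) (NVar 2)) ;;
  RSetArr (D + 4) (NSub (NVar 2) (NLit 2)) (RLit 0) ;;
  NSetVar 2 (NSub (NVar 2) (NLit 2)).

Definition c_pop : cmd :=
  c_pop_gaps ;; c_emit_piece 6 3 ;; c_emit_piece 7 2 ;; c_emit_piece 8 1 ;; c_merge.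

Lemma emit_piece s x k s' : x \notin [:: 20; 21; 22; 23]%N -> s' = outcome (c_emit_piece x k) s ->
  [/\ evs s' = evs s ++ emitted (rvar s 2) (rvar s 1) (rvar s x) (rarr s (D + 4) (nvar s 2 - k)%N) (rvar s 22),
      nvar s' 2 = nvar s 2, forall y, y \notin [:: 20; 21; 23]%N -> rvar s' y = rvar s y &
      forall a, a != D -> a != D.+1 -> rarr s' a = rarr s a].
Proof.
move=> hx ->; have ha := outcome_agree (c := c_emit_piece x k) s erefl.
split.
- rewrite /c_emit_piece; set c1 := RSetVar 20 _ ;; _.
  by rewrite -[outcome _ s]/(outcome c_emit (outcome c1 s)) evs_emit.
- by rewrite (agreeN ha).
- move=> y hy; rewrite (agreeR ha) //; move: hy; rewrite !inE => /norP[/negbTE -> /norP[/negbTE -> /negbTE ->]]; done.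
- by move=> a h1 h2; rewrite (agreeA ha) //= !inE; lia.
Qed.

Lemma outcome_merge s k : nvar s 2 = k.+3 ->
  let s' := outcome c_merge s in
  [/\ evs s' = evs s, nvar s' 2 = k.+1,
      rarr s' (D + 3) = update (rarr s (D + 3)) k.+1 (rarr s (D + 3) k.+3) &
      rarr s' (D + 4) = update (update (rarr s (D + 4)) k (Num.max (rarr s (D + 4) k) (rvar s 22))) k.+1 0].
Proof.
move=> hr s'.
have h : outcome (RSetVar 21 (RGet (D + 4) (NSub (NVar 2) (NLit 3))) ;;
   If (RLe (RVar 22) (RVar 21)) Skip (RSetVar 21 (RVar 22))) s =
   set_rvar s 21 (Num.max (rarr s (D + 4) k) (rvar s 22)).
  rewrite /= [X in X <= _]/update [X in _ <= X]/update /= hr !subSS subn0; case: leP => // _.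
  by rewrite /set_rvar /= update_update.
have {s' h} -> : s' = outcome (RSetArr (D + 4) (NSub (NVar 2) (NLit 3)) (RVar 21) ;;
  RSetArr (D + 3) (NSub (NVar 2) (NLit 2)) (RGet (D + 3) (NVar 2)) ;;
  RSetArr (D + 4) (NSub (NVar 2) (NLit 2)) (RLit 0) ;;
  NSetVar 2 (NSub (NVar 2) (NLit 2))) (set_rvar s 21 (Num.max (rarr s (D + 4) k) (rvar s 22))).
  by rewrite -h.
have e1 : (D + 3 == D + 4)%N = false by lia.
have e2 : (D + 4 == D + 3)%N = false by lia.
have e3 : (D == D + 3)%N = false by lia.
have e4 : (D == D + 4)%N = false by lia.
have e5 : (D.+1 == D + 3)%N = false by lia.
have e6 : (D.+1 == D + 4)%N = false by lia.
rewrite /= hr !subSS !subn0; set m := Num.max _ _; split.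
- by rewrite /evs /= /update e3 e4 e5 e6.
- by [].
- by rewrite update_other ?e1 // update_same update_other ?e1 // update_other ?e1.
- by rewrite update_same update_other ?e2 // update_same.
Qed.

Lemma outcome_pop s k : nvar s 2 = k.+3 ->
  let s' := outcome c_pop s in let V := rarr s (D + 3) in let B := rarr s (D + 4) in
  let dth := gap V k.+1 / 2 in
  [/\ evs s' = evs s ++ emitted (rvar s 2) (rvar s 1) (gap V k) (B k) dth ++
        emitted (rvar s 2) (rvar s 1) (gap V k.+1) (B k.+1) dth ++
        emitted (rvar s 2) (rvar s 1) (gap V k.+2) (B k.+2) dth,
      nvar s' 2 = k.+1, rarr s' (D + 3) = update V k.+1 (V k.+3) &
      rarr s' (D + 4) = update (update B k (Num.max (B k) dth)) k.+1 0].
Proof.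
move=> hr s' V B dth; have := erefl s'; rewrite {2}/s' /c_pop; do 4 rewrite outcome_seq.
clearbody s'.
have [s1 hs1] : exists s1, s1 = outcome c_pop_gaps s by eexists.
rewrite -hs1 => hs'.
have {hs1} [h1 h2 h3 h4 [h5 h6 h7 h8]] : [/\ nvar s1 = nvar s, rarr s1 = rarr s, evs s1 = evs s,
   rvar s1 22 = dth & [/\ rvar s1 6 = gap V k, rvar s1 7 = gap V k.+1, rvar s1 8 = gap V k.+2 &
   forall y, (y <= 5)%N -> rvar s1 y = rvar s y]].
  rewrite hs1 /c_pop_gaps; change (outcome (c_gap ?x ?k ;; ?c) ?s) with (outcome c (outcome (c_gap x k) s)).
  rewrite outcome_gap.
  change (outcome (c_gap ?x ?k ;; ?c) ?s) with (outcome c (outcome (c_gap x k) s)).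
  rewrite outcome_gap.
  change (outcome (c_gap ?x ?k ;; ?c) ?s) with (outcome c (outcome (c_gap x k) s)).
  rewrite outcome_gap /= hr !subSS !subn0.
  by split=> //; split=> // y hy; rewrite /update /=; do 4 (case: eqP => [?|_]; first by lia).
have [s2 hs2] : exists s2, s2 = outcome (c_emit_piece 6 3) s1 by eexists.
have [s3 hs3] : exists s3, s3 = outcome (c_emit_piece 7 2) s2 by eexists.
have [s4 hs4] : exists s4, s4 = outcome (c_emit_piece 8 1) s3 by eexists.
rewrite -hs2 -hs3 -hs4 in hs'; rewrite hs'.
have [g1 g2 g3 g4] := emit_piece (x := 6) erefl hs2.
have [g5 g6 g7 g8] := emit_piece (x := 7) erefl hs3.
have [g9 g10 g11 g12] := emit_piece (x := 8) erefl hs4.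
have hr4 : nvar s4 2 = k.+3 by rewrite g10 g6 g2 h1.
have n1 : (D + 3 != D)%N by lia.
have n2 : (D + 4 != D)%N by lia.
have n3 : (D + 3 != D.+1)%N by lia.
have n4 : (D + 4 != D.+1)%N by lia.
have [-> -> -> ->] := outcome_merge hr4.
rewrite g12 // g8 // g4 // g12 // g8 // g4 // h2 g11 // g7 // g3 // h4.
split=> //.
rewrite g9 g5 g1 h3 -!catA g6 g2 h1 hr !subSS subn0 g8 // g4 // h2.
rewrite g7 // g3 // !(g7 _, g3 _) // h4 h5 h6 h7 !h8 //.
Qed.

End Pass.

(** * The invariant of a pass *)

Section Tracks.
Context {R : realType}.
Implicit Types (V B : nat -> R) (ev : seq (R * R)).

(** The count [c0] is bounded by what has been emitted plus what the automaton would still find on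
    the stack and in the rest of the input; the emitted area and the outstanding credit share the
    budget [A]. Upper bounds suffice for finding a level with few short pieces. *)
Record tracks (L delta : R) (c0 : R -> R) A V B r rest ev : Prop := Tracks {
  tracks_count : forall eps, 0 <= eps < L ->
    c0 eps <= cov ev eps + (stack_count eps delta V B r rest)%:R;
  tracks_area : area L ev + stack_credit delta V B r <= A;
  tracks_range : forall e, e \in ev -> 0 <= e.1 < L }.

Lemma tracks_continue L delta c0 A V B r x rest ev : 0 <= delta -> stack_inv L V B r ->
  0 <= (x - V r) * (V r - V r.-1) -> tracks L delta c0 A V B r (x :: rest) ev ->
  tracks L delta c0 (A + delta) (update V r x) B r rest ev.
Proof.
move=> d0 hi hx [h1 h2 h3]; have [_ _ hc ha] := stack_continue hi hx; split=> //.
  by move=> eps he; have := h1 eps he; rewrite hc //; case/andP: he.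
by have := ha delta d0; move: h2; lra.
Qed.

Lemma tracks_push L delta c0 A V B r x rest ev : 0 <= delta -> stack_inv L V B r ->
  (x - V r) * (V r - V r.-1) < 0 -> tracks L delta c0 A V B r (x :: rest) ev ->
  tracks L delta c0 (A + delta) (update V r.+1 x) (update B r.+1 0) r.+1 rest ev.
Proof.
move=> d0 hi hx [h1 h2 h3]; have [_ _ hc ha] := stack_push hi hx; split=> //.
  by move=> eps he; have := h1 eps he; rewrite hc //; case/andP: he.
by have := ha delta d0; move: h2; lra.
Qed.

Lemma tracks_emit L delta c0 A V B r V' B' r' rest ev ev' :
  (forall eps, 0 <= eps < L -> (stack_count eps delta V B r rest)%:R <=
     (stack_count eps delta V' B' r' rest)%:R + cov ev' eps) ->
  area L ev' + stack_credit delta V' B' r' <= stack_credit delta V B r ->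
  (forall e, e \in ev' -> 0 <= e.1 < L) ->
  tracks L delta c0 A V B r rest ev -> tracks L delta c0 A V' B' r' rest (ev ++ ev').
Proof.
move=> g1 g2 g3 [h1 h2 h3]; split.
- by move=> eps he; rewrite cov_cat; move: (h1 _ he) (g1 _ he); lra.
- by rewrite area_cat; move: h2 g2; lra.
- by move=> e; rewrite mem_cat => /orP[/h3|/g3].
Qed.

Lemma stack_count1 L eps delta V B rest : stack_inv L V B 1 -> 0 <= eps < L ->
  stack_count eps delta V B 1 rest = short_pieces eps delta true (V 0%N) false (V 1%N) 0 (timed rest).
Proof.
move=> [_ hB0 hB1 hV _ _ _ _] /andP[e0 e1]; rewrite /stack_count /entries /= hB1.
rewrite cntE_extend ?/beyond // cntE_turn //; last by lra.
by rewrite andFb /=; have -> : (B 0%N <= eps) = false by apply/negbTE; rewrite -ltNge; lra.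
Qed.

End Tracks.

Section Pass.
Context {R : realType}.
Variable D : nat.
Implicit Types (s : state R).
Local Notation evs := (evs D).
Local Notation c_gap := (c_gap D).

(** A loop tests a single comparison, so the compound condition for a pop is computed beforehand
    into [nvar 6]. *)
Definition c_test : cmd :=
  NSetVar 6 (NLit 0) ;;
  If (NLe (NLit 3) (NVar 2))
    (c_gap 7 (NSub (NVar 2) (NLit 2)) ;; c_gap 8 (NSub (NVar 2) (NLit 1)) ;;
     If (RLe (RVar 7) (RVar 8)) (NSetVar 6 (NLit 1)) Skip) Skip.

Lemma outcome_test s : let s' := outcome c_test s in let V := rarr s (D + 3) in
  [/\ (1 <= nvar s' 6)%N = (3 <= nvar s 2)%N && (gap V (nvar s 2 - 2)%N <= gap V (nvar s 2 - 1)%N),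
   rarr s' = rarr s, forall x, x != 6%N -> nvar s' x = nvar s x &
   forall x, (x <= 5)%N -> rvar s' x = rvar s x].
Proof.
move=> s' V; have := erefl s'; rewrite {2}/s' /c_test outcome_seq.
clearbody s'.
change (outcome (If ?b ?c ?c') ?s1) with (if teval s1 b then outcome c s1 else outcome c' s1).
rewrite [teval _ _]/= {1}/update [nvar _ 2]/=; case: ifP => [h|_] ->; last first.
  by split=> // x /negbTE hx /=; rewrite /update hx.
do 2 (rewrite outcome_seq outcome_gap).
rewrite [neval _ _]/= [neval _ _]/=.
set g7 := gap _ _; set g8 := gap _ _.
have -> : g7 = gap V (nvar s 2 - 2) by [].
have -> : g8 = gap V (nvar s 2 - 1) by [].
have e7 (f : nat -> R) (u v : R) : update (update f 7 u) 8 v 7 = u by [].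
have e8 (f : nat -> R) (u v : R) : update (update f 7 u) 8 v 8 = v by [].
rewrite /= !e7 !e8; case: ifP => hg; split=> //= x hx;
  by rewrite /update //=; do ?(case: eqP => [hh|_]; first by move: hx; rewrite hh).
Qed.

(** The sign of a product decides whether the new vertex continues the top piece; a repeated vertex
    counts as continuing. *)
Definition c_step (a : nat) : cmd :=
  RSetVar 4 (RGet a (NVar 4)) ;;
  If (RLe (RLit 0) (RMul (RSub (RVar 4) (RGet (D + 3) (NVar 2)))
       (RSub (RGet (D + 3) (NVar 2)) (RGet (D + 3) (NSub (NVar 2) (NLit 1))))))
    (RSetArr (D + 3) (NVar 2) (RVar 4))
    (NSetVar 2 (NAdd (NVar 2) (NLit 1)) ;; RSetArr (D + 3) (NVar 2) (RVar 4) ;;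
     RSetArr (D + 4) (NVar 2) (RLit 0)) ;;
  RSetVar 3 (RAdd (RVar 3) (RLit 1)) ;; NSetVar 4 (NAdd (NVar 4) (NLit 1)).

Lemma outcome_step a s : (a < D)%N -> let s' := outcome (c_step a) s in
  let V := rarr s (D + 3) in let B := rarr s (D + 4) in let r := nvar s 2 in
  let x := rarr s a (nvar s 4) in
  let go := 0 <= (x - V r) * (V r - V r.-1) in
  [/\ nvar s' 2 = (if go then r else r.+1),
   rarr s' (D + 3) = (if go then update V r x else update V r.+1 x),
   rarr s' (D + 4) = (if go then B else update B r.+1 0) &
   [/\ evs s' = evs s, nvar s' 4 = (nvar s 4).+1 & rvar s' 3 = rvar s 3 + 1]].
Proof.
move=> aD s' V B r x go.
have e1 : (D + 3 == D + 4)%N = false by lia.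
have e2 : (D + 4 == D + 3)%N = false by lia.
have e3 : (D == D + 3)%N = false by lia.
have e4 : (D == D + 4)%N = false by lia.
have e5 : (D.+1 == D + 3)%N = false by lia.
have e6 : (D.+1 == D + 4)%N = false by lia.
have u4 (f : nat -> R) (u : R) : update f 4 u 4 = u by [].
rewrite /s' /= {s'} !u4 subn1 -/x -/r -/V -/go.
have u2 (f : nat -> nat) (u : nat) : update f 2 u 2 = u by [].
case: ifP => _; split; rewrite /= ?u2 ?addn1 //.
- by rewrite /update eqxx.
- by rewrite /update e2.
- by rewrite /evs /= /update e3 e5.
- by rewrite update_other ?e1 // update_same.
- by rewrite update_same update_other ?e2 //.
- by rewrite /evs /= /update e3 e4 e5 e6.
Qed.

End Pass.

Section Pass.
Context {R : realType}.
Variable D : nat.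
Implicit Types (s : state R).
Local Notation evs := (evs D).

Lemma eq_evs s s' : nvar s' 3 = nvar s 3 -> rarr s' = rarr s -> evs s' = evs s.
Proof. by rewrite /evs => -> ->. Qed.

Definition c_pops : cmd :=
  c_test D ;; While (NLe (NLit 1) (NVar 6)) (c_pop D ;; c_test D).

(** A pop emits at most six events and removes two entries, so the number of events plus three times
    the height does not grow; the time is amortized against the height in the same way. *)
Lemma runs_pops L delta c0 A rest s Q : 0 <= delta ->
  rvar s 1 = delta -> rvar s 2 = L ->
  stack_inv L (rarr s (D + 3)) (rarr s (D + 4)) (nvar s 2) ->
  decreasing (rarr s (D + 3)) (nvar s 2).-1 ->
  tracks L delta c0 A (rarr s (D + 3)) (rarr s (D + 4)) (nvar s 2) rest (evs s) ->
  (forall s' t, agree c_pops s s' ->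
     stack_inv L (rarr s' (D + 3)) (rarr s' (D + 4)) (nvar s' 2) ->
     decreasing (rarr s' (D + 3)) (nvar s' 2) ->
     tracks L delta c0 A (rarr s' (D + 3)) (rarr s' (D + 4)) (nvar s' 2) rest (evs s') ->
     (nvar s' 3 + 3 * nvar s' 2 <= nvar s 3 + 3 * nvar s 2)%N ->
     (t + 300 * nvar s' 2 <= 300 * nvar s 2 + 100)%N -> Q s' t) ->
  runs c_pops s Q.
Proof.
move=> d0 hdelta hL hinv hdec htr hQ.
suff : runs c_pops s (fun s' t =>
     [/\ stack_inv L (rarr s' (D + 3)) (rarr s' (D + 4)) (nvar s' 2),
     decreasing (rarr s' (D + 3)) (nvar s' 2),
     tracks L delta c0 A (rarr s' (D + 3)) (rarr s' (D + 4)) (nvar s' 2) rest (evs s'),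
     (nvar s' 3 + 3 * nvar s' 2 <= nvar s 3 + 3 * nvar s 2)%N &
     (t + 300 * nvar s' 2 <= 300 * nvar s 2 + 100)%N]).
  by move=> /runs_agree h; apply: runs_mono h _ => s' t [ha [h1 h2 h3 h4 h5]]; exact: hQ.
move=> {Q hQ}.
rewrite /c_pops.
pose I s1 := let V := rarr s1 (D + 3) in let B := rarr s1 (D + 4) in let r := nvar s1 2 in
  [/\ rvar s1 1 = delta /\ rvar s1 2 = L, stack_inv L V B r, decreasing V r.-1,
   tracks L delta c0 A V B r rest (evs s1) &
   (1 <= nvar s1 6)%N = (3 <= r)%N && (gap V (r - 2)%N <= gap V (r - 1)%N) /\
   (nvar s1 3 + 3 * r <= nvar s 3 + 3 * nvar s 2)%N].
have test_I s1 : rvar s1 1 = delta -> rvar s1 2 = L ->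
    stack_inv L (rarr s1 (D + 3)) (rarr s1 (D + 4)) (nvar s1 2) ->
    decreasing (rarr s1 (D + 3)) (nvar s1 2).-1 ->
    tracks L delta c0 A (rarr s1 (D + 3)) (rarr s1 (D + 4)) (nvar s1 2) rest (evs s1) ->
    (nvar s1 3 + 3 * nvar s1 2 <= nvar s 3 + 3 * nvar s 2)%N -> I (outcome (c_test D) s1).
  move=> g1 g2 g3 g4 g5 g6; have [h1 h2 h3 h4] := outcome_test D s1.
  by rewrite /I /= h1 h2 !h3 // !h4 // (eq_evs _ h2) // h3.
apply: runs_seq; apply: runs_straight => // t1 ht1.
apply: (@runs_while _ _ _ _ I (fun s1 => 300 * nvar s1 2)%N).
- exact: test_I.
- move=> s1 [[g1 g2] g3 g4 g5 [g6 g7]] /=; rewrite g6 => /andP[h1 h2].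
  apply: runs_straight => // t ht.
  have {}ht : (t <= 400)%N by apply: leq_trans ht _.
  have [k hk] : exists k, nvar s1 2 = k.+3 by exists (nvar s1 2 - 3)%N; lia.
  rewrite outcome_seq.
  have [w1 o2 o3 o4] := outcome_pop D hk.
  have ha := outcome_agree (c := c_pop D) s1 erefl.
  rewrite hk /= in h1 h2 g3 g4 g5 g7; rewrite !subSS !subn0 in h2.
  have [p1 p2 p3 p4 p5] := stack_pop g3 g4 h2.
  rewrite hk; move: (outcome (c_pop D) s1) w1 o2 o3 o4 ha => s2 w1 o2 o3 o4 ha.
  have r2 : nvar (outcome (c_test D) s2) 2 = k.+1.
    by have [_ _ h _] := outcome_test D s2; rewrite h.
  have hN: (nvar s2 3 <= nvar s1 3 + 6)%N.
    have : size (evs s2) = nvar s2 3 by rewrite /evs size_map size_iota.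
    rewrite w1 !size_cat {1}/evs size_map size_iota => <-.
    have h := @size_emitted R (rvar s1 2) (rvar s1 1).
    by rewrite addnA -addnA leq_add2l (leq_add (h _ _ _) (leq_add (h _ _ _) (h _ _ _))).
  split; last by rewrite r2; move: ht; clear; lia.
  apply: test_I.
  + by rewrite (agreeR ha).
  + by rewrite (agreeR ha).
  + by rewrite o2 o3 o4.
  + by rewrite o2 o3.
  + rewrite w1 o2 o3 o4 g1 g2; apply: tracks_emit g5; [|exact: p4|exact: p5].
    by move=> eps he; apply: p3.
  + by rewrite o2; move: hN g7; clear; lia.
- move=> s1 t [[g1 g2] g3 g4 g5 [g6 g7]] /=; rewrite g6 => hgo ht.
  have h2 : nvar (outcome (c_test D) s) 2 = nvar s 2.
    by have [_ _ h _] := outcome_test D s; rewrite h.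
  split=> //; last first.
    move: ht ht1; rewrite h2 => ht ht1.
    have {}ht1 : (t1 <= 60)%N by apply: leq_trans ht1 _.
    by move: ht ht1; clear; lia.
  move=> k /andP[k2 kr]; have [hk|hk] := ltnP k (nvar s1 2).-1; first by apply: g4; rewrite k2.
  have hkk : nvar s1 2 = k.+1 by move: kr hk; clear; lia.
  move: hgo; rewrite hkk ltnS k2 /= -ltNge.
  have -> : (k.+1 - 2 = k.-1)%N by move: k2; clear; lia.
  by rewrite subSS subn0.
Qed.

End Pass.

Section Pass.
Context {R : realType}.
Variable D : nat.
Implicit Types (s : state R).
Local Notation evs := (evs D).

Definition c_drain : cmd :=
  While (NLe (NLit 2) (NVar 2))
    ((NSetVar 2 (NSub (NVar 2) (NLit 1)) ;; c_gap D 6 (NVar 2) ;; RSetVar 22 (RDiv (RVar 6) (RLit 2))) ;;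
     c_emit_piece D 6 0).

Lemma runs_drain L delta c0 A s Q : 0 <= delta ->
  rvar s 1 = delta -> rvar s 2 = L ->
  stack_inv L (rarr s (D + 3)) (rarr s (D + 4)) (nvar s 2) ->
  decreasing (rarr s (D + 3)) (nvar s 2) ->
  tracks L delta c0 A (rarr s (D + 3)) (rarr s (D + 4)) (nvar s 2) [::] (evs s) ->
  (forall s' t, agree c_drain s s' ->
     tracks L delta c0 A (rarr s' (D + 3)) (rarr s' (D + 4)) 1 [::] (evs s') ->
     (nvar s' 3 + 3 <= nvar s 3 + 3 * nvar s 2)%N ->
     (t <= 100 * nvar s 2 + 100)%N -> Q s' t) ->
  runs c_drain s Q.
Proof.
move=> d0 hdelta hL hinv hdec htr hQ.
suff : runs c_drain s (fun s' t =>
     [/\ tracks L delta c0 A (rarr s' (D + 3)) (rarr s' (D + 4)) 1 [::] (evs s'),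
     (nvar s' 3 + 3 <= nvar s 3 + 3 * nvar s 2)%N &
     (t <= 100 * nvar s 2 + 100)%N]).
  by move=> /runs_agree h; apply: runs_mono h _ => s' t [ha [h1 h2 h3]]; exact: hQ.
move=> {Q hQ}.
set V := rarr s (D + 3) in hinv hdec htr; set B := rarr s (D + 4) in hinv hdec htr.
set r := nvar s 2 in hinv hdec.
pose I s1 := [/\ rvar s1 1 = delta /\ rvar s1 2 = L,
   rarr s1 (D + 3) = V /\ rarr s1 (D + 4) = B, (1 <= nvar s1 2 <= r)%N,
   tracks L delta c0 A V B (nvar s1 2) [::] (evs s1) &
   (nvar s1 3 + 3 * nvar s1 2 <= nvar s 3 + 3 * nvar s 2)%N].
apply: (@runs_while _ _ _ _ I (fun s1 => 100 * nvar s1 2)%N).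
- by split=> //; rewrite leqnn andbT; exact: stack_r hinv.
- move=> s1 [[g1 g2] [g3 g4] g5 g6 g7] hr; have {}hr : (2 <= nvar s1 2)%N by exact: hr.
  have [k hk] : exists k, nvar s1 2 = k.+2 by exists (nvar s1 2 - 2)%N; move: hr; clear; lia.
  apply: runs_straight => // t ht.
  have {}ht : (t <= 90)%N by apply: leq_trans ht _.
  rewrite outcome_seq.
  set s2 := outcome (_ ;; _ ;; _) s1.
  have hs2 : [/\ nvar s2 2 = k.+1, nvar s2 3 = nvar s1 3, rarr s2 = rarr s1 &
     [/\ rvar s2 6 = gap V k.+1, rvar s2 22 = gap V k.+1 / 2,
      rvar s2 1 = rvar s1 1 & rvar s2 2 = rvar s1 2]].
    have s2E : s2 = outcome (RSetVar 22 (RDiv (RVar 6) (RLit 2)))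
        (outcome (c_gap D 6 (NVar 2)) (outcome (NSetVar 2 (NSub (NVar 2) (NLit 1))) s1)) by [].
    rewrite s2E outcome_gap /= hk subn1 -g3; have -> : update (nvar s1) 2 k.+2.-1%N 2 = k.+1 by [].
    by [].
  clearbody s2; case: hs2 => e1 e2 e3 [e4 e5 e6 e7].
  have [f1 f2 f3 f4] := @emit_piece R D s2 6 0 _ erefl erefl.
  move: f1 f2 f3 f4; set s3 := outcome _ s2 => f1 f2 f3 f4; clearbody s3.
  rewrite !e1 e4 e5 e6 e7 g1 g2 e3 g4 subn0 (eq_evs D e2 e3) in f1.
  rewrite hk in g5 g6 g7.
  have kr : (k.+2 <= r)%N by case/andP: g5.
  have [p1 p2 p3] := stack_finish hinv hdec kr.
  have hN : (nvar s3 3 <= nvar s1 3 + 2)%N.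
    have : size (evs s3) = nvar s3 3 by rewrite /evs size_map size_iota.
    by rewrite f1 !size_cat {1}/evs size_map size_iota => <-; rewrite leq_add2l size_emitted.
  rewrite hk f2 e1; split; last by move: ht => /=; clear; lia.
  rewrite /I !f3 // !f4 //; do ?(by rewrite !eqn_leq; lia).
  rewrite e6 e7 g1 g2 e3 f2 e1; split=> //.
  + by rewrite /= ltnW.
  + rewrite f1; apply: tracks_emit g6; [|exact: p2|exact: p3].
    by move=> eps he; apply: p1.
  + by move: hN g7; clear; lia.
- move=> s1 t [[g1 g2] [g3 g4] g5 g6 g7] /= hr ht.
  have h1 : nvar s1 2 = 1%N by case/andP: g5 hr; clear; lia.
  rewrite h1 in g6 g7 ht; split=> //; first by rewrite g3 g4.
  by move: ht => /=; clear; lia.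
Qed.

(** The extra 1 makes the sentinel exceed [2 * L] strictly, also for [L = 0]; its birth [L] lies
    above every level considered. *)
Definition c_init (a : nat) : cmd :=
  RSetArr (D + 3) (NLit 0) (RSub (RSub (RGet a (NLit 0)) (RMul (RLit 2) (RVar 2))) (RLit 1)) ;;
  RSetArr (D + 3) (NLit 1) (RGet a (NLit 0)) ;;
  RSetArr (D + 4) (NLit 0) (RVar 2) ;; RSetArr (D + 4) (NLit 1) (RLit 0) ;;
  NSetVar 2 (NLit 1) ;; NSetVar 4 (NLit 1).

Lemma outcome_init a s : (a < D)%N -> 0 <= rvar s 2 ->
  let s' := outcome (c_init a) s in
  [/\ stack_inv (rvar s 2) (rarr s' (D + 3)) (rarr s' (D + 4)) 1,
      rarr s' (D + 3) 0%N <= rarr s' (D + 3) 1%N /\ rarr s' (D + 3) 1%N = rarr s a 0%N,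
      evs s' = evs s & nvar s' 2 = 1%N /\ nvar s' 4 = 1%N].
Proof.
move=> aD L0 s'.
have e1 : (D + 3 == D + 4)%N = false by lia.
have e2 : (D + 4 == D + 3)%N = false by lia.
have e3 : (D == D + 3)%N = false by lia.
have e4 : (D == D + 4)%N = false by lia.
have e5 : (D.+1 == D + 3)%N = false by lia.
have e6 : (D.+1 == D + 4)%N = false by lia.
have e7 : (a == D + 3)%N = false by lia.
have [hV0 hV1 hB0 hB1] : [/\ rarr s' (D + 3) 0%N = rarr s a 0%N - 2 * rvar s 2 - 1,
    rarr s' (D + 3) 1%N = rarr s a 0%N, rarr s' (D + 4) 0%N = rvar s 2 & rarr s' (D + 4) 1%N = 0].
  by rewrite /s' /= /update !eqxx ?e1 ?e2 ?eqxx ?e7 /=.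
split.
- split=> //; rewrite ?hV0 ?hV1 ?hB0 ?hB1 //.
  + by lra.
  + by move=> [|k] // _; rewrite hV0 hV1 /=; lra.
  + by move=> k; rewrite ltnS; case: k.
  + by move=> k; rewrite ltnS; case: k.
  + by move=> k; case: k => [|[]].
- by rewrite hV0 hV1; split=> //; lra.
- by rewrite /evs /s' /= /update e3 e4 e5 e6.
- by [].
Qed.

End Pass.

Lemma stack_count_end (R : realType) L eps delta (V B : nat -> R) : L <= B 0%N -> 2 * L < V 1%N - V 0%N ->
  0 <= eps < L -> stack_count eps delta V B 1 [::] = 0%N.
Proof.
move=> hB hV /andP[e0 e1]; rewrite /stack_count /entries /=.
rewrite cntE_extend ?/beyond // cntE_turn //; last by lra.
by rewrite cnt_nil; have -> : (B 0%N <= eps) = false by apply/negbTE; rewrite -ltNge; lra.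
Qed.

(** * A pass over one coordinate of one curve *)

Section Pass.
Context {R : realType}.
Variable D : nat.
Implicit Types (s : state R).
Local Notation evs := (evs D).

Definition c_pass (a nv : nat) : cmd :=
  c_init D a ;;
  While (NLe (NAdd (NVar 4) (NLit 1)) (NVar nv)) (c_step D a ;; c_pops D) ;;
  c_drain D.

Lemma runs_pass a nv L delta c0 A s Q : (a < D)%N -> (nv <= 1)%N -> (0 < nvar s nv)%N ->
  0 <= delta -> 0 <= L -> rvar s 1 = delta -> rvar s 2 = L ->
  (forall eps, 0 <= eps < L -> c0 eps <= cov (evs s) eps) ->
  area L (evs s) <= A -> (forall e, e \in evs s -> 0 <= e.1 < L) ->
  let x := rarr s a in let n := nvar s nv in
  (forall s' t, agree (c_pass a nv) s s' ->
     (forall eps, 0 <= eps < L -> c0 eps + (short_pieces eps delta true (x 0%N) false (x 0%N) 0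
         (timed [seq x i | i <- iota 1 n.-1]))%:R <= cov (evs s') eps) ->
     area L (evs s') <= A + delta * n.-1%:R -> (forall e, e \in evs s' -> 0 <= e.1 < L) ->
     (nvar s' 3 <= nvar s 3 + 3 * n)%N -> rvar s' 3 = rvar s 3 + n.-1%:R ->
     (t <= 1000 * n)%N -> Q s' t) ->
  runs (c_pass a nv) s Q.
Proof.
move=> aD hnv n0 d0 L0 hdelta hL hc hA hev x n hQ.
suff : runs (c_pass a nv) s (fun s' t =>
   [/\ (forall eps, 0 <= eps < L -> c0 eps + (short_pieces eps delta true (x 0%N) false (x 0%N) 0
         (timed [seq x i | i <- iota 1 n.-1]))%:R <= cov (evs s') eps),
     area L (evs s') <= A + delta * n.-1%:R, (forall e, e \in evs s' -> 0 <= e.1 < L) &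
     [/\ (nvar s' 3 <= nvar s 3 + 3 * n)%N, rvar s' 3 = rvar s 3 + n.-1%:R &
     (t <= 1000 * n)%N]]).
  by move=> /runs_agree h; apply: runs_mono h _ => s' t [ha [h1 h2 h3 [h4 h5 h6]]]; exact: hQ.
move=> {Q hQ}.
(* The count of this curve is added to what the earlier events already cover. *)
pose c' eps := c0 eps + (short_pieces eps delta true (x 0%N) false (x 0%N) 0
         (timed [seq x i | i <- iota 1 n.-1]))%:R.
have aV : a \notin [:: D; D.+1; (D + 3)%N; (D + 4)%N] by rewrite !inE; lia.
apply: runs_seq; apply: runs_straight => // t0 ht0.
have {}ht0 : (t0 <= 60)%N by apply: leq_trans ht0 _.
rewrite -{1}hL in L0; have [i1 [i2 i3] i4 [i5 i6]] := outcome_init aD L0; rewrite hL in L0 i1.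
have hai := outcome_agree (c := c_init D a) s erefl.
move: (outcome (c_init D a) s) i1 i2 i3 i4 i5 i6 hai => s0 i1 i2 i3 i4 i5 i6 hai.
have xs0 : rarr s0 a = x.
  by rewrite (agreeA hai) // !inE; move: aV; rewrite !inE; lia.
have ns0 : nvar s0 nv = n by rewrite (agreeN hai) // !inE; lia.
have es0 : nvar s0 3 = nvar s 3 by rewrite (agreeN hai).
have rs0 : rvar s0 3 = rvar s 3 by rewrite (agreeR hai).
pose I s1 := let i := nvar s1 4 in [/\ [/\ rvar s1 1 = delta, rvar s1 2 = L, rarr s1 a = x & nvar s1 nv = n],
   stack_inv L (rarr s1 (D + 3)) (rarr s1 (D + 4)) (nvar s1 2),
   decreasing (rarr s1 (D + 3)) (nvar s1 2),
   tracks L delta c' (A + delta * i.-1%:R) (rarr s1 (D + 3)) (rarr s1 (D + 4)) (nvar s1 2)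
     [seq x k | k <- iota i (n - i)] (evs s1) &
   [/\ (1 <= i <= n)%N, rvar s1 3 = rvar s 3 + i.-1%:R & (nvar s1 3 + 3 * nvar s1 2 <= nvar s 3 + 3 * i)%N]].
(* Each unread vertex holds enough for its own step, for a last failed test, and for the 300 owed to
   the stack entry it may create. *)
apply: runs_seq; apply: (@runs_while _ _ _ _ I (fun s1 => 500 * (n - nvar s1 4) + 300 * nvar s1 2)%N).
- rewrite /I i5 i6; split=> //.
  + by rewrite !(agreeR hai).
  + by move=> k; case: k => [|[]].
  + split; last by rewrite i4.
    * move=> eps he; rewrite /c' (@stack_count1 R L) // i3 i4 subn1.
      have := hc eps he; have [e0 _] := andP he.
      (* The stack starts the first piece at the sentinel instead of [x 0]; uncounted in both cases,
         it does not affect the bound. *)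
      have := @cnt_mono R eps delta e0 true (x 0%N) (rarr s0 (D + 3) 0%N) false (x 0%N) 0
        (timed [seq x i | i <- iota 1 n.-1]) (lexx _).
      by rewrite andFb addn0 -(ler_nat R); lra.
    * by rewrite i4 /= mulr0 addr0 stack_credit1 addr0.
  + by rewrite n0 rs0 es0 addr0; split.
- move=> s1 [[g1 g2 g3 g4] g5 g6 g7 [g8 g9 g10]] hi.
  have {}hi : (nvar s1 4 < n)%N by move: hi; rewrite /= g4 addn1.
  apply: runs_seq; apply: runs_straight => // t1 ht1.
  have {}ht1 : (t1 <= 90)%N by apply: leq_trans ht1 _.
  have [k1 k2 k3 [k4 k5 k6]] := outcome_step s1 aD.
  have has := outcome_agree (c := c_step D a) s1 erefl.
  move: (outcome (c_step D a) s1) k1 k2 k3 k4 k5 k6 has => s2.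
  set V := rarr s1 (D + 3) in g5 g6 g7 *; set B := rarr s1 (D + 4) in g5 g7 *.
  set r := nvar s1 2 in g5 g6 g7 g10 *; rewrite g3; set i := nvar s1 4 in g7 g8 g9 g10 hi *.
  move=> k1 k2 k3 k4 k5 k6 has.
  have hrest : [seq x k | k <- iota i (n - i)] = x i :: [seq x k | k <- iota i.+1 (n - i.+1)].
    by have -> : (n - i = (n - i.+1).+1)%N by lia.
  rewrite hrest in g7.
  have [j1 j2 j3] : [/\ stack_inv L (rarr s2 (D + 3)) (rarr s2 (D + 4)) (nvar s2 2),
      decreasing (rarr s2 (D + 3)) (nvar s2 2).-1 &
      tracks L delta c' (A + delta * i%:R) (rarr s2 (D + 3)) (rarr s2 (D + 4)) (nvar s2 2)
     [seq x k | k <- iota i.+1 (n - i.+1)] (evs s2)].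
    have -> : A + delta * i%:R = A + delta * i.-1%:R + delta.
      by rewrite -{1}(prednK (n := i)); [rewrite -natr1; ring|case/andP: g8].
    rewrite k4 k1 k2 k3; case: ifPn => hgo.
      have [l1 l2 _ _] := stack_continue g5 hgo.
      by split=> //; [exact: l2|exact: tracks_continue].
    rewrite -ltNge in hgo; have [l1 l2 _ _] := stack_push g5 hgo.
    by split=> //; [exact: l2|exact: tracks_push].
  apply: (runs_pops d0 _ _ j1 j2 j3); rewrite ?(agreeR has) //.
  move=> s3 t3 hap q1 q2 q3 q4 q5.
  have s34 : nvar s3 4 = i.+1 by rewrite (agreeN hap).
  have e2 : nvar s2 3 = nvar s1 3 by rewrite (agreeN has).
  have r2 : (nvar s2 2 <= r.+1)%N by rewrite k1; case: ifP.
  split; last by rewrite s34 /=; move: q5 ht1 r2 hi; clear; lia.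
  rewrite /I s34; split=> //.
  + rewrite !(agreeR hap) // !(agreeR has) // (agreeA hap) ?(agreeA has) // ?inE;
      [|by move: aV; rewrite !inE; lia|by move: aV; rewrite !inE; lia].
    by rewrite (agreeN hap) ?(agreeN has) // !inE; lia.
  + split; first by rewrite hi.
      by rewrite (agreeR hap) // k6 g9 -addrA natr1 prednK //; case/andP: g8.
    by move: q4 e2 r2 g10; clear; lia.
- move=> s1 t1 [[g1 g2 g3 g4] g5 g6 g7 [g8 g9 g10]] hi ht1.
  have hn : nvar s1 4 = n by move: hi g8; rewrite /= g4; clear; lia.
  rewrite hn subnn /= in g7 g9 g10 ht1.
  apply: (runs_drain d0 g1 g2 g5 g6 g7) => s2 t2 ha2 f1 f2 f3.
  have [f4 f5 f6] := f1.
  have hV : rarr s2 (D + 3) = rarr s1 (D + 3) by rewrite (agreeA ha2) // !inE; lia.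
  have hB : rarr s2 (D + 4) = rarr s1 (D + 4) by rewrite (agreeA ha2) // !inE; lia.
  rewrite hV hB in f4 f5.
  split=> //.
  + move=> eps he; have := f4 eps he; rewrite (@stack_count_end R L) ?addr0 //.
    * exact: stack_B0 g5.
    * exact: stack_V0 g5.
  + by move: f5; rewrite stack_credit1 addr0.
  + split; last first.
    * have := stack_r g5; move: ht1 f3 ht0; rewrite /= i6; clear -n0 i5; rewrite i5; lia.
    * by rewrite (agreeR ha2) // g9.
    * by move: f2 g10; clear; lia.
Qed.

End Pass.

(** * Selecting a pivot *)

Section Arrays.
Context {R : realType}.
Implicit Types (X Y : nat -> R) (P : pred R) (lo i k N g : nat).

Definition swap X k := update (update X k (X k.-1)) k.-1 (X k).

Lemma swapE X k j : swap X k j = if j == k.-1 then X k else if j == k then X k.-1 else X j.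
Proof. by []. Qed.

(** The state of insertion sort while the entry at [k] sinks to its place. *)
Definition almost_sorted X lo i k :=
  (forall a b, (lo <= a < b)%N -> (b <= i)%N -> a != k -> b != k -> X a <= X b) /\
  (forall b, (k < b <= i)%N -> X k <= X b).

Definition sorted_on X lo i := forall a b, (lo <= a <= b)%N -> (b <= i)%N -> X a <= X b.

Lemma almost_sorted_swap X lo i k : (lo < k <= i)%N -> X k < X k.-1 ->
  almost_sorted X lo i k -> almost_sorted (swap X k) lo i k.-1.
Proof.
move=> /andP[lk ki] hX [h1 h2]; split=> [a b /andP[la ab] bi ha hb|b /andP[kb bi]]; rewrite !swapE.
  rewrite (negbTE ha) (negbTE hb); case: eqP => [E|/eqP ak]; case: eqP => [E'|/eqP bk].
  - by [].
  - by apply: h1 => //; [rewrite -subn1; lia| rewrite -subn1; lia].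
  - by apply: h1 => //; [rewrite -subn1 in hb ha *; lia| rewrite -subn1; lia | rewrite -subn1; lia].
  - by apply: h1 => //; lia.
rewrite eqxx; have -> : (b == k.-1) = false by rewrite -subn1 in kb *; lia.
case: eqP => [E|/eqP bk]; first exact: ltW.
by apply: h2; rewrite -subn1 in kb; lia.
Qed.

Lemma almost_sorted_start X lo i : almost_sorted X lo i lo -> sorted_on X lo i.
Proof.
move=> [h1 h2] a b /andP[la]; rewrite leq_eqVlt => /orP[/eqP -> //|ab] bi.
by have [->|al] := eqVneq a lo; [apply: h2; lia|apply: h1; lia].
Qed.

Lemma almost_sorted_stop X lo i k : (lo < k)%N -> X k.-1 <= X k ->
  almost_sorted X lo i k -> sorted_on X lo i.
Proof.
move=> lk hX [h1 h2] a b /andP[la]; rewrite leq_eqVlt => /orP[/eqP -> //|ab] bi.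
have [ak|ak] := eqVneq a k; first by rewrite ak; apply: h2; lia.
have [bk|bk] := eqVneq b k; last by apply: h1 => //; lia.
rewrite bk; apply: le_trans hX; have [->//|] := eqVneq a k.-1 => ak1.
by apply: h1; rewrite -subn1 in ak1 *; lia.
Qed.

Definition tallyn P X N := (\sum_(0 <= i < N) P (X i))%N.

Lemma tally_eq P X Y N : (forall i, (i < N)%N -> X i = Y i) -> tallyn P X N = tallyn P Y N.
Proof. by move=> h; apply: eq_big_nat => i /h ->. Qed.

Lemma tallyS P X N : tallyn P X N.+1 = (tallyn P X N + P (X N))%N.
Proof. by rewrite /tallyn big_nat_recr. Qed.

Lemma tally_swap P X k N : (0 < k < N)%N -> tallyn P (swap X k) N = tallyn P X N.
Proof.
case: k => // k /= kN; have -> : N = (k.+2 + (N - k.+2))%N by lia.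
elim: (N - k.+2)%N => [|m IH]; last first.
  rewrite addnS [LHS]tallyS [RHS]tallyS IH swapE /=; have -> : ((k.+2 + m)%N == k) = false by lia.
  by have -> : ((k.+2 + m)%N == k.+1) = false by lia.
rewrite addn0 !tallyS !swapE /= !eqxx; have -> : (k.+1 == k) = false by lia.
rewrite (@tally_eq _ _ X) 1?addnAC // => i hi; rewrite swapE /=.
by do 2 (case: eqP => [?|_]; first by lia).
Qed.

Definition among X N Y M := forall i, (i < N)%N -> exists2 k, (k < M)%N & X i = Y k.

Lemma among_swap X k N : (0 < k < N)%N -> among (swap X k) N X N.
Proof.
move=> hk i hi; rewrite swapE; case: eqP => _; first by exists k => //; lia.
by case: eqP => _; [exists k.-1 => //; lia|exists i].
Qed.

Lemma among_trans X N Y M Z K : among X N Y M -> among Y M Z K -> among X N Z K.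
Proof. by move=> h1 h2 i /h1[k /h2[l hl E] ->]; exists l. Qed.

Lemma sum_four (E : nat -> nat) n : (\sum_(0 <= i < n.+4) E i =
  \sum_(0 <= i < n) E i + (E n + E n.+1 + E n.+2 + E n.+3))%N.
Proof. by do 4 (rewrite big_nat_recr //=); rewrite !addnA. Qed.

(** In a sorted group the entries satisfying [E] form an initial segment, and each block of four is
    represented by its last entry. A represented block is full, and a group has at most one partly
    filled block, which costs at most 3. *)
Lemma decimate_bounds (E : nat -> bool) g M : (0 < g)%N ->
  (forall a b, (a <= b)%N -> (a %/ 4 %/ g = b %/ 4 %/ g)%N -> E b -> E a) ->
  (4 * (\sum_(0 <= m < M) E (4 * m + 3)%N) <= \sum_(0 <= i < 4 * M) E i)%N /\
  (\sum_(0 <= i < 4 * M + 3) E i <= 4 * (\sum_(0 <= m < M) E (4 * m + 3)%N) + 3 * (1 + M %/ g))%N.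
Proof.
move=> g0 hE; elim: M => [|M [IH1 IH2]].
  rewrite muln0 add0n; split; first by rewrite !big_geq.
  rewrite [in leqRHS]big_geq // div0n.
  have -> : (\sum_(0 <= i < 3) E i = E 0 + E 1 + E 2)%N by do 3 (rewrite big_nat_recr //=); rewrite big_geq.
  by case: (E 0%N); case: (E 1%N); case: (E 2%N).
have imp a b : (a <= b)%N -> (a %/ 4 %/ g = b %/ 4 %/ g)%N -> (E b <= E a)%N.
  by move=> h1 h2; case: (boolP (E b)) => // /(hE _ _ h1 h2) ->.
have div4 r m : (r < 4)%N -> ((4 * m + r) %/ 4 = m)%N by move=> hr; rewrite mulnC divnMDl // divn_small // addn0.
have e r : (r <= 3)%N -> (E (4 * M + 3) <= E (4 * M + r))%N.
  by move=> hr; apply: imp; [lia|rewrite !div4].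
rewrite [X in (4 * X <= _)%N]big_nat_recr // [X in (_ <= 4 * X + _)%N]big_nat_recr //=.
move: IH1 IH2; set SM := (\sum_(0 <= m < M) _)%N => IH1 IH2.
split.
  have -> : (4 * M.+1 = (4 * M).+4)%N by clear; lia.
  rewrite sum_four; move: (e 0%N isT) (e 1%N isT) (e 2%N isT) IH1.
  rewrite addn0 addn1 addn2 addn3; set b0 := E _; set b1 := E _; set b2 := E _; set b3 := E _.
  by set S0 := (\sum_(_ <= _ < _) _)%N; clear; lia.
have e4 : (4 * M.+1 + 3 = (4 * M + 3).+4)%N by clear; lia.
have e5 : ((4 * M + 3).+1 = 4 * M.+1 + 0)%N by clear; lia.
have e6 : ((4 * M + 3).+2 = 4 * M.+1 + 1)%N by clear; lia.
have e7 : ((4 * M + 3).+3 = 4 * M.+1 + 2)%N by clear; lia.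
rewrite e4 sum_four e7 e6 e5 divnS //.
(* Inside a group an entry of the next block can satisfy [E] only if the last representative does;
   at a group boundary this fails and 3 is paid. *)
have f r : (r <= 2)%N -> ~~ (g %| M.+1)%N -> (E (4 * M.+1 + r) <= E (4 * M + 3))%N.
  move=> hr hg; apply: imp; first by lia.
  by rewrite !div4 //; [rewrite divnS // (negbTE hg)|lia].
move: IH2 (f 0%N isT) (f 1%N isT) (f 2%N isT); clearbody SM; clear.
set S0 := (\sum_(_ <= _ < _) _)%N; clearbody S0; move: (M %/ g)%N => q.
move: (E _) (E _) (E _) (E _) => b3 b0 b1 b2; case: (g %| M.+1)%N => /= h f0 f1 f2.
  by move: h; clear; lia.
by move: h (f0 isT) (f1 isT) (f2 isT); clear; lia.
Qed.

Definition lower_closed P := forall x y : R, x <= y -> P y -> P x.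

Definition sorted_groups X g N := forall a b, (a <= b < N)%N -> (a %/ g = b %/ g)%N -> X a <= X b.

Lemma tally_decimate P X Y g N : lower_closed P -> (0 < g)%N -> sorted_groups X (4 * g) N ->
  (forall m, (m < N %/ 4)%N -> Y m = X (4 * m + 3)%N) ->
  (4 * tallyn P Y (N %/ 4) <= tallyn P X N)%N /\
  (tallyn P X N <= 4 * tallyn P Y (N %/ 4) + 3 * (1 + N %/ (4 * g)))%N.
Proof.
(* Cut off at [N], the predicate stays closed downwards in each group, and the sums may run to
   [4 * (N %/ 4) + 3], which is at least [N]. *)
move=> dP g0 hX hY; pose E i := (i < N)%N && P (X i).
have hdiv := divn_eq N 4; have hmod := ltn_pmod N (isT : (0 < 4)%N).
have eY : tallyn P Y (N %/ 4) = (\sum_(0 <= m < N %/ 4) E (4 * m + 3))%N.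
  apply: eq_big_nat => m hm; rewrite hY /E; last by case/andP: hm.
  by have -> : (4 * m + 3 < N)%N by lia.
have eX : tallyn P X N = (\sum_(0 <= i < N) E i)%N by apply: eq_big_nat => i hi; rewrite /E; case/andP: hi => _ ->.
have [|h1 h2] := @decimate_bounds E g (N %/ 4) g0.
  move=> a b ab; rewrite -!divnMA => hab /andP[bN Pb]; rewrite /E (leq_ltn_trans ab bN) /=.
  by apply: dP Pb; apply: hX => //; rewrite ab.
rewrite divnMA eX eY; split.
  apply: leq_trans h1 _; rewrite [leqRHS](big_cat_nat _ (n := (4 * (N %/ 4))%N)) //=; last by lia.
  exact: leq_addr.
apply: leq_trans h2; rewrite [leqRHS](big_cat_nat _ (n := N)) //=; last by lia.
exact: leq_addr.
Qed.

Lemma tally_middle X N : (0 < N)%N -> sorted_on X 0 N.-1 ->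
  let mu := X (N./2) in
  (2 * tallyn (fun x => (x < mu)%R) X N <= N)%N /\ (N <= 2 * tallyn (fun x => (x <= mu)%R) X N)%N.
Proof.
move=> N0 hX mu; have hN := odd_double_half N.
have h2 : (N./2 <= N)%N by lia.
split; rewrite /tallyn (big_cat_nat _ (n := N./2)) //=.
  rewrite [X in (_ + X)%N]big_nat_cond [X in (_ + X)%N]big1 ?addn0.
    apply: (@leq_trans (2 * N./2)); last by lia.
    rewrite leq_mul2l /= -[leqRHS]subn0 -[leqRHS]muln1 -[leqRHS]sum_nat_const_nat.
    by apply: leq_sum => i _; exact: leq_b1.
  move=> i /andP[/andP[i1 i2] _]; have : mu <= X i by apply: hX; lia.
  by rewrite leNgt => /negbTE ->.
rewrite [X in (X + _)%N](_ : _ = N./2); last first.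
  rewrite -[RHS]subn0 -[RHS]muln1 -[RHS]sum_nat_const_nat; apply: eq_big_nat => i /andP[_ hi].
  by rewrite hX //; lia.
by rewrite big_ltn ?lexx /=; [lia|lia].
Qed.

Lemma tally_all X N : tallyn xpredT X N = N.
Proof. by rewrite /tallyn sum_nat_const_nat subn0 muln1. Qed.

End Arrays.

Section Pivot.
Context {R : realType}.
Variable a : nat.
Implicit Types (s : state R) (X : nat -> R) (P : pred R).

(** A permutation, expressed through its two consequences for sampling: equal tallies and
    membership. *)
Definition rearranged X N Y := (forall P, tallyn P Y N = tallyn P X N) /\ among Y N X N.

Lemma rearranged_refl X N : rearranged X N X.
Proof. by split=> // i hi; exists i. Qed.

Lemma rearranged_trans X N Y Z : rearranged X N Y -> rearranged Y N Z -> rearranged X N Z.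
Proof. by move=> [h1 h2] [h3 h4]; split=> [P|]; [rewrite h3|exact: among_trans h2]. Qed.

Lemma rearranged_swap X N k : (0 < k < N)%N -> rearranged X N (swap X k).
Proof. by move=> h; split=> [P|]; [exact: tally_swap|exact: among_swap]. Qed.

Definition c_insert : cmd :=
  While (NLe (NAdd (NVar 14) (NLit 1)) (NVar 13))
    (If (RLe (RGet a (NSub (NVar 13) (NLit 1))) (RGet a (NVar 13)))
       (NSetVar 13 (NVar 14))
       (RSetVar 10 (RGet a (NVar 13)) ;;
        RSetArr a (NVar 13) (RGet a (NSub (NVar 13) (NLit 1))) ;;
        RSetArr a (NSub (NVar 13) (NLit 1)) (RVar 10) ;;
        NSetVar 13 (NSub (NVar 13) (NLit 1)))).

Lemma runs_insert s lo i N Q : nvar s 14 = lo -> nvar s 13 = i -> (lo <= i < N)%N ->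
  almost_sorted (rarr s a) lo i i ->
  (forall s' t, agree c_insert s s' -> sorted_on (rarr s' a) lo i ->
     (forall j, (j < lo)%N -> rarr s' a j = rarr s a j) ->
     rearranged (rarr s a) N (rarr s' a) -> (t <= 60 * (i - lo) + 20)%N -> Q s' t) ->
  runs c_insert s Q.
Proof.
move=> hlo hi hN has hQ.
suff : runs c_insert s (fun s' t => [/\ sorted_on (rarr s' a) lo i,
     (forall j, (j < lo)%N -> rarr s' a j = rarr s a j),
     rearranged (rarr s a) N (rarr s' a) & (t <= 60 * (i - lo) + 20)%N]).
  by move=> /runs_agree h; apply: runs_mono h _ => s' t [ha [h1 h2 h3 h4]]; exact: hQ.
move=> {Q hQ}.
(* The second alternative is the early exit: once the entry is in place, the index is reset to
   [lo]. *)
pose I s1 := [/\ nvar s1 14 = lo, (lo <= nvar s1 13 <= i)%N,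
   (forall j, (j < lo)%N -> rarr s1 a j = rarr s a j), rearranged (rarr s a) N (rarr s1 a) &
   almost_sorted (rarr s1 a) lo i (nvar s1 13) \/ (nvar s1 13 = lo /\ sorted_on (rarr s1 a) lo i)].
apply: (@runs_while _ _ _ _ I (fun s1 => 60 * (nvar s1 13 - lo))%N).
- by rewrite /I hlo hi; split=> //; [lia|exact: rearranged_refl|left].
- move=> s1 [g1 g2 g3 g4 g5] hk; have {}hk : (lo < nvar s1 13)%N by move: hk; rewrite /= g1 addn1.
  have {}g5 : almost_sorted (rarr s1 a) lo i (nvar s1 13) by case: g5 => // -[E _]; move: hk; rewrite E ltnn.
  apply: runs_straight => // t ht; have {}ht : (t <= 40)%N by apply: leq_trans ht _.
  rewrite /= subn1; case: ifP => hle.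
    split; last by rewrite /update /= g1 subnn; move: ht hk; clear; lia.
    set s2 := set_nvar _ _ _; have [e1 e2 e3] : [/\ nvar s2 14 = lo, nvar s2 13 = lo & rarr s2 = rarr s1].
      by rewrite /s2 /= g1.
    clearbody s2; rewrite /I e1 e2 e3; split=> //; first by rewrite leqnn; move: g2 hk; clear; lia.
    by right; split=> //; exact: almost_sorted_stop g5.
  have {}hle : rarr s1 a (nvar s1 13) < rarr s1 a (nvar s1 13).-1 by rewrite ltNge hle.
  set s2 := set_nvar _ _ _.
  have e1 : nvar s2 14 = nvar s1 14 by [].
  have e2 : nvar s2 13 = (nvar s1 13).-1 by [].
  have e3 : rarr s2 a = swap (rarr s1 a) (nvar s1 13).
    by rewrite /= update_same /swap update_same.
  clearbody s2.
  split; last by rewrite e2; move: ht hk; clear; lia.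
  rewrite /I e1 e2 e3; split=> //; first by lia.
  + by move=> j hj; rewrite swapE -subn1; do 2 (case: eqP => [?|_]; first by lia); exact: g3.
  + by apply: rearranged_trans g4 (rearranged_swap _ _); lia.
  + by left; apply: almost_sorted_swap => //; lia.
- move=> s1 t [g1 g2 g3 g4 g5] hk ht.
  have {}hk : nvar s1 13 = lo by move: hk; rewrite /= g1 addn1; lia.
  split=> //; last by move: ht; rewrite hi /=; clear; lia.
  by case: g5 => [|[]] //; rewrite hk; exact: almost_sorted_start.
Qed.

(** Indices cannot be divided, so the start of the current group is tracked in [nvar 14]. *)
Definition c_sort : cmd :=
  (NSetVar 12 (NLit 0) ;; NSetVar 14 (NLit 0)) ;;
  While (NLe (NAdd (NVar 12) (NLit 1)) (NVar 10))
    ((If (NLe (NVar 11) (NSub (NVar 12) (NVar 14))) (NSetVar 14 (NVar 12)) Skip ;;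
      NSetVar 13 (NVar 12)) ;;
     c_insert ;; NSetVar 12 (NAdd (NVar 12) (NLit 1))).

Lemma runs_sort s g N Q : nvar s 10 = N -> nvar s 11 = g -> (0 < g)%N ->
  (forall s' t, agree c_sort s s' -> sorted_groups (rarr s' a) g N ->
     rearranged (rarr s a) N (rarr s' a) -> (t <= (60 * g + 60) * N + 20)%N -> Q s' t) ->
  runs c_sort s Q.
Proof.
move=> hN hg g0 hQ.
suff : runs c_sort s (fun s' t => [/\ sorted_groups (rarr s' a) g N,
     rearranged (rarr s a) N (rarr s' a) & (t <= (60 * g + 60) * N + 20)%N]).
  by move=> /runs_agree h; apply: runs_mono h _ => s' t [ha [h1 h2 h3]]; exact: hQ.
move=> {Q hQ}.
apply: runs_seq; apply: runs_straight => // t0 ht0; have {}ht0 : (t0 <= 4)%N by apply: leq_trans ht0 _.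
set s0 := outcome _ s.
have [e1 e2 e3 [e4 e5]] : [/\ nvar s0 10 = N, nvar s0 11 = g, nvar s0 12 = 0%N &
   nvar s0 14 = 0%N /\ rarr s0 = rarr s] by [].
clearbody s0.
pose I s1 := [/\ nvar s1 10 = N /\ nvar s1 11 = g, (exists q, nvar s1 14 = q * g)%N,
  (nvar s1 14 <= nvar s1 12 <= nvar s1 14 + g)%N /\ (nvar s1 12 <= N)%N,
  sorted_groups (rarr s1 a) g (nvar s1 12) & rearranged (rarr s a) N (rarr s1 a)].
apply: (@runs_while _ _ _ _ I (fun s1 => (60 * g + 60) * (N - nvar s1 12))%N).
- rewrite /I e1 e2 e3 e4 e5; split=> //; first by exists 0%N.
  + by move=> u v; rewrite ltn0 andbF.
  + exact: rearranged_refl.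
- move=> s1 [[g1 g2] [q g3] [g4 g5] g6 g7] hi; have {}hi : (nvar s1 12 < N)%N by move: hi; rewrite /= g1 addn1.
  apply: runs_seq; apply: runs_straight => // t1 ht1; have {}ht1 : (t1 <= 20)%N by apply: leq_trans ht1 _.
  set i := nvar s1 12 in g4 g5 g6 hi *.
  have [q' [hq1 hq2 hq3]] : exists q', [/\ nvar (outcome (If (NLe (NVar 11) (NSub (NVar 12) (NVar 14)))
     (NSetVar 14 (NVar 12)) Skip ;; NSetVar 13 (NVar 12)) s1) 14 = (q' * g)%N, (q' * g <= i)%N & (i < q' * g + g)%N].
    rewrite /= g2 g3 -/i; case: ifP => h.
      by exists q.+1; rewrite /= {1 2}/update /= mulSn; split; lia.
    by exists q; rewrite /= {1}/update /= g3; split; lia.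
  have ha := outcome_agree (c := (If (NLe (NVar 11) (NSub (NVar 12) (NVar 14)))
     (NSetVar 14 (NVar 12)) Skip ;; NSetVar 13 (NVar 12))) s1 erefl.
  have hk : nvar (outcome (If (NLe (NVar 11) (NSub (NVar 12) (NVar 14)))
     (NSetVar 14 (NVar 12)) Skip ;; NSetVar 13 (NVar 12)) s1) 13 = i.
    by rewrite /=; case: ifP.
  move: (outcome _ s1) hq1 ha hk => s2 hq1 ha hk.
  have grp u : (q' * g <= u <= i)%N -> (u %/ g = q')%N.
    by move=> hu; apply/eqP; rewrite eqn_leq leq_divRL // -ltnS ltn_divLR // mulSn; lia.
  have hX : rarr s2 a = rarr s1 a by rewrite (agreeA ha).
  apply: runs_seq; apply: (@runs_insert _ (q' * g)%N i N) => //; first by rewrite hq2.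
    rewrite hX; split=> [u v huv vi _ hv|v]; last by lia.
    by apply: g6; [lia|rewrite !grp //; lia].
  move=> s3 t3 ha3 h1 h2 h3 ht3; apply: runs_straight => // t4 ht4.
  have {}ht4 : (t4 <= 4)%N by apply: leq_trans ht4 _.
  set s4 := outcome _ s3.
  have f1 : nvar s4 12 = i.+1 by rewrite /s4 /= {1}/update /= (agreeN ha3) // (agreeN ha) // addn1.
  have f2 : nvar s4 14 = (q' * g)%N by rewrite /s4 /= {1}/update /= (agreeN ha3).
  have f3 : nvar s4 10 = N by rewrite /s4 /= {1}/update /= (agreeN ha3) // (agreeN ha).
  have f4 : nvar s4 11 = g by rewrite /s4 /= {1}/update /= (agreeN ha3) // (agreeN ha).
  have f5 : rarr s4 = rarr s3 by [].
  clearbody s4.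
  split; last first.
    rewrite f1 -/i; have -> : (N - i = (N - i.+1).+1)%N by lia.
    rewrite mulnS /=; move: ((60 * g + 60) * (N - i.+1))%N => w.
    by move: ht1 ht3 ht4 hq3 hq2; clear; lia.
  rewrite /I f1 f2 f3 f4 f5; split=> //; first by exists q'.
  + by split; lia.
  + move=> u v huv E; have [hv|hv] := leqP (q' * g) v.
      have Ev := grp v; rewrite -E in Ev.
      apply: h1; last by lia.
      have {}Ev : (u %/ g = q')%N by apply: Ev; lia.
      by rewrite -Ev leq_divM; lia.
    by rewrite !h2 ?hX; [apply: g6 => //; lia|lia|lia].
  + by apply: rearranged_trans g7 _; rewrite -hX.
- move=> s1 t1 [[g1 g2] [q g3] [g4 g5] g6 g7] hi ht1.
  have E : nvar s1 12 = N by move: hi; rewrite /= g1 addn1; lia.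
  rewrite E in g6; split=> //.
  move: ht1; rewrite e3 E subnn subn0 muln0 /=; move: (_ * N)%N => w.
  by move: ht0; clear; lia.
Qed.

Definition c_decimate : cmd :=
  (NSetVar 15 (NLit 0) ;; NSetVar 12 (NLit 3)) ;;
  While (NLe (NAdd (NVar 12) (NLit 1)) (NVar 10))
    (RSetArr a (NVar 15) (RGet a (NVar 12)) ;; NSetVar 15 (NAdd (NVar 15) (NLit 1)) ;;
     NSetVar 12 (NAdd (NVar 12) (NLit 4))) ;;
  NSetVar 10 (NVar 15).

Lemma runs_decimate s N Q : nvar s 10 = N ->
  (forall s' t, agree c_decimate s s' -> nvar s' 10 = (N %/ 4)%N ->
     (forall m, (m < N %/ 4)%N -> rarr s' a m = rarr s a (4 * m + 3)%N) ->
     (t <= 40 * N + 40)%N -> Q s' t) ->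
  runs c_decimate s Q.
Proof.
move=> hN hQ.
suff : runs c_decimate s (fun s' t => [/\ nvar s' 10 = (N %/ 4)%N,
     (forall m, (m < N %/ 4)%N -> rarr s' a m = rarr s a (4 * m + 3)%N) &
     (t <= 40 * N + 40)%N]).
  by move=> /runs_agree h; apply: runs_mono h _ => s' t [ha [h1 h2 h3]]; exact: hQ.
move=> {Q hQ}.
apply: runs_seq; apply: runs_straight => // t0 ht0; have {}ht0 : (t0 <= 4)%N by apply: leq_trans ht0 _.
set s0 := outcome _ s.
have [e1 e2 e3 e4] : [/\ nvar s0 10 = N, nvar s0 12 = 3%N, nvar s0 15 = 0%N & rarr s0 = rarr s] by [].
clearbody s0.
(* The reading position [4 * m + 3] stays ahead of the writing position [m], so working in place is
   safe. *)
pose I s1 := [/\ nvar s1 10 = N, nvar s1 12 = (4 * nvar s1 15 + 3)%N, (4 * nvar s1 15 <= N)%N,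
  (forall m, (m < nvar s1 15)%N -> rarr s1 a m = rarr s a (4 * m + 3)%N) &
  (forall m, (nvar s1 15 <= m)%N -> rarr s1 a m = rarr s a m)].
apply: runs_seq; apply: (@runs_while _ _ _ _ I (fun s1 => 40 * (N - nvar s1 15))%N).
- by rewrite /I e1 e2 e3 e4.
- move=> s1 [g1 g2 g3 g4 g5] hi; have {}hi : (4 * nvar s1 15 + 3 < N)%N by move: hi; rewrite /= g1 g2 addn1.
  apply: runs_straight => // t1 ht1; have {}ht1 : (t1 <= 20)%N by apply: leq_trans ht1 _.
  set s2 := outcome _ s1.
  have f1 : nvar s2 15 = (nvar s1 15).+1 by rewrite /s2 /= {1}/update /= {1}/update /= addn1.
  have f2 : nvar s2 12 = (nvar s1 12 + 4)%N by rewrite /s2 /= {1}/update /= {1}/update /=.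
  have f3 : nvar s2 10 = nvar s1 10 by [].
  have f4 : rarr s2 a = update (rarr s1 a) (nvar s1 15) (rarr s1 a (nvar s1 12)).
    by rewrite /s2 /= update_same.
  clearbody s2; split; last by rewrite f1 /=; move: ht1 hi; clear; lia.
  rewrite /I f1 f2 f3 f4; split=> //; [by lia|by lia| |].
  + move=> m; rewrite ltnS leq_eqVlt => /orP[/eqP ->|hm].
      by rewrite update_same g2 g5 //; lia.
    by rewrite update_other ?g4 //; lia.
  + by move=> m hm; rewrite update_other ?g5 //; lia.
- move=> s1 t1 [g1 g2 g3 g4 g5] hi ht1.
  have E : nvar s1 15 = (N %/ 4)%N by move: hi; rewrite /= g1 g2 addn1; lia.
  apply: runs_straight => // t2 ht2; have {}ht2 : (t2 <= 4)%N by apply: leq_trans ht2 _.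
  split.
  + by rewrite /= {1}/update /= E.
  + by rewrite -E; exact: g4.
  + by move: ht0 ht1 ht2; rewrite e3 /=; clear; lia.
Qed.

End Pivot.

Section Pivot.
Context {R : realType}.
Variables a b : nat.
Hypothesis ab : b != a.
Implicit Types (s : state R) (X : nat -> R) (P : pred R).

Definition c_copy : cmd :=
  (NSetVar 10 (NVar 3) ;; NSetVar 11 (NLit 64) ;; NSetVar 12 (NLit 0)) ;;
  While (NLe (NAdd (NVar 12) (NLit 1)) (NVar 3))
    (RSetArr a (NVar 12) (RGet b (NVar 12)) ;; NSetVar 12 (NAdd (NVar 12) (NLit 1))).

Lemma runs_copy s N Q : nvar s 3 = N ->
  (forall s' t, agree c_copy s s' -> nvar s' 10 = N -> nvar s' 11 = 64%N ->
     (forall i, (i < N)%N -> rarr s' a i = rarr s b i) -> (t <= 20 * N + 20)%N -> Q s' t) ->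
  runs c_copy s Q.
Proof.
move=> hN hQ.
suff : runs c_copy s (fun s' t => [/\ nvar s' 10 = N, nvar s' 11 = 64%N,
     (forall i, (i < N)%N -> rarr s' a i = rarr s b i) & (t <= 20 * N + 20)%N]).
  by move=> /runs_agree h; apply: runs_mono h _ => s' t [ha [h1 h2 h3 h4]]; exact: hQ.
move=> {Q hQ}.
apply: runs_seq; apply: runs_straight => // t0 ht0; have {}ht0 : (t0 <= 6)%N by apply: leq_trans ht0 _.
set s0 := outcome _ s.
have [e1 e2 e3 [e4 e5]] : [/\ nvar s0 10 = N, nvar s0 11 = 64%N, nvar s0 12 = 0%N &
   nvar s0 3 = N /\ rarr s0 = rarr s] by rewrite -hN.
clearbody s0.
pose I s1 := [/\ nvar s1 10 = N /\ nvar s1 11 = 64%N, nvar s1 3 = N, rarr s1 b = rarr s b, (nvar s1 12 <= N)%N &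
  (forall i, (i < nvar s1 12)%N -> rarr s1 a i = rarr s b i)].
apply: (@runs_while _ _ _ _ I (fun s1 => 20 * (N - nvar s1 12))%N).
- by rewrite /I e1 e2 e3 e4 e5.
- move=> s1 [[g1 g2] g3 g4 g5 g6] hi; have {}hi : (nvar s1 12 < N)%N by move: hi; rewrite /= g3 addn1.
  apply: runs_straight => // t1 ht1; have {}ht1 : (t1 <= 12)%N by apply: leq_trans ht1 _.
  set s2 := outcome _ s1.
  have [f1 f2 f3 f4] : [/\ nvar s2 12 = (nvar s1 12).+1, nvar s2 10 = N, nvar s2 11 = 64%N & nvar s2 3 = N].
    by rewrite /s2 /= {1}/update /= addn1.
  have f5 : rarr s2 b = rarr s b by rewrite /s2 /= update_other.
  have f6 : rarr s2 a = update (rarr s1 a) (nvar s1 12) (rarr s b (nvar s1 12)).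
    by rewrite /s2 /= update_same g4.
  clearbody s2; split; last by rewrite f1 /=; move: ht1 hi; clear; lia.
  rewrite /I f1 f2 f3 f4 f5 f6; split=> // i; rewrite ltnS leq_eqVlt => /orP[/eqP ->|hm].
    by rewrite update_same.
  by rewrite update_other ?g6 //; lia.
- move=> s1 t1 [[g1 g2] g3 g4 g5 g6] hi ht1.
  have E : nvar s1 12 = N by move: hi; rewrite /= g3 addn1; lia.
  rewrite E in g6; split=> //; move: ht0 ht1; rewrite e3 /=; clear; lia.
Qed.

Definition c_half : cmd :=
  NSetVar 12 (NLit 0) ;;
  While (NLe (NAdd (NAdd (NVar 12) (NVar 12)) (NLit 2)) (NVar 10)) (NSetVar 12 (NAdd (NVar 12) (NLit 1))) ;;
  RSetVar 9 (RGet a (NVar 12)).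

Lemma runs_half s N Q : nvar s 10 = N ->
  (forall s' t, agree c_half s s' -> rvar s' 9 = rarr s a N./2 -> (t <= 20 * N + 20)%N -> Q s' t) ->
  runs c_half s Q.
Proof.
move=> hN hQ.
suff : runs c_half s (fun s' t => rvar s' 9 = rarr s a N./2 /\ (t <= 20 * N + 20)%N).
  by move=> /runs_agree h; apply: runs_mono h _ => s' t [ha [h1 h2]]; exact: hQ.
move=> {Q hQ}; have hh := odd_double_half N.
apply: runs_seq; apply: runs_straight => // t0 ht0; have {}ht0 : (t0 <= 2)%N by apply: leq_trans ht0 _.
set s0 := outcome _ s.
have [e1 e2 e3] : [/\ nvar s0 10 = N, nvar s0 12 = 0%N & rarr s0 = rarr s] by [].
clearbody s0.
pose I s1 := [/\ nvar s1 10 = N, rarr s1 = rarr s & (2 * nvar s1 12 <= N)%N].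
apply: runs_seq; apply: (@runs_while _ _ _ _ I (fun s1 => 20 * (N - nvar s1 12))%N).
- by rewrite /I e1 e2 e3.
- move=> s1 [g1 g2 g3] hi; have {}hi : (2 * nvar s1 12 + 2 <= N)%N by move: hi; rewrite /= g1; lia.
  apply: runs_straight => // t1 ht1; have {}ht1 : (t1 <= 6)%N by apply: leq_trans ht1 _.
  set s2 := outcome _ s1.
  have [f1 f2 f3] : [/\ nvar s2 12 = (nvar s1 12).+1, nvar s2 10 = N & rarr s2 = rarr s].
    by rewrite /s2 /= {1}/update /= addn1.
  clearbody s2; split; last by rewrite f1 /=; move: ht1 hi; clear; lia.
  by rewrite /I f1 f2 f3; split=> //; lia.
- move=> s1 t1 [g1 g2 g3] hi ht1.
  have E : nvar s1 12 = N./2 by move: hi; rewrite /= g1; lia.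
  apply: runs_straight => // t2 ht2; have {}ht2 : (t2 <= 4)%N by apply: leq_trans ht2 _.
  split; last by move: ht0 ht1 ht2; rewrite e2 /=; clear; lia.
  by rewrite /= g2 E.
Qed.

Definition c_pivot : cmd :=
  c_copy ;;
  While (NLe (NAdd (NVar 11) (NLit 1)) (NVar 10))
    (c_sort a ;; c_decimate a ;; NSetVar 11 (NAdd (NVar 11) (NVar 11))) ;;
  c_sort a ;; c_half.

(* Every element of the sample [Y] stands for [k] elements of [X].  With groups of size [g] doubling, a
   later error of at most [12 * N / g] in total is still to come, whence the bound on [g * err]. *)
Definition sampled X N Y M g := exists k err : nat,
  [/\ (0 < k)%N /\ (k * M <= N)%N, (forall P, lower_closed P -> (k * tallyn P Y M <= tallyn P X N <= k * tallyn P Y M + err)%N),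
   (64 * (g * err) + 768 * N <= 12 * (g * N))%N & among Y M X N].

Lemma sampled_rearranged X N Y M Z g : sampled X N Y M g -> rearranged Y M Z -> sampled X N Z M g.
Proof.
move=> [k [err [h1 h2 h3 h4]]] [h5 h6]; exists k, err; split=> //.
  by move=> P dP; rewrite h5; exact: h2.
exact: among_trans h4.
Qed.

(** For groups of size [G = 4 * g] the new error is [3 * k * (1 + M %/ G)], at most [6 * N / G]
    because [G <= M] and [k * M <= N]. This is [12 * N / G - 12 * N / (2 * G)], exactly what the
    bound allows when [G] doubles. *)
Lemma sampled_decimate X N Y M Z g : (0 < g)%N -> (4 * g <= M)%N ->
  sampled X N Y M (4 * g) -> sorted_groups Y (4 * g) M ->
  (forall m, (m < M %/ 4)%N -> Z m = Y (4 * m + 3)%N) -> sampled X N Z (M %/ 4) (2 * (4 * g)).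
Proof.
move=> g0 hM [k [err [[k0 h1] h2 h3 h4]]] hY hZ.
have hd := divn_eq M 4; have hd' := leq_divM M (4 * g).
exists (4 * k)%N, (err + k * (3 * (1 + M %/ (4 * g))))%N; split.
- split; first by rewrite muln_gt0 k0.
  by apply: leq_trans h1; rewrite -mulnA mulnCA leq_mul2l mulnC leq_divM orbT.
- move=> P dP; have [g1 g2] := tally_decimate dP g0 hY hZ; have /andP[g3 g4] := h2 P dP.
  move: g1 g2 g3 g4; move: (tallyn P Z _) (tallyn P Y _) (tallyn P X _) => z y x g1 g2 g3 g4.
  move: g2; move: (3 * (1 + _))%N => w g2.
  have g5 : (k * (4 * z) <= k * y)%N by rewrite leq_mul2l g1 orbT.
  have g6 : (k * y <= k * (4 * z + w))%N by rewrite leq_mul2l g2 orbT.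
  have -> : (4 * k * z = k * (4 * z))%N by rewrite -mulnA mulnCA.
  rewrite mulnDr in g6; move: g3 g4 g5 g6; clear.
  by move: (k * (4 * z))%N => z'; move: (k * w)%N (k * y)%N => *; lia.
- move: hM hd' h3; set G := (4 * g)%N; set q := (M %/ G)%N => hM hd' h3.
  have g1 : (k * (G * (1 + q)) <= k * (2 * M))%N.
    by rewrite leq_mul2l mulnDr muln1 mul2n -addnn leq_add ?orbT // mulnC.
  have g2 : (k * (2 * M) <= 2 * N)%N by rewrite mulnCA leq_mul2l h1 orbT.
  have -> : (2 * G * (err + k * (3 * (1 + q))) = 2 * (G * err) + 6 * (k * (G * (1 + q))))%N by ring.
  have -> : (2 * G * N = 2 * (G * N))%N by rewrite mulnA.
  move: g1 g2 h3; clear.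
  move: (k * (G * _))%N => w; move: (k * _)%N (G * err)%N (G * N)%N => *; lia.
- apply: among_trans h4 => m hm; exists (4 * m + 3)%N; last exact: hZ.
  by move: hm hd; clear; lia.
Qed.

(** The error is at most [3 * N / 16], and with it the part of [N] not represented by the sample.
    The median of the sample thus has at most [N / 2 + 3 * N / 16 <= 3 * N / 4] values below it, and
    at least [13 * N / 32 >= N / 4] up to it. *)
Lemma sampled_middle X N Y M g : (0 < g)%N -> (0 < M)%N -> sampled X N Y M g -> sorted_on Y 0 M.-1 ->
  let mu := Y M./2 in
  [/\ (4 * tallyn (fun x => (x < mu)%R) X N <= 3 * N)%N,
      (N <= 4 * tallyn (fun x => (x <= mu)%R) X N)%N & exists2 k, (k < N)%N & mu = X k].
Proof.
move=> g0 M0 [k [err [[k0 h1] h2 h3 h4]]] hY mu.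
have [g1 g2] := tally_middle M0 hY.
have herr : (16 * err <= 3 * N)%N by rewrite -(leq_pmul2l g0); move: h3; clear; nia.
have d1 : lower_closed (fun x => x < mu) by move=> x y xy; exact: le_lt_trans.
have d2 : lower_closed (fun x => x <= mu) by move=> x y xy; exact: le_trans.
have dT : lower_closed (fun _ : R => true) by [].
have /andP[_ k1] := h2 _ d1; have /andP[k2 _] := h2 _ d2; have /andP[_ k3] := h2 _ dT.
rewrite !tally_all in k3.
split.
- move: g1 k1 h1 herr; rewrite -/mu; move: (tallyn _ _ _) (tallyn _ _ _) => x y g1 k1 h1 herr.
  have : (k * (2 * y) <= k * M)%N by rewrite leq_mul2l g1 orbT.
  by rewrite mulnCA; move: k1 h1 herr; clear; move: (k * _)%N (k * _)%N => *; lia.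
- move: g2 k2 k3 h1 herr; rewrite -/mu; move: (tallyn _ _ _) (tallyn _ _ _) => x y g2 k2 k3 h1 herr.
  have : (k * M <= k * (2 * y))%N by rewrite leq_mul2l g2 orbT.
  by rewrite mulnCA; move: k2 k3 h1 herr; clear; move: (k * _)%N (k * _)%N => *; lia.
- by apply: h4; lia.
Qed.

Lemma runs_pivot s N Q : nvar s 3 = N -> (0 < N)%N ->
  (forall s' t, agree c_pivot s s' ->
     (4 * tallyn (fun x => (x < rvar s' 9)%R) (rarr s b) N <= 3 * N)%N ->
     (N <= 4 * tallyn (fun x => (x <= rvar s' 9)%R) (rarr s b) N)%N ->
     (exists2 k, (k < N)%N & rvar s' 9 = rarr s b k) -> (t <= 20 * (1000 * N))%N -> Q s' t) ->
  runs c_pivot s Q.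
Proof.
move=> hN N0 hQ; set X := rarr s b.
suff : runs c_pivot s (fun s' t => [/\ (4 * tallyn (fun x => (x < rvar s' 9)%R) X N <= 3 * N)%N,
     (N <= 4 * tallyn (fun x => (x <= rvar s' 9)%R) X N)%N,
     (exists2 k, (k < N)%N & rvar s' 9 = rarr s b k) & (t <= 20 * (1000 * N))%N]).
  by move=> /runs_agree h; apply: runs_mono h _ => s' t [ha [h1 h2 h3 h4]]; exact: hQ.
move=> {Q hQ}.
apply: runs_seq; apply: (runs_copy hN) => s0 t0 _ e1 e2 e3 ht0.
pose I s1 := exists g, [/\ nvar s1 11 = (4 * g)%N, (16 <= g)%N, (0 < nvar s1 10)%N &
  sampled X N (rarr s1 a) (nvar s1 10) (4 * g)].
(* Sorting takes time of order group size times length. A round doubles the former and quarters the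
   latter, so the product is at least halved. *)
apply: runs_seq; apply: (@runs_while _ _ _ _ I (fun s1 => 200 * (nvar s1 11 * nvar s1 10))%N).
(* The full array is an exact sample of itself; the initial group size 64 meets the error bound with
   equality, [768 = 12 * 64]. *)
- exists 16%N; rewrite e1 e2; split=> //; exists 1%N, 0%N; rewrite mul1n; split=> //; last first.
  + by move=> i hi; exists i => //; exact: e3.
  + by lia.
  + by move=> P _; rewrite mul1n addn0 (tally_eq P e3) leqnn.
- move=> s1 [g [g1 g2 g3 g4]] hg.
  set M := nvar s1 10 in g3 g4 *; have {}hg : (4 * g < M)%N by move: hg; rewrite /= g1 addn1.
  have gg : (0 < 4 * g)%N by lia.
  apply: runs_seq; apply: (runs_sort erefl g1 gg) => s2 t2 ha2 h1 h2 ht2.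
  apply: runs_seq; have hM : nvar s2 10 = M by rewrite (agreeN ha2).
  apply: (runs_decimate hM) => s3 t3 ha3 h3 h4 ht3.
  apply: runs_straight => // t4 ht4; have {}ht4 : (t4 <= 4)%N by apply: leq_trans ht4 _.
  set s4 := outcome _ s3.
  have [f1 f2 f3] : [/\ nvar s4 11 = (2 * (4 * g))%N, nvar s4 10 = (M %/ 4)%N & rarr s4 = rarr s3].
    by rewrite /s4 /= {1}/update /= (agreeN ha3) // (agreeN ha2) // g1; split=> //; lia.
  clearbody s4; split; last first.
    rewrite f1 f2 g1 -/M; have hd : (M %/ 4 * 4 <= M)%N by exact: leq_divM.
    move: ht2 ht3 ht4 hg g2 hd; rewrite -/M /=; clear; move: (M %/ 4)%N => m ht2 ht3 ht4 hg g2 hd.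
    have k1 : (g * (m * 4) <= g * M)%N by rewrite leq_mul2l hd orbT.
    have k2 : (16 * M <= g * M)%N by rewrite leq_mul2r g2 orbT.
    rewrite mulnDl in ht2.
    have {}ht2 : (t2 <= 240 * (g * M) + 60 * M + 20)%N by apply: leq_trans ht2 _; rewrite -mulnA -mulnA; lia.
    have -> : (200 * (2 * (4 * g) * m) = 400 * (g * (m * 4)))%N by ring.
    have -> : (200 * (4 * g * M) = 800 * (g * M))%N by ring.
    by move: k1 k2 ht2 ht3 ht4 hg g2; move: (g * _)%N (g * _)%N => *; lia.
  exists (2 * g)%N; rewrite f1 f2 f3; split.
  + by lia.
  + by lia.
  + by rewrite divn_gt0 //; lia.
  + have -> : (4 * (2 * g) = 2 * (4 * g))%N by lia.
    apply: (@sampled_decimate X N (rarr s2 a)) => //; [by lia|by lia|].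
    exact: sampled_rearranged g4 h2.
- move=> s1 t1 [g [g1 g2 g3 g4]] hg ht1.
  set M := nvar s1 10 in g3 g4 hg *; have {}hg : (M <= 4 * g)%N by move: hg; rewrite /= g1 addn1 -leqNgt.
  have gg : (0 < 4 * g)%N by lia.
  apply: runs_seq; apply: (runs_sort erefl g1 gg) => s2 t2 ha2 h1 h2 ht2.
  have hM : nvar s2 10 = M by rewrite (agreeN ha2).
  apply: (runs_half hM) => s3 t3 ha3 -> ht3.
  have [|k1 k2 k3] := sampled_middle gg g3 (sampled_rearranged g4 h2).
    by move=> u v huv hv; apply: h1; [lia|rewrite !divn_small //; lia].
  split=> //.
  have hMN : (M <= N)%N.
    have [k [err [[k0 k4] _ _ _]]] := g4.
    by apply: leq_trans k4; rewrite leq_pmull.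
  move: ht0 ht1 ht2 ht3 hMN; rewrite e1 e2 g1 -/M /=; clear -N0; move=> ht0 ht1 ht2 ht3 hMN.
  have {}ht2 : (t2 <= 60 * (4 * g * M) + 60 * M + 20)%N by apply: leq_trans ht2 _; rewrite mulnDl -[(60 * (4 * g) * M)%N]mulnA.
  by move: ht0 ht1 ht2 ht3 hMN N0; move: (4 * g * M)%N => w; lia.
Qed.

End Pivot.

(** * Searching a level below the average *)

Section Search.
Context {R : realType}.
Implicit Types (ev : seq (R * R)) (T W : nat -> R).

Definition events T W n : seq (R * R) := [seq (T i, W i) | i <- iota 0 n].

Lemma eventsS T W n : events T W n.+1 = rcons (events T W n) (T n, W n).
Proof. by rewrite /events -addn1 iotaD map_cat cats1 add0n. Qed.

Lemma eq_events T W T' W' n : (forall i, (i < n)%N -> T i = T' i /\ W i = W' i) ->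
  events T W n = events T' W' n.
Proof. by move=> h; apply/eq_in_map => i; rewrite mem_iota => /h[-> ->]. Qed.

Lemma size_events T W n : size (events T W n) = n.
Proof. by rewrite size_map size_iota. Qed.

Lemma count_events (p : pred R) T W n : count (fun e => p e.1) (events T W n) = tallyn p T n.
Proof.
elim: n => [|n IH]; first by rewrite /tallyn big_geq.
by rewrite eventsS -cats1 count_cat IH tallyS /= addn0.
Qed.

(* On the remaining levels [[A, U[] the counting function is the constant [c] plus the contribution
   of the remaining events, and its average is at most [Bd]. *)
Record search_inv ev0 L Bd A U c ev : Prop := SearchInv {
  search_region : 0 <= A < U /\ U <= L;
  search_range : forall e, e \in ev -> A <= e.1 < U;
  search_cov : forall x, A <= x < U -> cov ev0 x = c + cov ev x;
  search_area : c * (U - A) + area U ev <= Bd * (U - A) }.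

Lemma search_done ev0 L Bd A U c : search_inv ev0 L Bd A U c [::] -> 0 <= A < L /\ cov ev0 A <= Bd.
Proof.
move=> [[/andP[h1 h2] h3] _ h4 h5]; split; first by rewrite h1; exact: lt_le_trans h3.
rewrite h4 ?lexx // /cov big_nil addr0; move: h5; rewrite /area big_nil addr0.
by rewrite ler_pM2r // subr_gt0.
Qed.

(** The integral of the counting function over [[A, mu]]. *)
Definition weighed mu A c ev : R := c * (mu - A) + \sum_(e <- ev | e.1 < mu) e.2 * (mu - e.1).

(** The mean over [[A, U]] is at most [Bd], so it is at most [Bd] on one side of [mu]. This lemma
    and the next keep such a side. *)
Lemma search_left ev0 L Bd A U c ev mu : A <= mu < U -> weighed mu A c ev < Bd * (mu - A) ->
  search_inv ev0 L Bd A U c ev -> search_inv ev0 L Bd A mu c [seq e <- ev | ~~ (mu <= e.1)].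
Proof.
move=> /andP[hA hU] hF [[/andP[h1 h2] h3] h4 h5 h6].
have E (e : R * R) : (~~ (mu <= e.1)) = (e.1 < mu) by rewrite ltNge.
(* The strict inequality rules out an empty interval, over which both sides vanish. *)
have Amu : A < mu.
  rewrite lt_neqAle hA andbT; apply/eqP => Emu; move: hF; rewrite /weighed -Emu subrr !mulr0 add0r.
  rewrite big_seq_cond big1 ?ltxx // => e /andP[/h4/andP[he _]]; rewrite ltNge he //.
split.
- by rewrite h1 Amu; split=> //; exact: ltW (lt_le_trans hU h3).
- by move=> e; rewrite mem_filter E => /andP[he /h4/andP[-> _]].
- move=> x /andP[x1 x2]; rewrite h5 ?x1 ?(lt_trans x2) //; congr (_ + _).
  rewrite /cov big_filter_cond; apply: eq_bigl => e; rewrite E.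
  by case: (leP e.1 x) => hx; rewrite ?andbF // (le_lt_trans hx).
- rewrite /area big_filter (eq_bigl _ _ E); exact: ltW.
Qed.

(** Events at [mu] itself have already jumped at the left end of the new interval and are absorbed
    into the constant. *)
Lemma search_right ev0 L Bd A U c ev mu : A <= mu < U -> Bd * (mu - A) <= weighed mu A c ev ->
  search_inv ev0 L Bd A U c ev ->
  search_inv ev0 L Bd mu U (c + \sum_(e <- ev | e.1 <= mu) e.2) [seq e <- ev | ~~ (e.1 <= mu)].
Proof.
move=> /andP[hA hU] hF [[/andP[h1 h2] h3] h4 h5 h6].
have E (e : R * R) : (~~ (e.1 <= mu)) = (mu < e.1) by rewrite ltNge.
split.
- by rewrite hU (le_trans h1).
- by move=> e; rewrite mem_filter E => /andP[/ltW -> /h4/andP[_ ->]].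
- move=> x /andP[x1 x2]; rewrite h5 ?x2 ?(le_trans hA) // -addrA; congr (_ + _).
  rewrite /cov big_filter_cond (bigID (fun e => e.1 <= mu)) /=; congr (_ + _); apply: eq_bigl => e.
    by case: (leP e.1 mu) => he; rewrite ?andbF // (le_trans he).
  by rewrite andbC.
- have hs : area U ev = (\sum_(e <- ev | e.1 < mu) e.2 * (mu - e.1)) +
      (\sum_(e <- ev | e.1 <= mu) e.2) * (U - mu) + area U [seq e <- ev | ~~ (e.1 <= mu)].
    rewrite /area big_filter [LHS](bigID (fun e => e.1 <= mu)) /=; congr (_ + _).
    rewrite mulr_suml big_mkcond [X in _ = X + _]big_mkcond [X in _ = _ + X]big_mkcond -big_split /=.
    apply: eq_bigr => e _; case: (ltgtP e.1 mu) => he; [ring|by rewrite addr0|by rewrite he; ring].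
  rewrite hs in h6; move: h6 hF; rewrite /weighed.
  set a1 := \sum_(_ <- _ | _) _; set a2 := \sum_(_ <- _ | _) _; set a3 := area _ _.
  have -> : Bd * (U - A) = Bd * (U - mu) + Bd * (mu - A) by ring.
  have -> : c * (U - A) = c * (U - mu) + c * (mu - A) by ring.
  rewrite mulrDl; lra.
Qed.

End Search.

(** * The prune and search program *)

Section SearchProgram.
Context {R : realType}.
Variable D : nat.
Implicit Types (s : state R).
Local Notation evs := (evs D).

Lemma evsE s : evs s = events (rarr s D) (rarr s D.+1) (nvar s 3).
Proof. by []. Qed.

Definition c_weigh : cmd :=
  (NSetVar 12 (NLit 0) ;; RSetVar 15 (RMul (RVar 13) (RSub (RVar 9) (RVar 11)))) ;;
  While (NLe (NAdd (NVar 12) (NLit 1)) (NVar 3))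
    (If (RLe (RVar 9) (RGet D (NVar 12))) Skip
       (RSetVar 15 (RAdd (RVar 15) (RMul (RGet D.+1 (NVar 12)) (RSub (RVar 9) (RGet D (NVar 12)))))) ;;
     NSetVar 12 (NAdd (NVar 12) (NLit 1))).

Lemma runs_weigh s Q :
  (forall s' t, agree c_weigh s s' -> rvar s' 15 = weighed (rvar s 9) (rvar s 11) (rvar s 13) (evs s) ->
     (t <= 40 * nvar s 3 + 40)%N -> Q s' t) ->
  runs c_weigh s Q.
Proof.
move=> hQ; set w := weighed _ _ _ _ in hQ; set N := nvar s 3 in hQ.
suff : runs c_weigh s (fun s' t => rvar s' 15 = w /\ (t <= 40 * N + 40)%N).
  by move=> /runs_agree h; apply: runs_mono h _ => s' t [ha [h1 h2]]; exact: hQ.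
move=> {hQ}.
apply: runs_seq; apply: runs_straight => // t0 ht0; have {}ht0 : (t0 <= 12)%N by apply: leq_trans ht0 _.
set s0 := outcome _ s.
pose I s1 := [/\ rarr s1 = rarr s, nvar s1 3 = N, rvar s1 9 = rvar s 9, (nvar s1 12 <= N)%N &
  rvar s1 15 = weighed (rvar s 9) (rvar s 11) (rvar s 13) (events (rarr s D) (rarr s D.+1) (nvar s1 12))].
apply: (@runs_while _ _ _ _ I (fun s1 => 40 * (N - nvar s1 12))%N).
- by rewrite /I /s0 /=; split=> //; rewrite /weighed big_nil addr0.
- move=> s1 [g1 g2 g3 g4 g5] hi; have {}hi : (nvar s1 12 < N)%N by move: hi; rewrite /= g2 addn1.
  apply: runs_straight => // t1 ht1; have {}ht1 : (t1 <= 30)%N by apply: leq_trans ht1 _.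
  set s2 := outcome _ s1.
  have f1 : nvar s2 12 = (nvar s1 12).+1 by rewrite /s2 /=; case: ifP => _; rewrite /= {1}/update /= addn1.
  have f2 : nvar s2 3 = nvar s1 3 by rewrite /s2 /=; case: ifP.
  have f3 : rarr s2 = rarr s1 by rewrite /s2 /=; case: ifP.
  have f4 : rvar s2 9 = rvar s1 9 by rewrite /s2 /=; case: ifP.
  have f5 : rvar s2 15 = if rvar s1 9 <= rarr s1 D (nvar s1 12) then rvar s1 15 else
      rvar s1 15 + rarr s1 D.+1 (nvar s1 12) * (rvar s1 9 - rarr s1 D (nvar s1 12)).
    by rewrite /s2 /=; case: ifP.
  clearbody s2; split; last by rewrite f1 /=; move: ht1 hi; clear; lia.
  rewrite /I f1 f2 f3 f4 f5 g1 g3 g5 eventsS; split=> //.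
  rewrite /weighed -cats1 big_cat big_cons big_nil /= addrA; case: leP => h; last by rewrite addr0.
  by rewrite addr0.
- move=> s1 t1 [g1 g2 g3 g4 g5] hi ht1.
  have E : nvar s1 12 = N by move: hi; rewrite /= g2 addn1; lia.
  rewrite E in g5; split=> //; move: ht0 ht1; rewrite /s0 /=; clear; lia.
Qed.

Definition c_filter (b : test) : cmd :=
  (NSetVar 12 (NLit 0) ;; NSetVar 15 (NLit 0) ;; RSetVar 16 (RLit 0)) ;;
  While (NLe (NAdd (NVar 12) (NLit 1)) (NVar 3))
    (If b (RSetVar 16 (RAdd (RVar 16) (RGet D.+1 (NVar 12))))
       (RSetArr D (NVar 15) (RGet D (NVar 12)) ;; RSetArr D.+1 (NVar 15) (RGet D.+1 (NVar 12)) ;;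
        NSetVar 15 (NAdd (NVar 15) (NLit 1))) ;;
     NSetVar 12 (NAdd (NVar 12) (NLit 1))) ;;
  NSetVar 3 (NVar 15).

Lemma runs_filter b (p : R -> R -> bool) s Q : (tcost b <= 10)%N ->
  (forall s1 : state R, teval s1 b = p (rvar s1 9) (rarr s1 D (nvar s1 12))) ->
  (forall s' t, agree (c_filter b) s s' -> evs s' = [seq e <- evs s | ~~ p (rvar s 9) e.1] ->
     rvar s' 16 = \sum_(e <- evs s | p (rvar s 9) e.1) e.2 ->
     (t <= 60 * nvar s 3 + 60)%N -> Q s' t) ->
  runs (c_filter b) s Q.
Proof.
move=> hb hp hQ; set N := nvar s 3 in hQ; set mu := rvar s 9 in hQ.
suff : runs (c_filter b) s (fun s' t => [/\ evs s' = [seq e <- evs s | ~~ p mu e.1],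
     rvar s' 16 = \sum_(e <- evs s | p mu e.1) e.2 & (t <= 60 * N + 60)%N]).
  by move=> /runs_agree h; apply: runs_mono h _ => s' t [ha [h1 h2 h3]]; exact: hQ.
move=> {hQ}.
apply: runs_seq; apply: runs_straight => // t0 ht0; have {}ht0 : (t0 <= 6)%N by apply: leq_trans ht0 _.
set s0 := outcome _ s; set T := rarr s D; set W := rarr s D.+1.
(* Kept events are written at or before the reading position, so the unread ones are intact. *)
pose I s1 := [/\ nvar s1 3 = N, rvar s1 9 = mu, (nvar s1 15 <= nvar s1 12 <= N)%N,
  (forall i, (nvar s1 12 <= i)%N -> rarr s1 D i = T i /\ rarr s1 D.+1 i = W i) &
  events (rarr s1 D) (rarr s1 D.+1) (nvar s1 15) = [seq e <- events T W (nvar s1 12) | ~~ p mu e.1] /\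
  rvar s1 16 = \sum_(e <- events T W (nvar s1 12) | p mu e.1) e.2].
apply: runs_seq; apply: (@runs_while _ _ _ _ I (fun s1 => 60 * (N - nvar s1 12))%N).
- by rewrite /I /s0 /=; split=> //; rewrite big_nil.
- move=> s1 [g1 g2 g3 g4 [g5 g6]] hi; have {}hi : (nvar s1 12 < N)%N by move: hi; rewrite /= g1 addn1.
  apply: runs_straight => // t1 ht1; have {}ht1 : (t1 <= 40)%N.
    by apply: leq_trans ht1 _; rewrite /= addnS; move: hb; clear; lia.
  set s2 := outcome _ s1.
  have hpi := hp s1; have [gT gW] := g4 _ (leqnn _); rewrite gT g2 in hpi.
  have f1 : nvar s2 12 = (nvar s1 12).+1 by rewrite /s2 /=; case: ifP => _; rewrite /= {1}/update /= addn1.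
  have f2 : nvar s2 3 = nvar s1 3 by rewrite /s2 /=; case: ifP.
  have f4 : rvar s2 9 = rvar s1 9 by rewrite /s2 /=; case: ifP.
  have f3 : [/\ rarr s2 D = (if teval s1 b then rarr s1 D else update (rarr s1 D) (nvar s1 15) (T (nvar s1 12))),
      rarr s2 D.+1 = (if teval s1 b then rarr s1 D.+1 else update (rarr s1 D.+1) (nvar s1 15) (W (nvar s1 12))),
      nvar s2 15 = (if teval s1 b then nvar s1 15 else (nvar s1 15).+1) &
      rvar s2 16 = (if teval s1 b then rvar s1 16 + W (nvar s1 12) else rvar s1 16)].
    have n1 : D != D.+1 by lia.
    have n2 : D.+1 != D by lia.
    rewrite /s2 /=; case: ifP => _ /=; first by rewrite -gW.
    by rewrite (update_other _ _ n1) !update_same (update_other _ _ n2) -gT -gW addn1.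
  move: f3; rewrite hpi; clearbody s2 => -[f5 f6 f7 f8].
  split; last by rewrite f1 /=; move: ht1 hi; clear; lia.
  rewrite /I f1 f2 f4 f5 f6 f7 f8 eventsS -cats1 filter_cat big_cat big_cons big_nil /=; case: ifP => hh /=.
    rewrite cats0 addr0 g6; split=> //; first by move: g3 hi; clear; lia.
    by move=> i hi'; apply: g4; exact: ltnW.
  rewrite addr0 g6; split=> //; first by move: g3 hi; clear; lia.
    by move=> i hi'; rewrite !update_other; [apply: g4; exact: ltnW|move: g3 hi'; clear; lia|move: g3 hi'; clear; lia].
  split=> //; rewrite eventsS !update_same -cats1 -g5; congr (_ ++ _); apply: eq_events => i hi'.
  by rewrite !update_other //; move: hi'; clear; lia.
- move=> s1 t1 [g1 g2 g3 g4 [g5 g6]] hi ht1.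
  have E : nvar s1 12 = N by move: hi; rewrite /= g1 addn1; lia.
  rewrite E in g5 g6; apply: runs_straight => // t2 ht2; have {}ht2 : (t2 <= 4)%N by apply: leq_trans ht2 _.
  split=> //.
  by move: ht0 ht1 ht2; rewrite /s0 /=; clear; lia.
Qed.

Definition c_search : cmd :=
  (RSetVar 11 (RLit 0) ;; RSetVar 12 (RVar 2) ;; RSetVar 13 (RLit 0)) ;;
  While (NLe (NLit 1) (NVar 3))
    (c_pivot (D + 2) D ;; c_weigh ;;
     If (RLe (RMul (RVar 14) (RSub (RVar 9) (RVar 11))) (RVar 15))
       (c_filter (RLe (RGet D (NVar 12)) (RVar 9)) ;;
        RSetVar 11 (RVar 9) ;; RSetVar 13 (RAdd (RVar 13) (RVar 16)))
       (c_filter (RLe (RVar 9) (RGet D (NVar 12))) ;; RSetVar 12 (RVar 9))).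

Lemma runs_if (b : test) c1 c2 s Q :
  (teval s b -> runs c1 s (fun s' t => Q s' (tcost b + t).+1)) ->
  (~~ teval s b -> runs c2 s (fun s' t => Q s' (tcost b + t).+1)) -> runs (If b c1 c2) s Q.
Proof.
move=> h1 h2; have [hb|hb] := boolP (teval s b).
  by have [s' [t [h3 h4]]] := h1 hb; exists s', (tcost b + t).+1; split=> //; exact: ExecIfTrue.
by have [s' [t [h3 h4]]] := h2 hb; exists s', (tcost b + t).+1; split=> //; exact: ExecIfFalse.
Qed.

(** Either branch keeps at most three quarters of the events, since the events at the pivot are
    dropped in both. The second alternative of the invariant covers [L = 0]: there are no events
    then, and 0 is returned. *)
Lemma runs_search s L Bd Q : rvar s 2 = L -> rvar s 14 = Bd -> 0 <= L ->
  (forall e, e \in evs s -> 0 <= e.1 < L) -> area L (evs s) <= Bd * L ->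
  (forall s' t, agree c_search s s' -> 0 <= rvar s' 11 <= L ->
     (0 < L -> rvar s' 11 < L /\ cov (evs s) (rvar s' 11) <= Bd) ->
     (t <= 100 * (1000 * nvar s 3) + 50)%N -> Q s' t) ->
  runs c_search s Q.
Proof.
move=> hL hBd L0 hev hA hQ; set N := nvar s 3 in hQ; set ev0 := evs s in hev hA hQ.
suff : runs c_search s (fun s' t => [/\ 0 <= rvar s' 11 <= L,
     (0 < L -> rvar s' 11 < L /\ cov ev0 (rvar s' 11) <= Bd) & (t <= 100 * (1000 * N) + 50)%N]).
  by move=> /runs_agree h; apply: runs_mono h _ => s' t [ha [h1 h2 h3]]; exact: hQ.
move=> {hQ}.
apply: runs_seq; apply: runs_straight => // t0 ht0; have {}ht0 : (t0 <= 6)%N by apply: leq_trans ht0 _.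
set s0 := outcome _ s.
pose I s1 := rvar s1 14 = Bd /\ 
  ((0 < L /\ search_inv ev0 L Bd (rvar s1 11) (rvar s1 12) (rvar s1 13) (evs s1)) \/
   [/\ L = 0, nvar s1 3 = 0%N & rvar s1 11 = 0]).
(* An iteration frees a quarter of the potential, [25 * (1000 * N)] for [N] events, of which the
   pivot takes at most [20 * (1000 * N)]. *)
apply: (@runs_while _ _ _ _ I (fun s1 => 100 * (1000 * nvar s1 3))%N).
- split=> //; have [Lp|Ln] := ltP 0 L.
    left; split=> //; have -> : evs s0 = ev0 by [].
    have [-> -> ->] : [/\ rvar s0 11 = 0, rvar s0 12 = L & rvar s0 13 = 0] by rewrite -hL.
    split=> //; [by rewrite !lexx Lp|by move=> x _; rewrite add0r|by rewrite mul0r add0r subr0].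
  right; have {}Ln : L = 0 by lra.
  split=> //; rewrite -[nvar s0 3]/N -(size_events (rarr s D) (rarr s D.+1) N).
  case E : (events _ _ _) => [//|e l]; have := hev e; rewrite /ev0 evsE E mem_head => /(_ isT).
  by rewrite Ln => /andP[e1 e2]; have := le_lt_trans e1 e2; rewrite ltxx.
- move=> s1 [g1 [[Lp g2]|[_ g2 _]]] hN; last by move: hN; rewrite /= g2.
  have {}hN : (0 < nvar s1 3)%N by [].
  have D2 : D != (D + 2)%N by lia.
  apply: runs_seq; apply: (runs_pivot D2 (erefl (nvar s1 3)) hN) => s2 t2 ha2 h1 h2 [k hk h3] ht2.
  have mD : D \notin mod_rarr (c_pivot (D + 2) D) by rewrite !inE; lia.
  have mD1 : D.+1 \notin mod_rarr (c_pivot (D + 2) D) by rewrite !inE; lia.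
  have ev2 : evs s2 = evs s1 by rewrite /evs (agreeA ha2 mD) (agreeA ha2 mD1) (agreeN ha2).
  set mu := rvar s2 9 in h1 h2 h3.
  have hmu : rvar s1 11 <= mu < rvar s1 12.
    have := search_range g2 (e := (rarr s1 D k, rarr s1 D.+1 k)); rewrite h3; apply.
    by apply/mapP; exists k => //; rewrite mem_iota.
  apply: runs_seq; apply: runs_weigh => s3 t3 ha3; rewrite ev2 (agreeR (x := 11) ha2) // (agreeR (x := 13) ha2) // -/mu => hw ht3.
  have N2 : nvar s2 3 = nvar s1 3 by rewrite (agreeN ha2).
  have ev3 : evs s3 = evs s1 by rewrite -ev2 /evs !(agreeA ha3) // (agreeN ha3).
  have [r9 r11 r14] : [/\ rvar s3 9 = mu, rvar s3 11 = rvar s1 11 & rvar s3 14 = Bd].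
    by rewrite !(agreeR ha3) // (agreeR (x := 11) ha2) // (agreeR (x := 14) ha2).
  have [r12 r13 N3] : [/\ rvar s3 12 = rvar s1 12, rvar s3 13 = rvar s1 13 & nvar s3 3 = nvar s1 3].
    by rewrite !(agreeR ha3) // !(agreeR ha2) // (agreeN ha3) // (agreeN ha2).
  have sz : size (evs s1) = nvar s1 3 by rewrite size_events.
  apply: runs_if; rewrite /= r9 r11 r14 hw => hF.
  + apply: runs_seq; apply: (@runs_filter _ (fun mu x => x <= mu)) => // s4 t4 ha4.
    rewrite r9 ev3 N3 => e4 e16 ht4; apply: runs_straight => // t5 ht5.
    have {}ht5 : (t5 <= 10)%N by apply: leq_trans ht5 _.
    set s5 := outcome _ s4.
    have [q1 q2 q3 q4] : [/\ rvar s5 11 = mu, rvar s5 13 = rvar s1 13 + \sum_(e <- evs s1 | e.1 <= mu) e.2,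
       rvar s5 12 = rvar s1 12 & rvar s5 14 = Bd].
      by rewrite /s5 /= /update /= e16 !(agreeR ha4) // r9 r13 r12 r14.
    have ev5 : evs s5 = evs s4 by [].
    have sz5 : size (evs s5) = nvar s5 3 by rewrite size_events.
    clearbody s5; split.
      split=> //; left; split=> //; rewrite q1 q2 q3 ev5 e4.
      exact: (search_right hmu hF g2).
    have hsz : (4 * nvar s5 3 <= 3 * nvar s1 3)%N.
      rewrite -sz5 ev5 e4 size_filter -sz -(count_predC (fun e => e.1 <= mu) (evs s1)).
      have := h2; rewrite -(count_events _ _ (rarr s1 D.+1)) -evsE -sz.
      rewrite -(count_predC (fun e => e.1 <= mu) (evs s1)).
      by move: (count _ _) (count _ _) => *; lia.
    by move: ht2 ht3 ht4 ht5 hsz hN; rewrite N2; clear; move: (nvar s1 3) (nvar s5 3) => *; lia.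
  + have {}hF : weighed mu (rvar s1 11) (rvar s1 13) (evs s1) < Bd * (mu - rvar s1 11) by rewrite ltNge.
    apply: runs_seq; apply: (@runs_filter _ (fun mu x => mu <= x)) => // s4 t4 ha4.
    rewrite r9 ev3 N3 => e4 _ ht4; apply: runs_straight => // t5 ht5.
    have {}ht5 : (t5 <= 10)%N by apply: leq_trans ht5 _.
    set s5 := outcome _ s4.
    have [q1 q2 q3 q4] : [/\ rvar s5 11 = rvar s1 11, rvar s5 13 = rvar s1 13, rvar s5 12 = mu & rvar s5 14 = Bd].
      by rewrite /s5 /= /update /= !(agreeR ha4) // r9 r11 r13 r14.
    have ev5 : evs s5 = evs s4 by [].
    have sz5 : size (evs s5) = nvar s5 3 by rewrite size_events.
    clearbody s5; split.
      split=> //; left; split=> //; rewrite q1 q2 q3 ev5 e4.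
      exact: (search_left hmu hF g2).
    have hsz : (4 * nvar s5 3 <= 3 * nvar s1 3)%N.
      rewrite -sz5 ev5 e4 size_filter.
      have := h1; rewrite -(count_events _ _ (rarr s1 D.+1)) -evsE.
      suff -> : count (fun e => (e.1 < mu)%R) (evs s1) = count (fun e => ~~ (mu <= e.1)%R) (evs s1) by [].
      by apply: eq_count => e /=; rewrite ltNge.
    by move: ht2 ht3 ht4 ht5 hsz hN; rewrite N2; clear; move: (nvar s1 3) (nvar s5 3) => *; lia.
- move=> s1 t1 [g1 g2] hN ht1.
  have {}hN : nvar s1 3 = 0%N by move: hN; rewrite /= -ltnNge ltnS leqn0 => /eqP.
  have ht : (t0 + t1 <= 100 * (1000 * N) + 50)%N.
    by move: ht0 ht1; rewrite /s0 /=; clear; lia.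
  case: g2 => [[Lp g2]|[-> _ ->]]; last by rewrite ltxx lexx.
  have Ev : evs s1 = [::] by rewrite evsE hN.
  rewrite Ev in g2; have [/andP[h1 h2] h3] := search_done g2.
  by split=> //; rewrite h1 ltW.
Qed.

End SearchProgram.

(** * The program for a stage *)

Section StageProgram.
Context {R : realType}.
Variable D : nat.
Implicit Types (s : state R).

Definition c_clamp : cmd :=
  If (RLe (RAdd (RVar 18) (RVar 6)) (RVar 17)) (RSetVar 17 (RAdd (RVar 18) (RVar 6))) Skip ;;
  If (RLe (RVar 17) (RSub (RVar 18) (RVar 6))) (RSetVar 17 (RSub (RVar 18) (RVar 6))) Skip.

Lemma outcome_clamp s :
  outcome c_clamp s = set_rvar s 17 (clamp (rvar s 6) (rvar s 17) (rvar s 18)).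
Proof.
have id17 s' : set_rvar s' 17 (rvar s' 17) = s'.
  apply: state_eq => //=; apply/funext => i; rewrite /update; case: eqP => // ->.
  by [].
have up v w s' : set_rvar (set_rvar s' 17 v) 17 w = set_rvar s' 17 w.
  by rewrite /set_rvar /= update_update.
set m := Num.min (rvar s 18 + rvar s 6) (rvar s 17).
rewrite /c_clamp outcome_seq.
have -> : outcome (If (RLe (RAdd (RVar 18) (RVar 6)) (RVar 17)) (RSetVar 17 (RAdd (RVar 18) (RVar 6))) Skip) s =
   set_rvar s 17 m.
  by rewrite /= /m; case: leP => h //; rewrite id17.
rewrite /= /clamp -/m [X in X <= _]/update [X in _ <= X - _]/update [X in _ - X]/update /=.
by case: leP => h //; rewrite up.
Qed.

(** On a horizontal edge the quotient has denominator 0 and evaluates to 0, so the point 1/2 is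
    chosen, as in [break]. *)
Definition c_break (a nv : nat) : cmd :=
  (RSetArr (D + 7) (NLit 0) (RSub (RGet a (NLit 0)) (RVar 6)) ;; NSetVar 12 (NLit 1)) ;;
  While (NLe (NAdd (NVar 12) (NLit 1)) (NVar nv))
    ((RSetVar 17 (RGet (D + 7) (NSub (NVar 12) (NLit 1))) ;; RSetVar 18 (RGet a (NVar 12))) ;;
     c_clamp ;;
     (RSetArr (D + 7) (NVar 12) (RVar 17) ;;
      RSetVar 19 (RDiv (RSub (RAdd (RGet a (NVar 12))
          (RSub (RGet (D + 7) (NSub (NVar 12) (NLit 1))) (RVar 17))) (RGet a (NSub (NVar 12) (NLit 1))))
        (RSub (RGet a (NVar 12)) (RGet a (NSub (NVar 12) (NLit 1)))))) ;;
     If (RLe (RVar 19) (RLit 0)) (RSetVar 19 (RDiv (RLit 1) (RLit 2)))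
       (If (RLe (RLit 1) (RVar 19)) (RSetVar 19 (RDiv (RLit 1) (RLit 2))) Skip) ;;
     RSetArr (D + 6) (NSub (NVar 12) (NLit 1)) (RVar 19) ;;
     NSetVar 12 (NAdd (NVar 12) (NLit 1))).

Lemma runs_break a nv eps s Q : (a < D)%N -> (nv <= 1)%N -> (0 < nvar s nv)%N -> rvar s 6 = eps ->
  let x := rarr s a in let n := nvar s nv in
  (forall s' t, agree (c_break a nv) s s' ->
     (forall m, (m < n)%N -> rarr s' (D + 7) m = play eps x m) ->
     (forall m, (m.+1 < n)%N -> rarr s' (D + 6) m = break eps x m) ->
     (t <= 400 * n)%N -> Q s' t) ->
  runs (c_break a nv) s Q.
Proof.
move=> aD hnv n0 heps x n hQ.
suff : runs (c_break a nv) s (fun s' t => [/\ (forall m, (m < n)%N -> rarr s' (D + 7) m = play eps x m),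
     (forall m, (m.+1 < n)%N -> rarr s' (D + 6) m = break eps x m) & (t <= 400 * n)%N]).
  by move=> /runs_agree h; apply: runs_mono h _ => s' t [ha [h1 h2 h3]]; exact: hQ.
move=> {hQ}.
have n67 : (D + 6 != D + 7)%N by lia.
have n76 : (D + 7 != D + 6)%N by lia.
have n7a : a != (D + 7)%N by lia.
have n6a : a != (D + 6)%N by lia.
apply: runs_seq; apply: runs_straight => // t0 ht0; have {}ht0 : (t0 <= 10)%N by apply: leq_trans ht0 _.
set s0 := outcome _ s.
pose I s1 := [/\ rarr s1 a = x, nvar s1 nv = n /\ rvar s1 6 = eps, (0 < nvar s1 12 <= n)%N,
  (forall m, (m < nvar s1 12)%N -> rarr s1 (D + 7) m = play eps x m) &
  (forall m, (m.+1 < nvar s1 12)%N -> rarr s1 (D + 6) m = break eps x m)].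
apply: (@runs_while _ _ _ _ I (fun s1 => 300 * (n - nvar s1 12))%N).
- split=> //.
  + by rewrite /s0 /= update_other.
  + by rewrite /s0 /= update_other //; lia.
  + by case=> // _; rewrite /s0 /= update_same update_same heps.
- move=> s1 [g1 [g2 g3] /andP[g4 g4'] g5 g6] hi; have {}hi : (nvar s1 12 < n)%N by move: hi; rewrite /= g2 addn1.
  apply: runs_straight => // t1 ht1; have {}ht1 : (t1 <= 200)%N by apply: leq_trans ht1 _.
  have [k hk] : exists k, nvar s1 12 = k.+1 by exists (nvar s1 12).-1; rewrite prednK.
  rewrite hk in g5 g6 hi *.
  rewrite outcome_seq; set s2 := outcome _ s1.
  have e2 : s2 = set_rvar (set_rvar s1 17 (play eps x k)) 18 (x k.+1).
    by rewrite /s2 /= g1 hk subn1 g5.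
  rewrite outcome_seq outcome_clamp e2.
  have -> : clamp (rvar (set_rvar (set_rvar s1 17 (play eps x k)) 18 (x k.+1)) 6)
     (rvar (set_rvar (set_rvar s1 17 (play eps x k)) 18 (x k.+1)) 17)
     (rvar (set_rvar (set_rvar s1 17 (play eps x k)) 18 (x k.+1)) 18) = play eps x k.+1.
    by rewrite /= {1}/update /= {1}/update /= g3.
  rewrite outcome_seq; clear e2 s2.
  set s2 := set_rvar _ 17 (play eps x k.+1).
  set s3 := outcome _ s2.
  have [f1 f2 f3 f4] : [/\ rvar s3 19 = (x k.+1 + (play eps x k - play eps x k.+1) - x k) / (x k.+1 - x k),
     rarr s3 = update (rarr s1) (D + 7) (update (rarr s1 (D + 7)) k.+1 (play eps x k.+1)),
     nvar s3 = nvar s1 & rvar s3 6 = eps].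
    have nk : k != k.+1 by lia.
    rewrite /s3 /s2 /= hk subn1 /=; split=> //.
    by rewrite !(update_other _ _ n7a) g1 !update_same (update_other _ _ nk) g5.
  clearbody s3; clear s2.
  rewrite outcome_seq; set s4 := outcome _ s3.
  have [h1 h2 h3 h4] : [/\ rvar s4 19 = break eps x k, rarr s4 = rarr s3, nvar s4 = nvar s1 & rvar s4 6 = eps].
    by rewrite /s4 /break /= f1; case: ifP => _ //; case: ifP.
  clearbody s4; set s5 := outcome _ s4.
  have [q1 q2 q3 q4] : [/\ nvar s5 12 = k.+2, nvar s5 nv = n, rvar s5 6 = eps &
      rarr s5 = update (rarr s4) (D + 6) (update (rarr s4 (D + 6)) k (break eps x k))].
    rewrite /s5 /= h1 h3 hk subn1 addn1; split=> //.
    by rewrite update_other ?g2 //; lia.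
  clearbody s5; split; last by rewrite q1 /=; move: ht1 hi; clear; lia.
  rewrite /I q1 q2 q3 q4 h2 f2; split=> //.
  + by rewrite !update_other.
  + move=> m; rewrite ltnS leq_eqVlt (update_other _ _ n76) update_same => /orP[/eqP ->|hm].
      by rewrite update_same.
    by rewrite update_other ?g5 //; lia.
  + move=> m; rewrite ltnS ltnS leq_eqVlt update_same (update_other _ _ n67) => /orP[/eqP ->|hm].
      by rewrite update_same.
    by rewrite update_other ?g6 //; lia.
- move=> s1 t1 [g1 [g2 g3] g4 g5 g6] hi ht1.
  have E : nvar s1 12 = n by move: hi; rewrite /= g2 addn1; lia.
  rewrite E in g5 g6; split=> //.
  by move: ht0 ht1 n0; rewrite -/n /s0 /=; clear; lia.
Qed.

(** The number of values doubles and writing in place would destroy values still to be read; hence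
    the buffer [D + 8], copied back at the end. *)
Definition c_fill (a nv : nat) (e0 e1 : rexp) (mid : cmd) (e2 : rexp) : cmd :=
  (RSetArr (D + 8) (NLit 0) e0 ;; RSetArr (D + 8) (NLit 1) e1 ;; NSetVar 12 (NLit 0) ;; NSetVar 15 (NLit 2)) ;;
  While (NLe (NAdd (NVar 12) (NLit 2)) (NVar nv))
    (mid ;; RSetArr (D + 8) (NVar 15) (RVar 17) ;; RSetArr (D + 8) (NAdd (NVar 15) (NLit 1)) e2 ;;
     NSetVar 12 (NAdd (NVar 12) (NLit 1)) ;; NSetVar 15 (NAdd (NVar 15) (NLit 2))) ;;
  NSetVar 12 (NLit 0) ;;
  While (NLe (NAdd (NVar 12) (NLit 1)) (NVar 15))
    (RSetArr a (NVar 12) (RGet (D + 8) (NVar 12)) ;; NSetVar 12 (NAdd (NVar 12) (NLit 1))).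

Definition unscratched s s' := [/\ forall b, b != (D + 8)%N -> rarr s' b = rarr s b,
  forall r, (r <= 10)%N -> rvar s' r = rvar s r & forall v, (v <= 10)%N -> nvar s' v = nvar s v].

Lemma runs_fill a nv e0 e1 mid e2 F s Q : (a < D)%N -> (nv <= 1)%N -> (0 < nvar s nv)%N ->
  straight mid -> mod_rarr mid = [::] -> mod_nvar mid = [::] ->
  (forall r, (r <= 10)%N -> r \notin mod_rvar mid) ->
  (rcost e0 <= 10)%N -> (rcost e1 <= 10)%N -> (rcost e2 <= 10)%N -> (cost mid <= 100)%N ->
  let n := nvar s nv in
  reval s e0 = F 0%N -> (forall s1, unscratched s s1 -> reval s1 e1 = F 1%N) ->
  (forall s1 i, unscratched s s1 -> nvar s1 12 = i -> (i.+1 < n)%N ->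
     rvar (outcome mid s1) 17 = F i.*2.+2 /\
     (forall s2, unscratched s s2 -> nvar s2 12 = i -> reval s2 e2 = F i.*2.+3)) ->
  (forall s' t, agree (c_fill a nv e0 e1 mid e2) s s' ->
     (forall i, (i < n.*2)%N -> rarr s' a i = F i) -> (t <= 300 * n)%N -> Q s' t) ->
  runs (c_fill a nv e0 e1 mid e2) s Q.
Proof.
move=> aD hnv n0 m1 m2 m3 m4 c0 c1 c2 cm n F0 F1 F2 hQ.
suff : runs (c_fill a nv e0 e1 mid e2) s (fun s' t =>
    (forall i, (i < n.*2)%N -> rarr s' a i = F i) /\ (t <= 300 * n)%N).
  by move=> /runs_agree h; apply: runs_mono h _ => s' t [ha [h1 h2]]; exact: hQ.
move=> {hQ}.
have na8 : a != (D + 8)%N by lia.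
have n8a : (D + 8 != a)%N by lia.
apply: runs_seq; apply: runs_straight => // t0 ht0.
have {}ht0 : (t0 <= 40)%N by apply: leq_trans ht0 _; move: c0 c1 => /=; clear; lia.
set s0 := outcome _ s.
have un0 : unscratched s s0.
  split=> // [b hb|v hv]; first by rewrite /s0 /= !(update_other _ _ hb).
  by rewrite /s0 /= !update_other //; lia.
have T0 : rarr s0 (D + 8) 0%N = F 0%N /\ rarr s0 (D + 8) 1%N = F 1%N.
  rewrite /s0 /= update_same update_same update_other // update_same update_same F0; split=> //.
  apply: F1; split=> // b hb.
  by rewrite /= (update_other _ _ hb).
have N0 : nvar s0 12 = 0%N /\ nvar s0 15 = 2 by [].
clearbody s0.
pose I s1 := [/\ unscratched s s1, nvar s1 15 = (nvar s1 12).*2.+2, (nvar s1 12 < n)%N &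
  (forall i, (i < nvar s1 15)%N -> rarr s1 (D + 8) i = F i)].
apply: runs_seq; apply: (@runs_while _ _ _ _ I (fun s1 => 200 * (n - nvar s1 12))%N).
- case: T0 N0 => h1 h2 [h3 h4]; rewrite /I h3 h4; split=> //.
  by move=> [|[]].
- move=> s1 [g1 g2 g3 g4] hi; have nn : nvar s1 nv = n by case: g1 => _ _ ->; lia.
  have {}hi : ((nvar s1 12).+1 < n)%N by move: hi; rewrite /= nn addn2.
  apply: runs_straight; first by rewrite /= m1.
  move=> t1 ht1; have {}ht1 : (t1 <= 150)%N by apply: leq_trans ht1 _; move: cm c2 => /=; clear; lia.
  have [h1 h2] := F2 s1 _ g1 erefl hi.
  rewrite outcome_seq; have ha := outcome_agree s1 m1.
  move: (outcome mid s1) h1 ha => s2 h1 ha.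
  have un2 : unscratched s s2.
    case: g1 => k1 k2 k3; split.
    + by move=> b hb; rewrite (agreeA ha) ?m2 ?k1.
    + by move=> r hr; rewrite (agreeR ha) ?m4 ?k2.
    + by move=> v hv; rewrite (agreeN ha) ?m3 ?k3.
  have [v12 v15] : nvar s2 12 = nvar s1 12 /\ nvar s2 15 = nvar s1 15 by rewrite !(agreeN ha) ?m3.
  have t8 : rarr s2 (D + 8) = rarr s1 (D + 8) by rewrite (agreeA ha) ?m2.
  clear ha.
  rewrite outcome_seq; set s3 := outcome _ s2.
  have un3 : unscratched s s3.
    case: un2 => k1 k2 k3; split=> // b hb.
    by rewrite /s3 /= (update_other _ _ hb) k1.
  have E3 := h2 s3 un3 v12.
  have r3 : rarr s3 (D + 8) = update (rarr s1 (D + 8)) (nvar s1 15) (F (nvar s1 12).*2.+2).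
    by rewrite /s3 /= update_same t8 v15 h1.
  have [w12 w15] : nvar s3 12 = nvar s1 12 /\ nvar s3 15 = nvar s1 15 by [].
  clearbody s3; set s4 := outcome _ s3.
  have un4 : unscratched s s4.
    case: un3 => k1 k2 k3; split=> // [b hb|v hv]; first by rewrite /s4 /= (update_other _ _ hb) k1.
    by rewrite /s4 /= !update_other ?k3 //; lia.
  have r4 : rarr s4 (D + 8) = update (rarr s3 (D + 8)) (nvar s1 15).+1 (F (nvar s1 12).*2.+3).
    by rewrite /s4 /= update_same E3 w15 addn1.
  have [z12 z15] : nvar s4 12 = (nvar s1 12).+1 /\ nvar s4 15 = (nvar s1 15).+2.
    have [-> ->] : nvar s4 12 = (nvar s3 12 + 1)%N /\ nvar s4 15 = (nvar s3 15 + 2)%N by [].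
    by rewrite w12 w15 addn1 addn2.
  clearbody s4; split; last by rewrite z12 /=; move: ht1 hi; clear; lia.
  rewrite /I z12 z15 r4 r3; split=> //; first by rewrite g2 doubleS.
  rewrite g2 => i hi2; have [->|ne1] := eqVneq i (nvar s1 12).*2.+3; first by rewrite update_same.
  rewrite update_other //; have [->|ne2] := eqVneq i (nvar s1 12).*2.+2; first by rewrite update_same.
  by rewrite update_other // g4 // g2; move: hi2 ne1 ne2; clear; lia.
- move=> s1 t1 [g1 g2 g3 g4] hi ht1; have nn : nvar s1 nv = n by case: g1 => _ _ ->; lia.
  have {}hi : (nvar s1 12).+1 = n by move: hi g3; rewrite /= nn addn2; clear; lia.
  have {}g2 : nvar s1 15 = n.*2 by rewrite g2 -hi doubleS.
  rewrite g2 in g4.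
  apply: runs_seq; apply: runs_straight => // t2 ht2; have {}ht2 : (t2 <= 2)%N by apply: leq_trans ht2 _.
  set s2 := outcome _ s1.
  pose J s3 := [/\ (nvar s3 12 <= n.*2)%N, nvar s3 15 = n.*2, rarr s3 (D + 8) = rarr s1 (D + 8) &
    (forall i, (i < nvar s3 12)%N -> rarr s3 a i = F i)].
  apply: (@runs_while _ _ _ _ J (fun s3 => 20 * (n.*2 - nvar s3 12))%N).
  + by [].
  + move=> s3 [k1 k2 k3 k4] hi3; have {}hi3 : (nvar s3 12 < n.*2)%N by move: hi3; rewrite /= k2 addn1.
    apply: runs_straight => // t3 ht3; have {}ht3 : (t3 <= 10)%N by apply: leq_trans ht3 _.
    set s4 := outcome _ s3.
    have [l1 l2 l3 l4] : [/\ nvar s4 12 = (nvar s3 12).+1, nvar s4 15 = n.*2, rarr s4 (D + 8) = rarr s1 (D + 8) &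
       rarr s4 a = update (rarr s3 a) (nvar s3 12) (F (nvar s3 12))].
      by rewrite /s4 /= {1}/update /= (update_other _ _ n8a) update_same k3 g4 // addn1.
    clearbody s4; split; last by rewrite l1 /=; move: ht3 hi3; clear; lia.
    rewrite /J l1 l2 l3 l4; split=> // i; rewrite ltnS leq_eqVlt => /orP[/eqP ->|him].
      by rewrite update_same.
    by rewrite update_other ?k4 //; lia.
  + move=> s3 t3 [k1 k2 k3 k4] hi3 ht3.
    have E : nvar s3 12 = n.*2 by move: hi3 k1; rewrite /= k2 addn1; clear; lia.
    rewrite E in k4; split=> //.
    move: N0 ht0 ht1 ht2 ht3 n0 hi; rewrite -/n /s2 /= => -[-> _]; clear; lia.
Qed.

End StageProgram.

(** * Loops over the coordinates *)

Section Each.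
Context {R : realType}.
Implicit Types (s : state R) (f : nat -> cmd).

(** Arrays are named by literals and [d] is a constant, so loops over coordinates are unrolled in
    the program text. *)
Definition c_each f ks : cmd := foldr (fun k c => f k ;; c) Skip ks.

Lemma runs_each f (I : nat -> state R -> Prop) T m n s Q : I m s ->
  (forall k s1, (m <= k < m + n)%N -> I k s1 -> runs (f k) s1 (fun s' t => I k.+1 s' /\ (t <= T)%N)) ->
  (forall s' t, agree (c_each f (iota m n)) s s' -> I (m + n)%N s' -> (t <= T * n + 1)%N -> Q s' t) ->
  runs (c_each f (iota m n)) s Q.
Proof.
move=> hI hf hQ.
suff : runs (c_each f (iota m n)) s (fun s' t => I (m + n)%N s' /\ (t <= T * n + 1)%N).
  by move=> /runs_agree h; apply: runs_mono h _ => s' t [ha [h1 h2]]; exact: hQ.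
move=> {hQ}; elim: n m s hI hf => [|n IH] m s hI hf /=.
  by exists s, 1%N; split; [exact: ExecSkip|rewrite addn0 muln0].
apply: runs_seq; apply: runs_mono (hf m s _ hI) _; first by rewrite leqnn addnS ltnS leq_addr.
move=> s1 t1 [h1 ht1]; apply: runs_mono (IH m.+1 s1 h1 _) _.
  by move=> k s2 hk; apply: hf; rewrite addnS -addSn; case/andP: hk => /ltnW -> ->.
by move=> s2 t2 [h2 ht2]; rewrite addnS -addSn; split=> //; rewrite mulnS; lia.
Qed.

Lemma mod_nvar_each f ks x : (forall k, k \in ks -> x \notin mod_nvar (f k)) -> x \notin mod_nvar (c_each f ks).
Proof.
elim: ks => //= k ks IH h; rewrite mem_cat negb_or h ?mem_head //=.
by apply: IH => l hl; apply: h; rewrite inE hl orbT.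
Qed.

Lemma mod_rvar_each f ks x : (forall k, k \in ks -> x \notin mod_rvar (f k)) -> x \notin mod_rvar (c_each f ks).
Proof.
elim: ks => //= k ks IH h; rewrite mem_cat negb_or h ?mem_head //=.
by apply: IH => l hl; apply: h; rewrite inE hl orbT.
Qed.

Lemma mod_rarr_each f ks x : (forall k, k \in ks -> x \notin mod_rarr (f k)) -> x \notin mod_rarr (c_each f ks).
Proof.
elim: ks => //= k ks IH h; rewrite mem_cat negb_or h ?mem_head //=.
by apply: IH => l hl; apply: h; rewrite inE hl orbT.
Qed.

(** Array cells agree with the vertices only below the current length; this and the next lemmas show
    that a stage looks no further. *)
Lemma eq_play eps (x x' : nat -> R) n m : (forall i, (i < n)%N -> x i = x' i) -> (m < n)%N ->
  play eps x m = play eps x' m.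
Proof. by move=> h; elim: m => [|m IH] hm /=; rewrite ?IH ?h // ltnW. Qed.

Lemma eq_break eps (x x' : nat -> R) n m : (forall i, (i < n)%N -> x i = x' i) -> (m.+1 < n)%N ->
  break eps x m = break eps x' m.
Proof.
move=> h hm; have hm' := ltnW hm; rewrite /break.
by rewrite !(eq_play eps h) // !h.
Qed.

Lemma even_or_odd i : [\/ i = 0%N, exists k, i = k.*2.+1 | exists k, i = k.*2.+2].
Proof.
case: i => [|i]; first exact: Or31.
by have := odd_double_half i; case: (odd i) => <-; [apply: Or33|apply: Or32]; exists i./2.
Qed.

Lemma eq_smooth eps L (x x' : nat -> R) n i : (forall i, (i < n)%N -> x i = x' i) -> (i < n.*2)%N ->
  smooth eps L x i = smooth eps L x' i.
Proof.
move=> h; case: (even_or_odd i) => [->|[k ->]|[k ->]] hi.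
- by rewrite /smooth /= h //; lia.
- by rewrite !smooth_odd; apply: eq_play h _; lia.
- have hk : (k.+1 < n)%N by lia.
  have hk' := ltnW hk; rewrite !smooth_even !(eq_play eps h) // (eq_break eps h) //.
  by rewrite !h.
Qed.

Lemma eq_refine (lam lam' z z' : nat -> R) n i : (forall i, (i < n)%N -> z i = z' i) ->
  (forall i, (i.+1 < n)%N -> lam i = lam' i) -> (i < n.*2)%N -> refine lam z i = refine lam' z' i.
Proof.
move=> h hl; case: (even_or_odd i) => [->|[k ->]|[k ->]] hi.
- by rewrite /refine /= h //; lia.
- by rewrite !refine_odd; apply: h; lia.
- have hk : (k.+1 < n)%N by lia.
  by rewrite !refine_even hl // !h // ltnW.
Qed.

End Each.

Section StageProgram.
Context {R : realType}.
Variables D d : nat.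
Implicit Types (s : state R).

Definition c_mix (a : nat) : cmd :=
  RSetVar 17 (RAdd (RGet a (NVar 12)) (RMul (RGet (D + 6) (NVar 12))
    (RSub (RGet a (NAdd (NVar 12) (NLit 1))) (RGet a (NVar 12))))).

Definition c_refine (a nv : nat) : cmd :=
  c_fill D a nv (RGet a (NLit 0)) (RGet a (NLit 0)) (c_mix a) (RGet a (NAdd (NVar 12) (NLit 1))).

Definition c_smooth (a nv : nat) : cmd :=
  c_fill D a nv (RSub (RGet a (NLit 0)) (RVar 2)) (RGet (D + 7) (NLit 0))
    ((c_mix a ;; RSetVar 18 (RVar 17) ;; RSetVar 17 (RGet (D + 7) (NVar 12))) ;; c_clamp)
    (RGet (D + 7) (NAdd (NVar 12) (NLit 1))).

Lemma runs_refine a nv lam s Q : (a < D)%N -> (nv <= 1)%N -> (0 < nvar s nv)%N ->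
  (forall m, (m.+1 < nvar s nv)%N -> rarr s (D + 6) m = lam m) ->
  (forall s' t, agree (c_refine a nv) s s' ->
     (forall i, (i < (nvar s nv).*2)%N -> rarr s' a i = refine lam (rarr s a) i) ->
     (t <= 300 * nvar s nv)%N -> Q s' t) ->
  runs (c_refine a nv) s Q.
Proof.
move=> aD hnv n0 hlam hQ.
have na8 : a != (D + 8)%N by lia.
have n68 : (D + 6)%N != (D + 8)%N by lia.
apply: (@runs_fill _ D _ _ _ _ _ _ (refine lam (rarr s a))) => //.
- by move=> r hr; rewrite !inE; lia.
- by move=> s1 [h1 _ _]; rewrite /= h1 // -[1%N]/(0.*2.+1) refine_odd.
- move=> s1 i [h1 h2 h3] hi hin; split.
    by rewrite refine_even /= {1}/update /= !h1 // hi addn1 hlam.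
  by move=> s2 [k1 _ _] hi2; rewrite /= k1 // hi2 addn1 -(refine_odd lam (rarr s a) i.+1).
Qed.

Lemma runs_smooth a nv eps s Q : (a < D)%N -> (nv <= 1)%N -> (0 < nvar s nv)%N -> rvar s 6 = eps ->
  (forall m, (m < nvar s nv)%N -> rarr s (D + 7) m = play eps (rarr s a) m) ->
  (forall m, (m.+1 < nvar s nv)%N -> rarr s (D + 6) m = break eps (rarr s a) m) ->
  (forall s' t, agree (c_smooth a nv) s s' ->
     (forall i, (i < (nvar s nv).*2)%N -> rarr s' a i = smooth eps (rvar s 2) (rarr s a) i) ->
     (t <= 300 * nvar s nv)%N -> Q s' t) ->
  runs (c_smooth a nv) s Q.
Proof.
move=> aD hnv n0 heps hy hlam hQ.
have na8 : a != (D + 8)%N by lia.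
have n68 : (D + 6)%N != (D + 8)%N by lia.
have n78 : (D + 7)%N != (D + 8)%N by lia.
apply: (@runs_fill _ D _ _ _ _ _ _ (smooth eps (rvar s 2) (rarr s a))) => //.
- by move=> r hr; rewrite !inE; lia.
- by move=> s1 [h1 _ _]; rewrite /= h1 // hy // -[1%N]/(0.*2.+1) smooth_odd.
- move=> s1 i [h1 h2 h3] hi hin; split; last first.
    by move=> s2 [k1 _ _] hi2; rewrite /= k1 // hi2 addn1 hy // -(smooth_odd eps (rvar s 2) (rarr s a) i.+1).
  rewrite outcome_seq outcome_clamp smooth_even.
  set s2 := outcome _ s1.
  have e6 : rvar s2 6 = eps by rewrite -heps -h2.
  have e17 : rvar s2 17 = rarr s1 (D + 7) (nvar s1 12) by [].
  have e18 : rvar s2 18 = rarr s1 a (nvar s1 12) + rarr s1 (D + 6) (nvar s1 12) *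
    (rarr s1 a (nvar s1 12 + 1)%N - rarr s1 a (nvar s1 12)) by [].
  clearbody s2; rewrite /= update_same e6 e17 e18 !h1 // hi addn1.
  by rewrite hlam // hy // ltnW.
Qed.

(** Breaks and play values are computed before any coordinate is overwritten, so all coordinates are
    subdivided at the same points. *)
Definition c_stage (base nv j : nat) : cmd :=
  RSetVar 6 (RGet (D + 5) (NLit j)) ;; c_break D (base + j) nv ;;
  c_each (fun k => if k == j then c_smooth (base + k) nv else c_refine (base + k) nv) (iota 0 d) ;;
  NSetVar nv (NAdd (NVar nv) (NVar nv)).

Lemma stage_nvar base nv j x : (j < d)%N -> x \notin [:: nv; 12; 15]%N -> x \notin mod_nvar (c_stage base nv j).
Proof.
rewrite !inE => hj hx.
have /negbTE e : x \notin mod_nvar (c_each (fun k => if k == j then c_smooth (base + k) nv else c_refine (base + k) nv) (iota 0 d)).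
  by apply: mod_nvar_each => k _; case: ifP => _; rewrite !inE; lia.
by rewrite /= !(mem_cat, in_cons) e !inE; lia.
Qed.

Lemma stage_rvar base nv j x : (j < d)%N -> (x <= 5)%N -> x \notin mod_rvar (c_stage base nv j).
Proof.
move=> hj hx.
have /negbTE e : x \notin mod_rvar (c_each (fun k => if k == j then c_smooth (base + k) nv else c_refine (base + k) nv) (iota 0 d)).
  by apply: mod_rvar_each => k _; case: ifP => _; rewrite !inE; lia.
by rewrite /= !(mem_cat, in_cons) e !inE; lia.
Qed.

Lemma stage_rarr base nv j x : (j < d)%N -> ~~ (base <= x < base + d)%N ->
  x \notin [:: (D + 6)%N; (D + 7)%N; (D + 8)%N] -> x \notin mod_rarr (c_stage base nv j).
Proof.
rewrite !inE => hj hx1 hx.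
have /negbTE e : x \notin mod_rarr (c_each (fun k => if k == j then c_smooth (base + k) nv else c_refine (base + k) nv) (iota 0 d)).
  by apply: mod_rarr_each => k; rewrite mem_iota => hk; case: ifP => _; rewrite !inE; lia.
by rewrite /= !(mem_cat, in_cons) e !inE; lia.
Qed.

Lemma runs_stage base nv j eps s Q : (base + d <= D)%N -> (nv <= 1)%N -> (0 < nvar s nv)%N -> (j < d)%N ->
  rarr s (D + 5) j = eps ->
  let n := nvar s nv in let z k := rarr s (base + k) in
  (forall s' t, agree (c_stage base nv j) s s' -> nvar s' nv = n.*2 ->
     (forall k i, (k < d)%N -> (i < n.*2)%N -> rarr s' (base + k) i =
        if k == j then smooth eps (rvar s 2) (z j) i else refine (break eps (z j)) (z k) i) ->
     (t <= (300 * d + 500) * n)%N -> Q s' t) ->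
  runs (c_stage base nv j) s Q.
Proof.
move=> hb hnv n0 hj heps n z hQ.
suff : runs (c_stage base nv j) s (fun s' t => [/\ nvar s' nv = n.*2,
     (forall k i, (k < d)%N -> (i < n.*2)%N -> rarr s' (base + k) i =
        if k == j then smooth eps (rvar s 2) (z j) i else refine (break eps (z j)) (z k) i) &
     (t <= (300 * d + 500) * n)%N]).
  by move=> /runs_agree h; apply: runs_mono h _ => s' t [ha [h1 h2 h3]]; exact: hQ.
move=> {hQ}.
have hjD : (base + j < D)%N by lia.
apply: runs_seq; apply: runs_straight => // t0 ht0; have {}ht0 : (t0 <= 4)%N by apply: leq_trans ht0 _.
set s0 := outcome _ s.
have [e1 e2 e3 e4] : [/\ nvar s0 = nvar s, rvar s0 6 = eps, rvar s0 2 = rvar s 2 & rarr s0 = rarr s].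
  by rewrite /s0 /= -heps.
clearbody s0; rewrite -e1 in n0.
apply: runs_seq; apply: (runs_break hjD hnv n0 e2) => s1 t1 ha1; rewrite e1 e4 -/n -/(z j) => h1 h2 ht1.
have nn1 : nvar s1 nv = n by rewrite (agreeN ha1) ?e1 // !inE; lia.
have [r6 r2] : rvar s1 6 = eps /\ rvar s1 2 = rvar s 2 by rewrite !(agreeR ha1).
have z1 k : (k < d)%N -> rarr s1 (base + k) = z k.
  by move=> hk; rewrite (agreeA ha1) ?e4 // !inE; lia.
pose I k s2 := [/\ nvar s2 nv = n, rvar s2 6 = eps /\ rvar s2 2 = rvar s 2,
  rarr s2 (D + 6) = rarr s1 (D + 6) /\ rarr s2 (D + 7) = rarr s1 (D + 7),
  (forall l, (k <= l < d)%N -> rarr s2 (base + l) = z l) &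
  (forall l i, (l < k)%N -> (l < d)%N -> (i < n.*2)%N -> rarr s2 (base + l) i =
        if l == j then smooth eps (rvar s 2) (z j) i else refine (break eps (z j)) (z l) i)].
apply: runs_seq; apply: (@runs_each _ _ I (300 * n)%N).
- by split=> // l /andP[_]; exact: z1.
- move=> k s2 /andP[_ hk] [g1 [g2 g3] [g4 g5] g6 g7]; rewrite add0n in hk.
  have hkD : (base + k < D)%N by lia.
  have nn0 : (0 < nvar s2 nv)%N by rewrite g1; move: n0; rewrite e1.
  have gk : rarr s2 (base + k) = z k by apply: g6; rewrite leqnn.
  case: ifP => hkj.
    move/eqP: hkj => hkj.
    apply: (runs_smooth hkD hnv nn0 g2).
    + by move=> m; rewrite g1 g5 gk hkj; exact: h1.
    + by move=> m; rewrite g1 g4 gk hkj; exact: h2.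
    + move=> s3 t3 ha3; rewrite g1 g3 gk => hz ht3; split=> //.
      rewrite /I (agreeN ha3) ?(agreeA (a := (D + 6)%N) ha3) ?(agreeA (a := (D + 7)%N) ha3) ?(agreeR (x := 6) ha3) ?(agreeR (x := 2) ha3) //;
        [|by rewrite !inE; lia|by rewrite !inE; lia|by rewrite !inE; lia].
      split=> //.
      * by move=> l hl; rewrite (agreeA ha3) ?g6 //; [lia|rewrite !inE; lia].
      * move=> l i; rewrite ltnS leq_eqVlt => /orP[/eqP ->|hl] hld hi.
          by rewrite hz // hkj eqxx.
        by rewrite (agreeA ha3) ?g7 // !inE; lia.
  apply: (runs_refine (lam := break eps (z j)) hkD hnv nn0).
  + by move=> m; rewrite g1 g4; exact: h2.
  + move=> s3 t3 ha3; rewrite g1 gk => hz ht3; split=> //.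
    rewrite /I (agreeN ha3) ?(agreeA (a := (D + 6)%N) ha3) ?(agreeA (a := (D + 7)%N) ha3) ?(agreeR (x := 6) ha3) ?(agreeR (x := 2) ha3) //;
        [|by rewrite !inE; lia|by rewrite !inE; lia|by rewrite !inE; lia].
    split=> //.
    * by move=> l hl; rewrite (agreeA ha3) ?g6 //; [lia|rewrite !inE; lia].
    * move=> l i; rewrite ltnS leq_eqVlt => /orP[/eqP ->|hl] hld hi.
        by rewrite hz // hkj.
      by rewrite (agreeA ha3) ?g7 // !inE; lia.
- move=> s2 t2 _ [g1 _ _ _ g7] ht2.
  apply: runs_straight => // t3 ht3; have {}ht3 : (t3 <= 4)%N by apply: leq_trans ht3 _.
  split.
  + by rewrite /= update_same g1 addnn.
  + by move=> k i hk hi; apply: g7; rewrite ?add0n.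
  + rewrite e1 -/n in n0; rewrite mulnDl; rewrite mulnAC in ht2.
    by move: ht0 ht1 ht2 ht3 n0; move: (300 * d * n)%N => w; lia.
Qed.

End StageProgram.

(** * The whole program *)

Section Choose.
Context {R : realType}.
Variables d : nat.
Implicit Types (s : state R).
Local Notation D := (d + d)%N.

Lemma agreeN_ge c s s' k v : agree c s s' -> all (leq k) (mod_nvar c) -> (v < k)%N -> nvar s' v = nvar s v.
Proof. by move=> h hc hv; apply: (agreeN h); apply/negP => /(allP hc); rewrite leqNgt hv. Qed.

Lemma agreeR_ge c s s' k v : agree c s s' -> all (leq k) (mod_rvar c) -> (v < k)%N -> rvar s' v = rvar s v.
Proof. by move=> h hc hv; apply: (agreeR h); apply/negP => /(allP hc); rewrite leqNgt hv. Qed.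

(** The prepended piece may be short from level [L - 2 * delta = (alpha - 2) * delta] on, cut off at
    0; one event serves both curves. Correspondingly [rvar 3] starts at 2, and the two passes raise
    it to [2 * n]. *)
Definition c_first : cmd :=
  (NSetVar 3 (NLit 0) ;; RSetVar 3 (RLit 2) ;;
   RSetVar 17 (RMul (RSub (RVar 0) (RLit 2)) (RVar 1))) ;;
  If (RLe (RVar 17) (RLit 0)) (RSetVar 17 (RLit 0)) Skip ;;
  If (RLe (RVar 2) (RVar 17)) Skip (c_push D (RLit 1) (RVar 17)).

Lemma outcome_first s alpha delta L : rvar s 0 = alpha -> rvar s 1 = delta -> rvar s 2 = L ->
  L = alpha * delta -> 0 <= delta -> 0 <= L ->
  let s' := outcome c_first s in
  [/\ forall eps, 0 <= eps < L -> (L - eps <= 2 * delta)%R%:R <= cov (evs D s') eps,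
      area L (evs D s') <= 2 * delta, forall e, e \in evs D s' -> 0 <= e.1 < L,
      (nvar s' 3 <= 1)%N & rvar s' 3 = 2].
Proof.
move=> h0 h1 h2 hL d0 L0 s'; pose lo : R := if (alpha - 2) * delta <= 0 then 0 else (alpha - 2) * delta.
have hlo : 0 <= lo /\ L - 2 * delta <= lo.
  have e : (alpha - 2) * delta = L - 2 * delta by rewrite hL; ring.
  by rewrite /lo e; case: (leP (L - 2 * delta) 0) => h; rewrite ?lexx ?h ?(ltW h).
have hlo2 : lo = 0 \/ lo = L - 2 * delta by rewrite /lo hL; case: ifP => _; [left|right; ring].
have [E1 E2 E3] : [/\ evs D s' = (if L <= lo then [::] else [:: (lo, 1)]), (nvar s' 3 <= 1)%N & rvar s' 3 = 2].
  rewrite /s' /c_first outcome_seq; set s1 := outcome _ s.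
  have [e1 e2 e3 e4] : [/\ nvar s1 3 = 0%N, rvar s1 17 = (alpha - 2) * delta, rvar s1 2 = L & rvar s1 3 = 2].
    by rewrite /s1 /= -h0 -h1 -h2.
  clearbody s1; rewrite outcome_seq; set s2 := outcome _ s1.
  have [f1 f2 f3 f4] : [/\ nvar s2 3 = 0%N, rvar s2 17 = lo, rvar s2 2 = L & rvar s2 3 = 2].
    by rewrite /s2 /lo /= e2; case: ifP => _ /=; rewrite ?e1 ?e3 ?e4.
  clearbody s2.
  change (outcome (If ?b ?c ?c') s2) with (if teval s2 b then outcome c s2 else outcome c' s2).
  rewrite [teval _ _]/= f2 f3; case: ifP => h.
    by split=> //=; [rewrite /evs f1|rewrite f1].
  split.
  + rewrite (_ : evs _ _ = rcons (evs D s2) (rvar s2 17, 1)); last exact: evs_push.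
    by rewrite /evs f1 f2.
  + by rewrite /= {1}/update /= f1.
  + by rewrite /= f4.
rewrite E1 E2 E3; case: leP => h; split=> //.
- move=> eps he; rewrite /cov big_nil.
  by have -> : (L - eps <= 2 * delta) = false by apply/negbTE; rewrite -ltNge; case: hlo2 => E; lra.
- by rewrite /area big_nil; lra.
- move=> eps he; rewrite /cov big_cons big_nil /= addr0.
  case: (leP lo eps) => hh; first by rewrite lern1 leq_b1.
  by have -> : (L - eps <= 2 * delta) = false by apply/negbTE; rewrite -ltNge; case: hlo2 => E; lra.
- by rewrite /area big_cons big_nil /=; lra.
- by move=> e; rewrite inE => /eqP ->; rewrite /= h; case: hlo => ->.
Qed.

Definition c_choose (j : nat) : cmd :=
  c_first ;; c_pass D j 0 ;; c_pass D (d + j) 1 ;;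
  RSetVar 14 (RDiv (RVar 3) (RVar 0)) ;; c_search D ;; RSetArr (D + 5) (NLit j) (RVar 11).

Lemma notin_search a : (a < D)%N || (a == (D + 5)%N) -> a \notin mod_rarr (c_search D).
Proof.
have /allP h : all (mem [:: D; D.+1; (D + 2)%N]) (mod_rarr (c_search D)) by rewrite /= !inE !eqxx ?orbT.
by move=> ha; apply/negP => /h; rewrite !inE; lia.
Qed.

Definition count_from eps delta (x : nat -> R) n : nat :=
  short_pieces eps delta true (x 0%N) false (x 0%N) 0 (timed [seq x i | i <- iota 1 n.-1]).

(** For [L = 0] no level lies below [L] and only the range is claimed; the theorem treats that case
    apart. *)
Definition good_level (alpha delta L : R) n (x y : nat -> R) e : Prop :=
  0 <= e <= L /\ (0 < L -> e < L /\
    ((L - e <= 2 * delta)%R%:R : R) + (count_from e delta x n)%:R + (count_from e delta y n)%:R <= 2 * n%:R / alpha).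

Lemma runs_choose j s alpha delta L n Q : (j < d)%N -> rvar s 0 = alpha -> rvar s 1 = delta ->
  rvar s 2 = L -> L = alpha * delta -> 0 < alpha -> 0 <= delta -> nvar s 0 = n -> nvar s 1 = n -> (0 < n)%N ->
  (forall s' t, (forall v, (v <= 1)%N -> nvar s' v = nvar s v) -> (forall r, (r <= 2)%N -> rvar s' r = rvar s r) ->
     (forall a, (a < D)%N -> rarr s' a = rarr s a) ->
     (forall k, k != j -> rarr s' (D + 5) k = rarr s (D + 5) k) ->
     good_level alpha delta L n (rarr s j) (rarr s (d + j)) (rarr s' (D + 5) j) ->
     (t <= 800 * (1000 * n))%N -> Q s' t) ->
  runs (c_choose j) s Q.
Proof.
move=> hj h0 h1 h2 hL a0 d0 n0 n1 npos hQ.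
have L0 : 0 <= L by rewrite hL mulr_ge0 // ltW.
have djD : (d + j < D)%N by lia.
have jD : (j < D)%N by lia.
apply: runs_seq; apply: runs_straight => // t0 ht0; have {}ht0 : (t0 <= 40)%N by apply: leq_trans ht0 _.
have [g1 g2 g3 g4 g5] := outcome_first h0 h1 h2 hL d0 L0.
have ha := outcome_agree (c := c_first) s erefl.
move: (outcome c_first s) g1 g2 g3 g4 g5 ha => s0 g1 g2 g3 g4 g5 ha.
have A0 a : (a < D)%N || (a == (D + 5)%N) -> rarr s0 a = rarr s a by move=> ?; rewrite (agreeA ha) // !inE; lia.
have N0 v : (v <= 1)%N -> nvar s0 v = nvar s v by move=> hv; rewrite (agreeN_ge (k := 2) ha).
have R0 r : (r <= 2)%N -> rvar s0 r = rvar s r by move=> hr; rewrite (agreeR_ge (k := 3) ha).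
have p0 : (0 < nvar s0 0)%N by rewrite N0 // n0.
have [d1' l1'] : rvar s0 1 = delta /\ rvar s0 2 = L by rewrite !R0.
apply: runs_seq; apply: (runs_pass jD (leq0n 1) p0 d0 L0 d1' l1' g1 g2 g3).
rewrite A0 ?jD // N0 // n0 => s1 t1 ha1; rewrite -/(count_from _ _ _ _) => k1 k2 k3 k4 k5 ht1.
have A1 a : (a < D)%N || (a == (D + 5)%N) -> rarr s1 a = rarr s a by move=> h; rewrite (agreeA ha1) ?A0 // !inE; lia.
have N1 v : (v <= 1)%N -> nvar s1 v = nvar s v by move=> hv; rewrite (agreeN_ge (k := 2) ha1) ?N0.
have R1 r : (r <= 2)%N -> rvar s1 r = rvar s r by move=> hr; rewrite (agreeR_ge (k := 3) ha1) ?R0.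
have p1 : (0 < nvar s1 1)%N by rewrite N1 // n1.
have [d2' l2'] : rvar s1 1 = delta /\ rvar s1 2 = L by rewrite !R1.
apply: runs_seq; apply: (runs_pass djD (leqnn 1) p1 d0 L0 d2' l2' k1 k2 k3).
rewrite A1 ?djD // N1 // n1 => s2 t2 ha2; rewrite -/(count_from _ _ _ _) => l1 l2 l3 l4 l5 ht2.
have A2 a : (a < D)%N || (a == (D + 5)%N) -> rarr s2 a = rarr s a by move=> h; rewrite (agreeA ha2) ?A1 // !inE; lia.
have N2 v : (v <= 1)%N -> nvar s2 v = nvar s v by move=> hv; rewrite (agreeN_ge (k := 2) ha2) ?N1.
have R2 r : (r <= 2)%N -> rvar s2 r = rvar s r by move=> hr; rewrite (agreeR_ge (k := 3) ha2) ?R1.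
apply: runs_seq; apply: runs_straight => // t3 ht3; have {}ht3 : (t3 <= 5)%N by apply: leq_trans ht3 _.
set s3 := outcome _ s2.
have nE : n%:R = 1 + n.-1%:R :> R by rewrite -{1}(prednK npos) -natr1 addrC.
have [ev3 a3 n3 [r3 r14]] : [/\ evs D s3 = evs D s2, rarr s3 = rarr s2, nvar s3 = nvar s2 &
   (forall r, (r <= 2)%N -> rvar s3 r = rvar s r) /\ rvar s3 14 = 2 * n%:R / alpha].
  split=> //; split=> [r hr|]; first by rewrite /s3 /= update_other ?R2 //; lia.
  by rewrite /s3 /= {1}/update /= l5 k5 g5 R2 // h0 nE; congr (_ / _); ring.
clearbody s3.
apply: runs_seq; apply: (runs_search (L := L) _ r14) => //; first by rewrite r3.
- by rewrite ev3.
- rewrite ev3; apply: le_trans l2 _; rewrite hL nE.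
  (* The budget [2 * n * delta] splits into [2 * delta] for the prepended piece and
     [(n - 1) * delta] for each curve. *)
  have -> : 2 * (1 + n.-1%:R) / alpha * (alpha * delta) = 2 * delta + delta * n.-1%:R + delta * n.-1%:R.
    by field; rewrite gt_eqF.
  exact: lexx.
move=> s4 t4 ha4; rewrite ev3 n3 => m1 m2 ht4.
apply: runs_straight => // t5 ht5; have {}ht5 : (t5 <= 5)%N by apply: leq_trans ht5 _.
set s5 := outcome _ s4.
have A5 : rarr s4 (D + 5) = rarr s (D + 5).
  by rewrite (agreeA ha4) ?notin_search ?a3 ?A2 ?eqxx ?orbT.
apply: hQ.
- by move=> v hv; rewrite /s5 /= (agreeN_ge (k := 2) ha4) ?n3 ?N2.
- by move=> r hr; rewrite /s5 /= (agreeR_ge (k := 3) ha4) ?r3.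
- move=> a ha'; have na : a != (D + 5)%N by move: ha'; clear; lia.
  rewrite /s5 [rarr _]/= update_other //.
  by rewrite (agreeA ha4) ?notin_search ?a3 ?A2 ?ha'.
- by move=> k hk; rewrite /s5 /= update_same update_other // A5.
- rewrite /s5 /= update_same update_same; split=> // Lp; have [q1 q2] := m2 Lp.
  split=> //; apply: le_trans q2; apply: l1.
  by case/andP: m1 => -> _.
- move: ht0 ht1 ht2 ht3 ht4 ht5 k4 l4 g4 npos; clear.
  move: (nvar s0 3) (nvar s1 3) (nvar s2 3) => *; lia.
Qed.

End Choose.

Section Stages.
Context {R : realType}.
Variables d : nat.
Implicit Types (s : state R).
Local Notation D := (d + d)%N.

Lemma runs_stages base nv eps L (p : seq 'rV[R]_d) s Q : (base + d <= D)%N -> (nv <= 1)%N -> (0 < size p)%N ->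
  nvar s nv = size p -> stores_vertices s base p -> rvar s 2 = L ->
  (forall j : 'I_d, rarr s (D + 5) j = eps j) ->
  let p' := stages eps L (enum 'I_d) p in
  (forall s' t, agree (c_each (c_stage D d base nv) (iota 0 d)) s s' -> nvar s' nv = size p' ->
     stores_vertices s' base p' -> (t <= (300 * d + 500) * (size p * 2 ^ d) * d + 1)%N -> Q s' t) ->
  runs (c_each (c_stage D d base nv) (iota 0 d)) s Q.
Proof.
move=> hb hnv hp hn hs hL he p' hQ.
pose ps k := stages eps L (take k (enum 'I_d)) p.
pose I k s1 := [/\ nvar s1 nv = size (ps k), stores_vertices s1 base (ps k), rvar s1 2 = L &
  forall j : 'I_d, rarr s1 (D + 5) j = eps j].
have spos k : (0 < size (ps k))%N by exact: size_stages_gt0.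
apply: (@runs_each _ _ I ((300 * d + 500) * (size p * 2 ^ d))%N).
- by rewrite /I /ps take0.
- move=> k s1 hk [g1 g2 g3 g4]; rewrite add0n /= in hk.
  have kd : (k < d)%N := hk.
  pose j := Ordinal kd.
  have pE : ps k.+1 = stage j (eps j) L (ps k).
    rewrite /ps (take_nth j) ?size_enum_ord // /stages foldl_rcons; congr (stage _ (eps _) _ _).
      by apply: val_inj; rewrite /= nth_enum_ord.
    by apply: val_inj; rewrite /= nth_enum_ord.
  have n0 : (0 < nvar s1 nv)%N by rewrite g1.
  apply: (runs_stage hb hnv n0 kd (g4 j)) => s2 t2 ha h1 h2 ht.
  rewrite g1 in h1 h2 ht.
  have hz (l : 'I_d) i : (i < size (ps k))%N -> rarr s1 (base + l) i = vcoord (ps k) l i by move=> /g2.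
  split; last first.
    apply: leq_trans ht _; rewrite leq_mul2l size_stages leq_mul2l leq_exp2l //.
    by rewrite size_takel ?size_enum_ord ?(ltnW kd) // !orbT.
  split.
  + by rewrite h1 pE size_stage.
  + move=> i l; rewrite pE size_stage => hi; rewrite h2 // -/(vcoord _ l i) coord_stage // g3.
    case: eqVneq => [E|ne].
      have -> : l == j by apply/eqP/val_inj.
      exact: (eq_smooth (n := size (ps k)) (eps j) L (hz j)).
    have -> : (l == j) = false by apply/negbTE.
    apply: (eq_refine (n := size (ps k))) => // [u|u]; first exact: hz.
    exact: (eq_break (n := size (ps k)) (eps j) (hz j)).
  + by rewrite (agreeR ha) // stage_rvar.
  + by move=> l; rewrite (agreeA ha) ?g4 // stage_rarr // ?inE; lia.
- move=> s' t ha [g1 g2 _ _] ht; rewrite add0n /ps in g1 g2.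
  have E : take d (enum 'I_d) = enum 'I_d by rewrite take_oversize // size_enum_ord.
  by rewrite E in g1 g2; apply: hQ.
Qed.

Lemma agree_stages base nv s s' : agree (c_each (c_stage D d base nv) (iota 0 d)) s s' ->
  [/\ forall x, x \notin [:: nv; 12; 15]%N -> nvar s' x = nvar s x,
      forall x, (x <= 5)%N -> rvar s' x = rvar s x &
      forall x, ~~ (base <= x < base + d)%N -> x \notin [:: (D + 6)%N; (D + 7)%N; (D + 8)%N] -> rarr s' x = rarr s x].
Proof.
move=> h; split=> x hx.
- rewrite (agreeN h) // mod_nvar_each // => k; rewrite mem_iota => /andP[_ kd].
  exact: (@stage_nvar _ d base nv k x kd hx).
- rewrite (agreeR h) // mod_rvar_each // => k; rewrite mem_iota => /andP[_ kd].
  exact: (@stage_rvar _ d base nv k x kd hx).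
- move=> hx2; rewrite (agreeA h) // mod_rarr_each // => k; rewrite mem_iota => /andP[_ kd].
  exact: (@stage_rarr _ d base nv k x kd hx hx2).
Qed.

End Stages.

Lemma few_short_le (R : realType) (c : R -> R) delta x y :
  few_short_pieces c delta x -> x <= y -> few_short_pieces c delta y.
Proof. by move=> [s [h1 h2]] h; exists s; split=> //; exact: le_trans h2 h. Qed.

Theorem theorem14 (R : realType) (d : nat) (hd : (1 <= d)%N) :
  exists (prog : cmd) (C : nat),
    forall (n : nat) (p q : n.-tuple 'rV[R]_d) (alpha delta : R) (s : state R),
      1 <= alpha <= n%:R -> 0 <= delta -> is_input s p q alpha delta ->
      exists (s' : state R) (t : nat) (p' q' : seq 'rV[R]_d),
        [/\ exec prog s s' t /\ (t <= C * n)%N,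
            is_output s' p' q' /\ (0 < size p')%N /\ (0 < size q')%N,
            forall j : 'I_d,
              few_short_pieces (projection (curve p') j) delta (2 * n%:R / alpha) /\
              few_short_pieces (projection (curve q') j) delta (2 * n%:R / alpha),
            frechet (curve p') (curve q') <= frechet (curve p) (curve q) &
            frechet (curve p) (curve q) <=
              frechet (curve p') (curve q') + 2 * alpha * delta].
Proof.
set D := (d + d)%N.
exists (RSetVar 2 (RMul (RVar 0) (RVar 1)) ;; c_each (c_choose d) (iota 0 d) ;;
  c_each (c_stage D d 0 0) (iota 0 d) ;; c_each (c_stage D d d 1) (iota 0 d)).
(* The first term pays for [d] level searches, the second for [d] stages on each curve, each of them
   bounded by the final size [n * 2 ^ d]. *)
exists (800 * 1000 * d + 2 * ((300 * d + 500) * 2 ^ d * d) + 10)%N.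
move=> n p q alpha delta s /andP[a1 an] d0 [[n0 n1] [r0 r1] sp sq].
rewrite !size_tuple in n0 n1.
have a0 : 0 < alpha by lra.
have npos : (0 < n)%N by rewrite -(ltr_nat R); lra.
set L := alpha * delta; have L0 : 0 <= L by rewrite mulr_ge0 // ltW.
suff [s' [t [h1 [p' [q' [h2 h3 h4 [h5 h6]]]]]]] : runs (RSetVar 2 (RMul (RVar 0) (RVar 1)) ;; c_each (c_choose d) (iota 0 d) ;;
  c_each (c_stage D d 0 0) (iota 0 d) ;; c_each (c_stage D d d 1) (iota 0 d)) s
  (fun s' t => exists p' q' : seq 'rV[R]_d, [/\ (t <= (800 * 1000 * d + 2 * ((300 * d + 500) * 2 ^ d * d) + 10) * n)%N,
    is_output s' p' q' /\ (0 < size p')%N /\ (0 < size q')%N,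
    forall j : 'I_d, few_short_pieces (projection (curve p') j) delta (2 * n%:R / alpha) /\
              few_short_pieces (projection (curve q') j) delta (2 * n%:R / alpha) &
    frechet (curve p') (curve q') <= frechet (curve p) (curve q) /\
    frechet (curve p) (curve q) <= frechet (curve p') (curve q') + 2 * alpha * delta]).
  by exists s', t, p', q'.
apply: runs_seq; apply: runs_straight => // t0 ht0; have {}ht0 : (t0 <= 4)%N by apply: leq_trans ht0 _.
set s0 := outcome _ s.
have [e1 e2 e3 [e4 e5]] : [/\ nvar s0 = nvar s, rvar s0 0 = alpha, rvar s0 1 = delta & rvar s0 2 = L /\ rarr s0 = rarr s].
  by rewrite /s0 /= /L -r0 -r1.
clearbody s0.
pose I k s1 := [/\ nvar s1 0 = n /\ nvar s1 1 = n, [/\ rvar s1 0 = alpha, rvar s1 1 = delta & rvar s1 2 = L],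
  (forall a, (a < D)%N -> rarr s1 a = rarr s a) &
  (forall j, (j < k)%N -> (j < d)%N -> good_level alpha delta L n (rarr s j) (rarr s (d + j)) (rarr s1 (D + 5) j))].
apply: runs_seq; apply: (@runs_each _ _ I (800 * (1000 * n))%N).
- by rewrite /I e1 e5.
- move=> k s1 /andP[_ kd] [[g1 g2] [g3 g4 g5] g6 g7]; rewrite add0n in kd.
  apply: (runs_choose kd g3 g4 g5 erefl a0 d0 g1 g2 npos) => s2 t2 k1 k2 k3 k4 k5 ht2.
  split=> //; split.
  + by rewrite !k1.
  + by rewrite !k2.
  + by move=> a ha; rewrite k3 ?g6.
  + move=> j; rewrite ltnS leq_eqVlt => /orP[/eqP ->|hj] jd.
      have kD : (k < D)%N by rewrite /D; lia.
      have dkD : (d + k < D)%N by rewrite /D ltn_add2l.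
      by move: k5; rewrite (g6 _ kD) (g6 _ dkD).
    by rewrite k4; [exact: g7|move: hj; clear; lia].
move=> s1 t1 _ [[g1 g2] [g3 g4 g5] g6 g7] ht1.
pose eps (j : 'I_d) := rarr s1 (D + 5) j.
have good (j : 'I_d) : good_level alpha delta L n (rarr s j) (rarr s (d + j)) (eps j) by apply: g7.
have he (j : 'I_d) : 0 <= eps j <= L by case: (good j).
have pp : (0 < size p)%N by rewrite size_tuple.
have qp : (0 < size q)%N by rewrite size_tuple.
have sp1 : stores_vertices s1 0 p by move=> i j hi; rewrite g6 ?sp // /D; have := ltn_ord j; lia.
have sq1 : stores_vertices s1 d q by move=> i j hi; rewrite g6 ?sq // /D; have := ltn_ord j; lia.
have bd0 : (0 + d <= D)%N by rewrite /D; lia.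
have bdd : (d + d <= D)%N by [].
have np1 : nvar s1 0 = size p by rewrite size_tuple.
have nq1 : nvar s1 1 = size q by rewrite size_tuple.
apply: runs_seq; apply: (runs_stages (eps := eps) bd0 _ pp np1 sp1 g5) => // s2 t2 ha2 h1 h2 ht2.
have [fn0 fr0 fa0] := agree_stages ha2.
have nq2 : nvar s2 1 = size q by rewrite fn0.
have sq2 : stores_vertices s2 d q.
  by move=> i j hi; rewrite fa0 ?sq1 // /D ?inE; have := ltn_ord j; lia.
have r22 : rvar s2 2 = L by rewrite fr0.
have he2 (j : 'I_d) : rarr s2 (D + 5) j = eps j by rewrite fa0 // /D ?inE; lia.
apply: (runs_stages bdd _ qp nq2 sq2 r22 he2) => // s3 t3 ha3 h3 h4 ht3.
have [fn1 fr1 fa1] := agree_stages ha3.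
have [F1 F2] := frechet_stages he pp qp hd.
exists (stages eps L (enum 'I_d) p), (stages eps L (enum 'I_d) q); split.
- rewrite !size_tuple in ht2 ht3.
  have {}ht2 : (t2 <= (300 * d + 500) * 2 ^ d * d * n + 1)%N by apply: leq_trans ht2 _; rewrite -!mulnA leq_add2r leq_mul2l [(n * _)%N]mulnC -!mulnA leqnn orbT.
  have {}ht3 : (t3 <= (300 * d + 500) * 2 ^ d * d * n + 1)%N by apply: leq_trans ht3 _; rewrite -!mulnA leq_add2r leq_mul2l [(n * _)%N]mulnC -!mulnA leqnn orbT.
  have {}ht1 : (t1 <= 800 * 1000 * d * n + 1)%N.
    by apply: leq_trans ht1 _; rewrite mulnA mulnAC.
  move: ht0 ht1 ht2 ht3 npos; clear.
  move: (800 * 1000 * d)%N => U; move: (_ * 2 ^ d * d)%N => W; rewrite mulnDl mulnDl -(mulnA 2).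
  by move: (U * n)%N (W * n)%N => *; lia.
- split; last by split; exact: size_stages_gt0.
  split=> //; first by rewrite fn1.
  by move=> i j hi; rewrite fa1 ?h2 // /D ?inE; have := ltn_ord j; lia.
(* [L = 0] forces [delta = 0], as [alpha] is positive; then there is at most one short piece, and
   [1 <= 2 * n / alpha]. *)
- have [Lz|Lp] := leP L 0.
    have dz : delta = 0 by apply/eqP; rewrite eq_le d0 andbT -(pmulr_rle0 _ a0).
    have h1x : 1 <= 2 * n%:R / alpha by rewrite ler_pdivlMr // mul1r; apply: le_trans an _; rewrite ler_peMl ?ler0n // ler1n.
    by move=> j; rewrite dz; split; apply: few_short_le (few_short_zero _ _) h1x; exact: size_stages_gt0.
  have dp : 0 < delta by rewrite lt_neqAle d0 andbT; apply/eqP => E; move: Lp; rewrite /L -E mulr0 ltxx.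
  have he' k : 0 <= eps k < L by have [/andP[-> _] /(_ Lp)[-> _]] := good k.
  have cP (r : seq 'rV[R]_d) x (j : 'I_d) : (0 < size r)%N -> size r = n ->
      (forall i, (i < size r)%N -> x i = r`_i ord0 j) ->
      pieces_count (eps j) delta r j true false = count_from (eps j) delta x n.
    move=> rp rn hx; rewrite /pieces_count /count_from hx // -rn; congr (short_pieces _ _ _ _ _ _ _ (timed _)).
    by apply/eq_in_map => i; rewrite mem_iota => hi; rewrite hx //; move: hi; clear; lia.
  (* The level is good for the sum of both counts and the indicator; for each curve the count of the
     other one is dropped. *)
  move=> j; have [_ /(_ Lp)[_ hg]] := good j; split.
    apply: few_short_stages => //; rewrite (cP _ (rarr s j)); [|by rewrite size_tuple|by rewrite size_tuple|by move=> i; exact: (sp i j)].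
    by apply: le_trans hg; rewrite natrD [leLHS]addrC lerDl.
  apply: few_short_stages => //; rewrite (cP _ (rarr s (d + j))); [|by rewrite size_tuple|by rewrite size_tuple|by move=> i; exact: (sq i j)].
  by apply: le_trans hg; rewrite natrD [leLHS]addrC lerD2r lerDl.
- by split=> //; rewrite -mulrA.
Qed.
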